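(* Let $k\geq0$ be an integer. (1) Work with formal power series in $(x,\lambda)$, $\lambda=(\lambda_1,\ldots,\lambda_m)$, with complex coefficients. (1a) Any formal parametric family of vector fields $\tilde{\bm{X}}(x;\lambda)$ unfolding $\tilde{\bm{X}}(x;0)=x^{k+1}\frac{1}{\omega(x)}\frac{\partial}{\partial x}$, $\omega\in\mathbb{C}[[x]]$, $\omega(0)\neq0$, is formally conjugate to a family of the form $$\bm{X}(x;\lambda)=c(\lambda)\,x\,\frac{\partial}{\partial x}\qquad\text{if }k=0,\tag{A}$$ $$\bm{X}(x;\lambda)=\frac{x^{k+1}+y_{k-1}(\lambda)x^{k-1}+\ldots+y_0(\lambda)}{1+\mu(\lambda)x^k}\,\frac{\partial}{\partial x}\qquad\text{if }k\geq1,\tag{B}$$ with $c,y_j,\mu\in\mathbb{C}[[\lambda]]$, $y_0(0)=\ldots=y_{k-1}(0)=0$, where (for $k\geq1$) $\mu(\lambda)=-\mathrm{Res}_{x=\infty}\bm{X}(x;\lambda)^{-1}$ is the sum of the residues of $\tilde{\bm{X}}(x;\lambda)^{-1}$ over its local polar locus around the origin. (1b) The normal form (A) for $k=0$ and the normal form (B) for $k=1$ are unique, while (B) for $k>1$ is unique up to the action of $x\mapsto e^{2\pi i\frac{l}{k}}x$, $y_j(\lambda)\mapsto e^{-2\pi i\frac{(j-1)l}{k}}y_j(\lambda)$, $j=0,\ldots,k-1$, $l\in\mathbb{Z}_k$. More precisely, if $\phi(x,\lambda)$ is a formal transformation, fixing $\lambda$, between two families $\bm{X}$, $\bm{X}'$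 in normal form (A) (if $k=0$) or (B) (if $k\geq1$), i.e. $\bm{X}=\phi^*\bm{X}'$, then $\phi(x,\lambda)=e^{t(\lambda)}x$ if $k=0$, and $\phi(x,\lambda)=e^{2\pi i\frac{l}{k}}\exp(t(\lambda)\bm{X})(x;\lambda)$ for some $l\in\mathbb{Z}_k$ if $k\geq1$, for some formal power series $t(\lambda)$. (1c) For $k\geq1$ and $\mu\in\mathbb{C}$, the deformation $$\bm{X}_3(x;y)=\frac{x^{k+1}+y_{k-1}x^{k-1}+\ldots+y_1x+y_0}{1+(\mu+y_{2k+1})x^k}\,\frac{\partial}{\partial x},\qquad y=(y_0,\ldots,y_{k-1},y_{2k+1}),$$ of $\bm{X}_3(x;0)=\frac{x^{k+1}}{1+\mu x^k}\frac{\partial}{\partial x}$ is universal in the formal category. (1d) In the formal real case (all series have real coefficients) the corresponding statements hold, with the normal form (B) replaced by $$\bm{X}(x;\lambda)=\frac{x^{k+1}+y_{k-1}(\lambda)x^{k-1}+\ldots+y_0(\lambda)}{(\pm1)^{k+1}+\mu(\lambda)x^k}\,\frac{\partial}{\partial x},$$ (and correspondingly the denominator $1+(\mu+y_{2k+1})x^k$ of $\bm{X}_3$ replaced by $(\pm1)^{k+1}+(\mu+y_{2k+1})x^k$), where only rotations with $e^{2\pi il/k}\in\{1,-1\}$ occur, and where for $k=0$ the conjugacies are $\phi=\pm e^{t(\lambda)}x$ with $t$ real. (2) Let $\bm{X}(x;\lambda)$, $\bm{X}'(x;\lambda)$ be two analytic germs of parametric families of vector fields, $(x,\lambda)\in(\mathbb{C}\times\mathbb{C}^m,0)$,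 unfolding vector fields of the form $x^{k+1}\frac{1}{\omega(x)}\frac{\partial}{\partial x}$ with $\omega$ analytic, $\omega(0)\neq0$. Then $\bm{X}$ and $\bm{X}'$ are formally conjugate if and only if they are analytically conjugate. Moreover, denoting by $\hat{\mathcal{I}}_\lambda$ the ideal of formal power series in $(x,\lambda)$ that vanish when $\lambda=0$, if $\hat\phi(x,\lambda)$ is a formal conjugating transformation, $\hat\phi^*\bm{X}'=\bm{X}$, then for any $n>0$ there exists an analytic conjugacy $\phi_n(x,\lambda)$, $\phi_n^*\bm{X}'=\bm{X}$, such that $\phi_n=\hat\phi\mod\hat{\mathcal{I}}_\lambda^n$.
   Context: ''Formal'' means formal power series in $(x,\lambda)$; ''analytic'' means convergent germs at the origin. Conjugacy: two families of vector fields $\bm{X}=a(x;\lambda)\frac{\partial}{\partial x}$ and $\bm{X}'=b(x';\lambda)\frac{\partial}{\partial x'}$ depending on the same parameter $\lambda$ are formally (resp. analytically) conjugate if there is a formal (resp. analytic) invertible change of coordinate $x'=\phi(x;\lambda)$ (with $\phi(0;0)=0$, $\partial_x\phi(0;0)\neq0$), preserving $\lambda$, with $b(\phi(x;\lambda);\lambda)=a(x;\lambda)\,\partial_x\phi(x;\lambda)$; one writes $\bm{X}=\phi^*\bm{X}'$. For $\bm{X}=a\frac{\partial}{\partial x}$, $\bm{X}^{-1}$ denotes the dual 1-form $\frac{dx}{a}$. For a formal family $\tilde{\bm{X}}$ as in (1a), the sum of residues of $\tilde{\bm{X}}^{-1}$ over its local polar locus is understood as the coefficient of $x^{-1}dx$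 in the expansion of $\tilde{\bm{X}}^{-1}$ as a power series in $\lambda$ with coefficients formal Laurent series in $x$ (for analytic families this equals the sum of the residues at the $k+1$ zeros, with multiplicity, merging at $x=0$ as $\lambda\to0$). $\exp(t\bm{X})(x;\lambda)=\sum_{n\geq0}\frac{t^n}{n!}\bm{X}^n.x$ is the (formal) time-$t$ flow map. In (1b), normal forms (A) are understood with $c(0)\neq0$ and (B) with $y_0(0)=\ldots=y_{k-1}(0)=0$. Deformations (formal category): a family $\bm{X}(x;\lambda)$ is a deformation of $\bm{X}(x;0)$. Two deformations of the same vector field with the same parameter are equivalent if they are formally conjugate by some $\phi$ with $\phi(x;0)\equiv x$. If $\psi(\lambda)$ is a formal map with $\psi(0)=0$ (not necessarily invertible), $\bm{X}'(x;\psi(\lambda))$ is induced from $\bm{X}'(x;\lambda')$. A deformation $\bm{X}'(x;\lambda')$ is versal if every formal deformation $\bm{X}(x;\lambda)$ (with any number of parameters) of the same vector field $\bm{X}(x;0)=\bm{X}'(x;0)$ is equivalent to one induced from it; it is universal if moreover the inducing map $\psi$ is unique. *)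

(* Defs.v *)
From HB Require Import structures.
From mathcomp Require Import all_boot all_order all_algebra.
From mathcomp Require Import complex.
From mathcomp Require Import boolp classical_sets fsbigop reals ereal esum sequences exp trigo.
(* The notations of mpoly clash with those of mathcomp-analysis. *)
From mathcomp.multinomials Require Import -(notations) mpoly.

Set Implicit Arguments.
Unset Strict Implicit.
Unset Printing Implicit Defensive.

Import Order.TTheory GRing.Theory Num.Theory.

Local Open Scope ring_scope.

(* fps K n is K[[z_0, ..., z_(n-1)]]: a series is its family of coefficients,
   indexed by the exponents of the monomials. *)
Record fps (K : Type) (n : nat) := Fps { fcoef :> multinom n -> K }.

HB.instance Definition _ (K : Type) n := [isNew for @fcoef K n].
HB.instance Definition _ (K : choiceType) n := [Choice of fps K n by <:].

Lemma fpsP (K : Type) n (f g : fps K n) : (forall a, f a = g a) -> f = g.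
Proof. by case: f g => [f] [g] /= /funext ->. Qed.

Section FpsRing.
Variables (K : fieldType) (n : nat).
Implicit Types f g h : fps K n.

Definition fps_zero : fps K n := Fps (fun=> 0).
Definition fps_opp f : fps K n := Fps (fun a => - f a).
Definition fps_add f g : fps K n := Fps (fun a => f a + g a).

Fact fps_addA : associative fps_add.
Proof. by move=> f g h; apply: fpsP => a; rewrite /= addrA. Qed.
Fact fps_addC : commutative fps_add.
Proof. by move=> f g; apply: fpsP => a; rewrite /= addrC. Qed.
Fact fps_add0 : left_id fps_zero fps_add.
Proof. by move=> f; apply: fpsP => a; rewrite /= add0r. Qed.
Fact fps_addN : left_inverse fps_zero fps_opp fps_add.
Proof. by move=> f; apply: fpsP => a; rewrite /= addNr. Qed.

HB.instance Definition _ :=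
  GRing.isZmodule.Build (fps K n) fps_addA fps_addC fps_add0 fps_addN.

Definition fpsC (c : K) : fps K n := Fps (fun a => c *+ (a == @mnm0 n)).
Definition fpsX (i : 'I_n) : fps K n := Fps (fun a => (a == mnm1 i)%:R).

Definition fps_mul f g : fps K n :=
  Fps (fun a => \sum_(k : bmultinom n (mdeg a).+1 * bmultinom n (mdeg a).+1
                      | a == mnm_add k.1 k.2) f k.1 * g k.2).

Let trunc (N : nat) f : mpoly n K := \sum_(a : bmultinom n N) f a *: mpolyX K a.

Let truncE N f a : (mdeg a < N)%N -> mcoeff a (trunc N f) = f a.
Proof. by move=> ?; rewrite /trunc mcoeff_mpoly. Qed.

Let mcoeffM_congr (p q p' q' : mpoly n K) a :
    (forall b, (mdeg b <= mdeg a)%N -> mcoeff b p = mcoeff b p') ->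
    (forall b, (mdeg b <= mdeg a)%N -> mcoeff b q = mcoeff b q') ->
  mcoeff a (p * q) = mcoeff a (p' * q').
Proof.
move=> hp hq; rewrite !mcoeffM; apply: eq_bigr => -[b c] _ /=.
by rewrite hp ?hq // -ltnS bmdeg.
Qed.

Let fps_mulE N f g a : (mdeg a < N)%N ->
  fps_mul f g a = mcoeff a (trunc N f * trunc N g).
Proof.
move=> ltaN; rewrite mcoeffM /=; apply: eq_bigr => -[b c] _ /=.
by rewrite !truncE // (leq_trans _ ltaN) ?bmdeg.
Qed.

Fact fps_mulA : associative fps_mul.
Proof.
move=> f g h; apply: fpsP => a; set N := (mdeg a).+1.
have mulT u v b : (mdeg b <= mdeg a)%N ->
    mcoeff b (trunc N (fps_mul u v)) = mcoeff b (trunc N u * trunc N v).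
  by move=> leb; rewrite truncE ?ltnS // (fps_mulE (N := N)).
rewrite !(fps_mulE (N := N)) //.
rewrite (mcoeffM_congr (p' := trunc N f) (q' := trunc N g * trunc N h)) //;
  last by move=> b /mulT.
rewrite mulrA; apply: mcoeffM_congr => // b /mulT -> //.
Qed.

Fact fps_mulC : commutative fps_mul.
Proof.
move=> f g; apply: fpsP => a.
by rewrite !(fps_mulE (N := (mdeg a).+1)) // mulrC.
Qed.

Fact fps_mul1 : left_id (fpsC 1) fps_mul.
Proof.
move=> f; apply: fpsP => a; set N := (mdeg a).+1.
rewrite (fps_mulE (N := N)) // (mcoeffM_congr (p' := 1) (q' := trunc N f)) //.
  by rewrite mul1r truncE.
by move=> b leb; rewrite truncE ?ltnS // mcoeff1.
Qed.

Fact fps_mulDl : left_distributive fps_mul fps_add.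
Proof.
move=> f g h; apply: fpsP => a; rewrite /= -big_split /=.
by apply: eq_bigr => k _; rewrite mulrDl.
Qed.

Fact fps_one_neq0 : fpsC 1 != 0.
Proof.
by apply/eqP => /(congr1 (fun f : fps K n => f mnm0)) /= /eqP; rewrite eqxx oner_eq0.
Qed.

HB.instance Definition _ := GRing.Zmodule_isComNzRing.Build (fps K n)
  fps_mulA fps_mulC fps_mul1 fps_mulDl fps_one_neq0.

Lemma fcoefD f g a : (f + g) a = f a + g a. Proof. by []. Qed.
Lemma fcoefN f a : (- f) a = - f a. Proof. by []. Qed.
Lemma fcoefM f g a : (f * g) a =
  \sum_(k : bmultinom n (mdeg a).+1 * bmultinom n (mdeg a).+1
        | a == mnm_add k.1 k.2) f k.1 * g k.2.
Proof. by []. Qed.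

Lemma fcoef_sum (I : Type) (r : seq I) (P : pred I) (F : I -> fps K n) a :
  (\sum_(i <- r | P i) F i) a = \sum_(i <- r | P i) F i a.
Proof. exact: (big_morph (fun f : fps K n => f a)). Qed.

Lemma fcoefM_congr f g f' g' a :
    (forall b, (mdeg b <= mdeg a)%N -> f b = f' b) ->
    (forall b, (mdeg b <= mdeg a)%N -> g b = g' b) ->
  (f * g) a = (f' * g') a.
Proof.
move=> hf hg; rewrite !fcoefM; apply: eq_bigr => -[b c] _ /=.
by rewrite hf ?hg // -ltnS bmdeg.
Qed.

Lemma fcoefM0 f g : (f * g) mnm0 = f mnm0 * g mnm0.
Proof.
rewrite (fps_mulE (N := 1)) ?mdeg0 //.
have /= [-> _] := mcoeff0_is_multiplicative n K.
by rewrite !truncE ?mdeg0.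
Qed.

Lemma fcoefCM c f a : (fpsC c * f) a = c * f a.
Proof.
rewrite (fps_mulE (N := (mdeg a).+1)) //.
rewrite (mcoeffM_congr (p' := mpolyC n c) (q' := trunc (mdeg a).+1 f)) //.
  by rewrite mcoeffCM truncE.
by move=> b leb; rewrite truncE ?ltnS // mcoeffC mulr_natr.
Qed.

Lemma fcoefX_small f i a : f mnm0 = 0 -> (mdeg a < i)%N -> (f ^+ i) a = 0.
Proof.
move=> f0; elim: i a => // i IHi a; rewrite ltnS => lea.
rewrite exprS fcoefM big1 // => -[[b ltb] [c ltc]] /= /eqP defa.
have [->|b_neq0] := eqVneq b mnm0; first by rewrite f0 mul0r.
rewrite IHi ?mulr0 // (leq_trans _ lea) //.
have -> : mdeg a = (mdeg b + mdeg c)%N by rewrite -mdegD -defa.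
by rewrite -[X in (X < _)%N]add0n ltn_add2r lt0n mdeg_eq0.
Qed.

Definition fps_unit : {pred fps K n} := [pred f : fps K n | f mnm0 != 0].

(* 1 / f = c * sum_i (1 - c * f) ^ i with c = 1 / f(0). *)
Definition fps_inv f : fps K n :=
  if f mnm0 == 0 then f else
    let c := fpsC (f mnm0)^-1 in
    Fps (fun a => (c * \sum_(i < (mdeg a).+1) (1 - c * f) ^+ i) a).

Fact fps_mulV : {in fps_unit, left_inverse 1 fps_inv *%R}.
Proof.
move=> f; rewrite inE => f0; rewrite /fps_inv (negbTE f0).
set c := fpsC _; set g := 1 - c * f; apply: fpsP => a.
have g0 : g mnm0 = 0.
  by rewrite fcoefD fcoefN fcoefCM mulVf //= eqxx subrr.
rewrite (@fcoefM_congr _ f (c * \sum_(i < (mdeg a).+1) g ^+ i) f) //.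
  have -> : c * (\sum_(i < (mdeg a).+1) g ^+ i) * f = 1 - g ^+ (mdeg a).+1.
    rewrite -[in RHS](expr1n _ (mdeg a).+1) subrXX.
    rewrite -mulrA mulrC -mulrA [f * c]mulrC mulrC.
    rewrite {3}/g opprB addrCA subrr addr0; congr (_ * _).
    by apply: eq_bigr => i _; rewrite expr1n mul1r.
  by rewrite fcoefD fcoefN fcoefX_small ?subr0.
move=> b leb; rewrite {1}/fcoef [LHS]fcoefCM [RHS]fcoefCM !fcoef_sum.
congr (_ * _).
rewrite (@big_ord_widen _ _ _ _ (mdeg a).+1 (fun i => (g ^+ i) b)) ?ltnS //.
rewrite big_mkcond; apply: eq_bigr => i _; case: ifP => // /negbT.
by rewrite -leqNgt => ltbi; rewrite fcoefX_small.
Qed.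

Fact fps_unitP f g : g * f = 1 -> fps_unit f.
Proof.
move=> /(congr1 (fun h : fps K n => h mnm0)); rewrite fcoefM0 /= eqxx => gf.
by apply/eqP => f0; move/eqP: gf; rewrite f0 mulr0 eq_sym oner_eq0.
Qed.

Fact fps_inv_out : {in [predC fps_unit], fps_inv =1 id}.
Proof. by move=> f; rewrite !inE negbK /fps_inv => ->. Qed.

HB.instance Definition _ := GRing.ComNzRing_hasMulInverse.Build (fps K n)
  fps_mulV fps_unitP fps_inv_out.

Lemma fps_unitE f : (f \is a GRing.unit) = (f mnm0 != 0).
Proof. by []. Qed.

End FpsRing.

(* Composition f(g_0, ..., g_(n-1)), meaningful when every g i has constant term
   0: then a product of more than mdeg a of the g i does not reach the
   coefficient a. *)
Definition fps_comp (K : fieldType) (n p : nat) (f : fps K n)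
    (g : 'I_n -> fps K p) : fps K p :=
  Fps (fun a => \sum_(b : bmultinom n (mdeg a).+1)
                   f b * (\prod_(i < n) g i ^+ (bmnm b) i) a).

(* s is the sum of the sequence u, coefficientwise and with finitely many
   nonzero terms contributing to each coefficient. *)
Definition formal_sum (K : fieldType) (n : nat) (u : nat -> fps K n)
    (s : fps K n) : Prop :=
  forall a, exists N0 : nat, forall N : nat, (N0 <= N)%N ->
    (\sum_(i < N) u i) a = s a.

(* e^t = E(t(0)) * sum_i (t - t(0))^i / i!, E being the exponential of K. *)
Definition fps_exp (K : fieldType) (n : nat) (E : K -> K) (t : fps K n) :
    fps K n :=
  fpsC n (E (t mnm0)) *
  Fps (fun a => (\sum_(i < (mdeg a).+1)
                    fpsC n (i`!%:R^-1) * (t - fpsC n (t mnm0)) ^+ i) a).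

Section Families.
Variable K : fieldType.

(* In fps K m.+1 = K[[x, lambda]], x is the variable ord0 and lambda_j is the
   variable lift ord0 j. The vector field a(x; lambda) d/dx is represented by
   the series a, and a series in lambda alone has type fps K m. *)

Definition mcons m (i : nat) (b : multinom m) : multinom m.+1 :=
  Multinom [tuple of i :: b].

Definition mtail m (a : multinom m.+1) : multinom m :=
  Multinom [tuple a (lift ord0 j) | j < m].

Definition xvar m : fps K m.+1 := fpsX K ord0.

Definition lamvar m (j : 'I_m) : fps K m.+1 := fpsX K (lift ord0 j).

Definition of_poly m (P : {poly fps K m}) : fps K m.+1 :=
  Fps (fun a => P`_(a ord0) (mtail a)).

Definition of_lam m (c : fps K m) : fps K m.+1 := of_poly c%:P.

Definition dx m (f : fps K m.+1) : fps K m.+1 :=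
  Fps (fun a => f (mnm_add a (mnm1 ord0)) *+ (a ord0).+1).

(* f(x; 0), a series in x alone. *)
Definition at_lam0 m (f : fps K m.+1) : fps K 1 :=
  Fps (fun a => f (mcons (a ord0) mnm0)).

(* f(phi; psi_1, ..., psi_p) *)
Definition subst m p (f : fps K p.+1) (phi : fps K m.+1)
    (psi : 'I_p -> fps K m.+1) : fps K m.+1 :=
  fps_comp f (fun i => if unlift ord0 i is Some j then psi j else phi).

Definition coord_change m (phi : fps K m.+1) : Prop :=
  phi mnm0 = 0 /\ dx phi mnm0 != 0.

(* X = phi^* X', for X = a d/dx and X' = b d/dx *)
Definition conjugacy m (a b phi : fps K m.+1) : Prop :=
  coord_change phi /\ subst b phi (@lamvar m) = a * dx phi.

Definition formally_conjugate m (a b : fps K m.+1) : Prop :=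
  exists phi, conjugacy a b phi.

(* exp(t X)(x; lambda) = psi, for X = a d/dx *)
Definition is_flow m (a : fps K m.+1) (t : fps K m) (psi : fps K m.+1) : Prop :=
  formal_sum (fun i => of_lam (t ^+ i) * fpsC m.+1 (i`!%:R^-1) *
                       iter i (fun f => a * dx f) (xvar m)) psi.

(* X(x; 0) = x^(k+1) / omega(x) d/dx *)
Definition unfolds m k (a : fps K m.+1) (omega : fps K 1) : Prop :=
  omega mnm0 != 0 /\ at_lam0 a = xvar 0 ^+ k.+1 / omega.

Definition nfA m (c : fps K m) : fps K m.+1 := of_lam c * xvar m.

Definition nfB_num m k (y : 'I_k -> fps K m) : {poly fps K m} :=
  'X^(k.+1) + \sum_(j < k) y j *: 'X^j.

Definition nfB_den m k (e : K) (mu : fps K m) : {poly fps K m} :=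
  (fpsC m e)%:P + mu *: 'X^k.

(* (x^(k+1) + y_(k-1) x^(k-1) + ... + y_0) / (e + mu x^k) *)
Definition nfB m k (e : K) (y : 'I_k -> fps K m) (mu : fps K m) : fps K m.+1 :=
  of_poly (nfB_num y) / of_poly (nfB_den k e mu).

(* K((x))[[lambda]] consists of the u : multinom m -> int -> K whose components
   u b are Laurent series. The inner sum of laurent_mul has finite support. *)
Definition is_laurent (v : int -> K) : Prop :=
  exists d : nat, forall i : int, i < - d%:Z -> v i = 0.

Definition laurent_mul m (a : fps K m.+1) (u : multinom m -> int -> K)
    (b : multinom m) (n : int) : K :=
  \sum_(p : bmultinom m (mdeg b).+1 * bmultinom m (mdeg b).+1
         | b == mnm_add p.1 p.2)
    \sum_(i \in [set: nat]) a (mcons i p.1) * u p.2 (n - i%:Z).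

(* r(lambda) is the coefficient of x^-1 dx in dx / a, expanded in
   K((x))[[lambda]]. *)
Definition residue_sum m (a : fps K m.+1) (r : fps K m) : Prop :=
  exists u : multinom m -> int -> K,
    [/\ forall b, is_laurent (u b),
        forall b n, laurent_mul a u b n = ((b == mnm0) && (n == 0))%:R
      & forall b, r b = u b (- 1)].

(* r is the residue at x = oo of (Q / P) dx: v is the expansion of Q / P in
   powers of 1/x, and dx = - dw / w^2 in the coordinate w = 1/x. *)
Definition residue_infty m (Q P : {poly fps K m}) (r : fps K m) : Prop :=
  exists v : int -> fps K m,
    [/\ exists d : nat, forall i : int, d%:Z < i -> v i = 0,
        forall n : int, \sum_(i < size P) P`_i * v (n - i%:Z) =
                        (if n is Posz j then Q`_j else 0)
      & r = - v (- 1)].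

(* X(x; psi(lambda)) *)
Definition induced m p (X : fps K p.+1) (psi : 'I_p -> fps K m) : fps K m.+1 :=
  subst X (xvar m) (fun j => of_lam (psi j)).

Definition equivalent_deformations m (a b : fps K m.+1) : Prop :=
  exists phi, conjugacy a b phi /\ at_lam0 phi = xvar 0.

Definition induces m p (X : fps K p.+1) (a : fps K m.+1)
    (psi : 'I_p -> fps K m) : Prop :=
  (forall j, psi j mnm0 = 0) /\ equivalent_deformations a (induced X psi).

Definition versal p (X : fps K p.+1) : Prop :=
  forall m (a : fps K m.+1), at_lam0 a = at_lam0 X ->
    exists psi : 'I_p -> fps K m, induces X a psi.

Definition universal p (X : fps K p.+1) : Prop :=
  versal X /\
  forall m (a : fps K m.+1), at_lam0 a = at_lam0 X ->
    forall psi psi' : 'I_p -> fps K m,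
      induces X a psi -> induces X a psi' -> psi = psi'.

(* The parameters are y_0, ..., y_(k-1) and, in last position, y_(2k+1). *)
Definition X3 k (e mu : K) : fps K k.+2 :=
  @nfB k.+1 k e (fun j => fpsX K (widen_ord (leqnSn k) j))
    (fpsC k.+1 mu + fpsX K ord_max).

Definition vanish_at_lam0 m (f : fps K m.+1) : Prop := at_lam0 f = 0.

Definition ideal_pow n (I : fps K n -> Prop) (N : nat) (f : fps K n) : Prop :=
  exists (r : nat) (h : 'I_r -> fps K n) (g : 'I_r -> 'I_N -> fps K n),
    (forall i j, I (g i j)) /\ f = \sum_(i < r) h i * \prod_(j < N) g i j.

End Families.

Section Complex.
Variable R : realType.
Local Open Scope complex_scope.

Definition cexp (z : R[i]) : R[i] :=
  (expR (complex.Re z))%:C *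
  (cos (complex.Im z) +i* sin (complex.Im z)).

(* e^(2 pi i q) *)
Definition cexp2pi (q : R) : R[i] := cexp (0 +i* (2 * pi * q)).

(* Absolute convergence on a polydisc around the origin. *)
Definition analytic n (f : fps R[i] n) : Prop :=
  exists2 r : R, 0 < r &
    summable [set: multinom n]
      (fun a => (ComplexField.Normc.normc (f a) * r ^+ mdeg a)%:E).

Definition analytically_conjugate m (a b : fps R[i] m.+1) : Prop :=
  exists phi, analytic phi /\ conjugacy a b phi.

End Complex.

(* Main.v *)
(* In the weights x -> 1, lambda -> k + 2, the equation for a conjugacy x + xi,
   tangent to the identity, from a family to the form (B) is a higher order
   perturbation of its linearisation at x^(k+1) d/dx,
     (k+1) x^k xi - x^(k+1) xi' + sum_(j < k) y_j x^j - mu x^(2k+1) = g.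
   On monomials this determines (xi, y, mu) from g up to the coefficient of
   x^(k+1) in xi, which is free. A fixed point argument therefore yields exactly
   one solution for each prescribed value tau(lambda) of this coefficient, and
   flows exp(t X) of the normal form realise all values of tau: two tangent
   conjugacies to normal forms of the same family differ by a flow, and the normal
   forms agree. The remaining freedom is a dilation by c, which multiplies the
   constant term of the denominator by c^k.

   In the coordinates x, lambda / x^(k+1) the Laurent series in question become
   power series; there the residue of a normal form is computed by comparing with
   logarithmic derivatives, whose residues are invariant.

   When tau is a polynomial and the family converges, the iteration preserves a
   ball of radius d r^(k+1) for the majorant norm on a small polydisc, so the
   solution converges. Truncating tau thus approximates a formal conjugacy by
   analytic ones. *)

From HB Require Import structures.
From mathcomp Require Import all_boot all_order all_algebra.
From mathcomp Require Import ring lra zify.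
From mathcomp Require Import complex.
From mathcomp Require Import boolp classical_sets cardinality fsbigop reals ereal.
From mathcomp Require Import esum sequences exp trigo.
From mathcomp.multinomials Require Import -(notations) ssrcomplements mpoly.
Require Import Defs.

Set Implicit Arguments.
Unset Strict Implicit.
Unset Printing Implicit Defensive.

Import Order.TTheory GRing.Theory Num.Theory.

Local Open Scope ring_scope.

(* Unification would otherwise unfold sums and products of series. *)
Opaque fps_add fps_opp fps_mul fps_inv.

Local Notation "a +m b" := (mnm_add a b) (at level 50, left associativity).

(* Otherwise simpl turns the coefficients of a product into sums. *)
Arguments fcoef : simpl never.

(** The linearised operator maps [x^i] to [(k+1-i) x^(i+k)]. Its image misses exactly
    [x^0, ..., x^(k-1)] and [x^(2k+1)], which is why the normal form needs the parameters [y_j] and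
    [mu] and no others; its kernel [x^(k+1)] is the direction of the flow. Uniqueness is proved
    relative to a set of lambda-exponents closed under divisors. The full set gives uniqueness of
    normal forms, the set [{0}] shows that the conjugacy of a deformation is the identity at
    [lambda = 0], and the exponents of degree below [n] give congruence modulo the [n]-th power of
    the ideal of lambda. The constant term [e] of the denominator stays arbitrary until the end, so
    that one argument serves both fields. Normalising [e] takes a [k]-th root: over the complex
    numbers it becomes 1, over the reals a sign survives when [k] is even. The case [k = 0] runs
    through the same existence argument with [mu(0) = 0], the form (B) being then [x / (e + mu)];
    uniqueness in that case is a direct comparison of coefficients. *)

Lemma FpsE (K : Type) n (F : multinom n -> K) a : Fps F a = F a. Proof. by []. Qed.

Lemma fcoef1 (K : fieldType) n a : (1 : fps K n) a = (a == @mnm0 n)%:R.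
Proof. by []. Qed.

(** * Weighted orders of formal power series *)

Section Multinomials.
Variable n : nat.
Implicit Types a b c : multinom n.

Lemma big_bmnm_widen (V : nmodType) M N (F : multinom n -> V) : (M <= N)%N ->
  (forall b, (M <= mdeg b)%N -> F b = 0) ->
  \sum_(b : bmultinom n N) F b = \sum_(b : bmultinom n M) F b.
Proof.
move=> leMN F0.
rewrite (@big_sub_widen _ _ _ _ _ _ (bmultinom n M) (bmultinom n N) xpredT F) /=;
  last by move=> x /leq_trans; apply.
rewrite [LHS](bigID (fun b : bmultinom n N => (mdeg b < M)%N)) /=.
by rewrite [X in _ + X]big1 ?addr0 // => b; rewrite -leqNgt => /F0.
Qed.

Definition wt (w : 'I_n -> nat) a := (\sum_i w i * a i)%N.

Lemma wtD w a b : wt w (a +m b) = (wt w a + wt w b)%N.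
Proof. by rewrite /wt -big_split; apply: eq_bigr => i _; rewrite mnmDE mulnDr. Qed.

Lemma wt0 w : wt w (@mnm0 n) = 0%N.
Proof. by rewrite /wt big1 // => i _; rewrite mnm0E muln0. Qed.

Lemma wt1 w i : wt w (mnm1 i) = w i.
Proof.
rewrite /wt (bigD1 i) //= mnm1E eqxx muln1 big1 ?addn0 // => j nji.
by rewrite mnm1E eq_sym (negbTE nji) muln0.
Qed.

Lemma wt_mdeg a : wt (fun=> 1%N) a = mdeg a.
Proof. by rewrite /wt mdegE; apply: eq_bigr => i _; rewrite mul1n. Qed.

Lemma leq_wt w w' a : (forall i, w i <= w' i)%N -> (wt w a <= wt w' a)%N.
Proof. by move=> le; apply: leq_sum => i _; rewrite leq_mul2r le orbT. Qed.

(** Closed under divisors of monomials. A coefficient of a product on such a set involves only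
    coefficients of the factors on the set, so agreement on [Q] is compatible with products. *)
Definition dclosed (Q : pred (multinom n)) := forall a b, Q (a +m b) -> Q b.

Lemma dclosed_predT : dclosed predT. Proof. by []. Qed.

Lemma dclosed_wt w N : dclosed (fun a => wt w a < N)%N.
Proof. by move=> a b; rewrite wtD; apply: leq_ltn_trans; rewrite leq_addl. Qed.

End Multinomials.
Hint Resolve dclosed_predT dclosed_wt : core.

Section Weights.
Variables (K : fieldType) (n : nat) (Q : pred (multinom n)) (w : 'I_n -> nat).
Hypothesis dQ : dclosed Q.
Implicit Types f g u v : fps K n.

(** The bound [N] does not depend on [a], so that sums over [a] and over the exponents of the
    factors can be exchanged. *)
Lemma fcoefM_wide N f g a : (mdeg a < N)%N ->
  (f * g) a = \sum_(b : bmultinom n N) \sum_(c : bmultinom n N | a == b +m c)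
                 f b * g c.
Proof.
move=> lt_aN; rewrite fcoefM.
rewrite -(pair_big_dep xpredT (fun b c : bmultinom n _ => a == b +m c)
            (fun b c : bmultinom n _ => f b * g c)) /=.
pose F (b c : multinom n) := if a == b +m c then f b * g c else 0.
have F0 b c : (mdeg a < mdeg b + mdeg c)%N -> F b c = 0.
  by rewrite /F; case: eqP => // ->; rewrite mdegD ltnn.
transitivity (\sum_(b : bmultinom n N) \sum_(c : bmultinom n N) F b c).
  rewrite (@big_bmnm_widen _ _ (mdeg a).+1 N (fun b => \sum_(c : bmultinom n N) F b c)) //;
    last by move=> b leb; rewrite big1 // => c _; rewrite F0 // (leq_trans leb) ?leq_addr.
  apply: eq_bigr => b _; rewrite big_mkcond.
  by rewrite -(@big_bmnm_widen _ _ (mdeg a).+1 N (F b)) // => c lec;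
     rewrite F0 // (leq_trans lec) ?leq_addl.
by apply: eq_bigr => b _; rewrite [RHS]big_mkcond.
Qed.

Lemma fcoefM_eq0 f g a :
  (forall b c, a = b +m c -> f b = 0 \/ g c = 0) -> (f * g) a = 0.
Proof.
move=> fg0; rewrite fcoefM big1 // => -[b c] /= /eqP /fg0[]->; rewrite ?mul0r //.
by rewrite mulr0.
Qed.

Definition vge N f := forall a, Q a -> (wt w a < N)%N -> f a = 0.
Definition wge N f := forall a, (wt w a < N)%N -> f a = 0.

Lemma wge0 N : wge N 0. Proof. by []. Qed.
Lemma wge_0 f : wge 0 f. Proof. by []. Qed.
Lemma vgeW N M f : (M <= N)%N -> vge N f -> vge M f.
Proof. by move=> leMN h a Qa lt; rewrite h // (leq_trans lt). Qed.
Lemma wgeW N M f : (M <= N)%N -> wge N f -> wge M f.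
Proof. by move=> leMN h a lt; rewrite h // (leq_trans lt). Qed.
Lemma vgeD N f g : vge N f -> vge N g -> vge N (f + g).
Proof. by move=> hf hg a Qa lt; rewrite fcoefD hf ?hg ?addr0. Qed.
Lemma wgeD N f g : wge N f -> wge N g -> wge N (f + g).
Proof. by move=> hf hg a lt; rewrite fcoefD hf ?hg ?addr0. Qed.
Lemma vgeN N f : vge N f -> vge N (- f).
Proof. by move=> hf a Qa lt; rewrite fcoefN hf ?oppr0. Qed.
Lemma wgeN N f : wge N f -> wge N (- f).
Proof. by move=> hf a lt; rewrite fcoefN hf ?oppr0. Qed.
Lemma vge_sum N I (r : seq I) (P : pred I) (F : I -> fps K n) :
  (forall i, P i -> vge N (F i)) -> vge N (\sum_(i <- r | P i) F i).
Proof. by move=> h; elim/big_ind: _ => //; exact: vgeD. Qed.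
Lemma wge_sum N I (r : seq I) (P : pred I) (F : I -> fps K n) :
  (forall i, P i -> wge N (F i)) -> wge N (\sum_(i <- r | P i) F i).
Proof. by move=> h; elim/big_ind: _ => //; exact: wgeD. Qed.

Lemma vgeM N p f g : wge p f -> vge N g -> vge (p + N) (f * g).
Proof.
move=> hf hg a Qa lta; apply: fcoefM_eq0 => b c defa.
have [ltb|leb] := ltnP (wt w b) p; first by left; apply: hf.
right; apply: hg; first by apply: (dQ (a := b)); rewrite -defa.
by move: lta; rewrite defa wtD; lia.
Qed.
Lemma wgeM N p f g : wge p f -> wge N g -> wge (p + N) (f * g).
Proof.
move=> hf hg a lta; apply: fcoefM_eq0 => b c defa.
have [ltb|leb] := ltnP (wt w b) p; first by left; apply: hf.
by right; apply: hg; move: lta; rewrite defa wtD; lia.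
Qed.
Lemma wgeX p f i : wge p f -> wge (i * p) (f ^+ i).
Proof. by move=> hf; elim: i => // i IHi; rewrite exprS mulSn; apply: wgeM. Qed.
Lemma wge_prod I (r : seq I) (P : pred I) (p : I -> nat) (F : I -> fps K n) :
  (forall i, P i -> wge (p i) (F i)) ->
  wge (\sum_(i <- r | P i) p i)%N (\prod_(i <- r | P i) F i).
Proof. by move=> h; elim/big_ind2: _ => // *; exact: wgeM. Qed.
Lemma wgeX1 i : wge (w i) (fpsX K i).
Proof. by move=> a; rewrite FpsE; case: eqP => // ->; rewrite wt1 ltnn. Qed.
Lemma wgeCM N c f : wge N f -> wge N (fpsC n c * f).
Proof. by move=> h a lt; rewrite fcoefCM h ?mulr0. Qed.

(** [s] is a relative precision: beyond their common order [p], the two series agree on [Q] for [s]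
    further orders. Products add the [p] and keep [s], and a contraction is a map that raises
    [s]. *)
Definition near p s u u' := [/\ wge p u, wge p u' & vge (p + s) (u - u')].

Lemma near_refl p s u : wge p u -> near p s u u.
Proof. by move=> h; split=> //; rewrite subrr. Qed.
Lemma nearW p s q r u u' : (q <= p)%N -> (q + r <= p + s)%N ->
  near p s u u' -> near q r u u'.
Proof. by move=> le1 le2 [h1 h2 h3]; split; [exact: wgeW h1|exact: wgeW h2|exact: vgeW h3]. Qed.
Lemma nearD p s u u' v v' : near p s u u' -> near p s v v' ->
  near p s (u + v) (u' + v').
Proof.
move=> [h1 h2 h3] [k1 k2 k3]; split; [exact: wgeD|exact: wgeD|].
by rewrite opprD addrACA; apply: vgeD.
Qed.
Lemma nearN p s u u' : near p s u u' -> near p s (- u) (- u').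
Proof.
move=> [h1 h2 h3]; split; [exact: wgeN|exact: wgeN|].
by rewrite -opprD; apply: vgeN.
Qed.
Lemma nearB p s u u' v v' : near p s u u' -> near p s v v' ->
  near p s (u - v) (u' - v').
Proof. by move=> h1 /nearN; apply: nearD. Qed.
Lemma nearM p q s u u' v v' : near p s u u' -> near q s v v' ->
  near (p + q) s (u * v) (u' * v').
Proof.
move=> [h1 h2 h3] [k1 k2 k3]; split; [exact: wgeM|exact: wgeM|].
have -> : u * v - u' * v' = u * (v - v') + v' * (u - u') by ring.
apply: vgeD; first by rewrite -addnA; apply: vgeM.
by rewrite addnAC addnC; apply: vgeM.
Qed.
Lemma nearX p s u u' i : near p s u u' -> near (i * p) s (u ^+ i) (u' ^+ i).
Proof.
move=> h; elim: i => [|i IHi]; first by rewrite !expr0; apply: near_refl.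
by rewrite !exprS mulSn; apply: nearM.
Qed.
Lemma near_sum p s I (r : seq I) (P : pred I) (F F' : I -> fps K n) :
  (forall i, P i -> near p s (F i) (F' i)) ->
  near p s (\sum_(i <- r | P i) F i) (\sum_(i <- r | P i) F' i).
Proof.
move=> h; elim/big_ind2: _ => //; first exact: near_refl.
by move=> *; apply: nearD.
Qed.
Lemma near_prod s I (r : seq I) (P : pred I) (p : I -> nat) (F F' : I -> fps K n) :
  (forall i, P i -> near (p i) s (F i) (F' i)) ->
  near (\sum_(i <- r | P i) p i)%N s (\prod_(i <- r | P i) F i)
    (\prod_(i <- r | P i) F' i).
Proof.
move=> h; elim/big_ind3: _ => //; first exact: near_refl.
by move=> *; apply: nearM.
Qed.

End Weights.

Notation deg1 := (fun=> 1%N).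

Lemma ord1_mdeg (K : fieldType) n (f : fps K n) : wge deg1 1 f <-> f mnm0 = 0.
Proof.
split=> [|f0 a]; first by apply; rewrite wt0.
by rewrite wt_mdeg ltnS leqn0 mdeg_eq0 => /eqP ->.
Qed.

(** * Composition of power series *)

Section Comp.
Variables (K : fieldType) (n p : nat).
Implicit Types f g : fps K n.

Lemma mmap1D (h : 'I_n -> fps K p) a b :
  mmap1 h (a +m b) = mmap1 h a * mmap1 h b.
Proof.
rewrite /mmap1 -big_split; apply: eq_bigr => i _.
by rewrite mnmDE exprD.
Qed.

Lemma wge_mmap1 (w : 'I_n -> nat) (w' : 'I_p -> nat) (h : 'I_n -> fps K p) b :
  (forall i, wge w' (w i) (h i)) -> wge w' (wt w b) (mmap1 h b).
Proof.
move=> hh; apply: wge_prod => i _.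
by rewrite mulnC; apply: wgeX.
Qed.

Lemma near_mmap1 Q (w : 'I_n -> nat) (w' : 'I_p -> nat) s (h h' : 'I_n -> fps K p) b :
  dclosed Q ->
  (forall i, near Q w' (w i) s (h i) (h' i)) ->
  near Q w' (wt w b) s (mmap1 h b) (mmap1 h' b).
Proof.
move=> dQ hh; apply: near_prod => // i _.
by rewrite mulnC; apply: nearX.
Qed.

Section Fixed.
Variable h : 'I_n -> fps K p.
Hypothesis h0 : forall i, h i mnm0 = 0.

Lemma mmap1_small b a : (mdeg a < mdeg b)%N -> mmap1 h b a = 0.
Proof.
move=> lt; apply: (@wge_mmap1 deg1 deg1); rewrite ?wt_mdeg // => i.
exact/ord1_mdeg.
Qed.

Lemma fcompE N f a : (mdeg a < N)%N ->
  fps_comp f h a = \sum_(b : bmultinom n N) f b * mmap1 h b a.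
Proof.
move=> ltN; rewrite (@big_bmnm_widen _ _ (mdeg a).+1 N (fun b => f b * mmap1 h b a)) //.
by move=> b lt; rewrite mmap1_small ?mulr0.
Qed.

Definition fcomp_trunc N f : fps K p :=
  \sum_(b : bmultinom n N) fpsC p (f b) * mmap1 h b.

Lemma fcomp_truncE N f a : (mdeg a < N)%N -> fps_comp f h a = fcomp_trunc N f a.
Proof.
move=> ltN; rewrite (fcompE _ ltN) fcoef_sum; apply: eq_bigr => b _.
by rewrite fcoefCM.
Qed.

Lemma fcompD f g : fps_comp (f + g) h = fps_comp f h + fps_comp g h.
Proof.
apply: fpsP => a; rewrite fcoefD !FpsE -big_split; apply: eq_bigr => b _.
by rewrite fcoefD mulrDl.
Qed.

Lemma fcompN f : fps_comp (- f) h = - fps_comp f h.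
Proof.
apply: fpsP => a; rewrite fcoefN !FpsE -sumrN; apply: eq_bigr => b _.
by rewrite fcoefN mulNr.
Qed.

(** Both series may be truncated at [N] without changing the coefficient at [a]. The surplus
    products of monomials, of degree at least [N], vanish at [a] because every [h i] has order 1. *)
Lemma fcompM f g : fps_comp (f * g) h = fps_comp f h * fps_comp g h.
Proof.
apply: fpsP => a; pose N := (mdeg a).+1.
rewrite [RHS](@fcoefM_congr _ _ _ _ (fcomp_trunc N f) (fcomp_trunc N g));
  try by move=> b leb; rewrite (@fcomp_truncE N).
rewrite (@fcompE N) // /fcomp_trunc big_distrlr /= fcoef_sum.
under eq_bigr => b _ do rewrite (@fcoefM_wide _ _ N) ?bmdeg // mulr_suml.
rewrite exchange_big /=; apply: eq_bigr => c _.
under eq_bigr => b _ do rewrite mulr_suml.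
rewrite fcoef_sum; under eq_bigr => b _ do rewrite big_mkcond /=.
rewrite exchange_big /=; apply: eq_bigr => d _.
have -> : (fpsC p (f c) * mmap1 h c * (fpsC p (g d) * mmap1 h d)) =
          fpsC p (f c) * (fpsC p (g d) * mmap1 h (c +m d)).
  by rewrite mmap1D; ring.
rewrite !fcoefCM; have [ltN|leN] := ltnP (mdeg (c +m d)) N; last first.
  rewrite mmap1_small ?mulr0 ?big1 // => b _; case: eqP => // eqb.
  by move: (bmdeg b); rewrite eqb ltnNge leN.
rewrite (bigD1 (BMultinom ltN)) //= eqxx big1 ?addr0 ?mulrA // => b nb.
by case: eqP => // eqb; case/eqP: nb; apply/val_inj.
Qed.

Lemma fcompC c : fps_comp (fpsC n c) h = fpsC p c.
Proof.
apply: fpsP => a; rewrite (@fcompE (mdeg a).+1) // (bigD1 (@bm0 n _)) //= FpsE eqxx mulr1n.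
rewrite big1 ?addr0 => [|b nb]; last first.
  by rewrite FpsE (_ : (b == mnm0 :> multinom n) = false) ?mulr0n ?mul0r //; apply/negbTE.
by rewrite mmap11 fcoef1 mulr_natr.
Qed.

Lemma fcomp1 : fps_comp 1 h = 1. Proof. exact: fcompC. Qed.

Lemma fcompX i : fps_comp (fpsX K i) h = h i.
Proof.
apply: fpsP => a; rewrite (@fcompE (mdeg a).+2) //.
have lt1 : (mdeg (mnm1 i) < (mdeg a).+2)%N by rewrite mdeg1.
rewrite (bigD1 (BMultinom lt1)) //= FpsE eqxx mul1r mmap1U big1 ?addr0 // => b nb.
by rewrite FpsE (_ : (b == mnm1 i :> multinom n) = false) ?mul0r //; apply/negbTE.
Qed.

Lemma fcomp0 f : fps_comp f h mnm0 = f mnm0.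
Proof.
rewrite (@fcompE 1) ?mdeg0 // (bigD1 (@bm0 n _)) //= big1 ?addr0 => [|b nb].
  by rewrite mmap11 fcoef1 eqxx mulr1.
rewrite mmap1_small ?mulr0 // mdeg0 lt0n mdeg_eq0.
by apply: contra nb => /eqP b0; apply/eqP/val_inj.
Qed.

End Fixed.

Lemma wge_fcomp (w : 'I_n -> nat) (w' : 'I_p -> nat) (h : 'I_n -> fps K p) N f :
  (forall i, wge w' (w i) (h i)) -> wge w N f -> wge w' N (fps_comp f h).
Proof.
move=> hh hf a lta; rewrite FpsE big1 // => b _.
have [ltb|leb] := ltnP (wt w b) N; first by rewrite hf ?mul0r.
by rewrite (wge_mmap1 hh) ?mulr0 // (leq_trans lta).
Qed.

Lemma near_fcomp Q (w : 'I_n -> nat) (w' : 'I_p -> nat) (h h' : 'I_n -> fps K p) N s f :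
  dclosed Q ->
  (forall i, near Q w' (w i) s (h i) (h' i)) -> wge w N f ->
  near Q w' N s (fps_comp f h) (fps_comp f h').
Proof.
move=> dQ hh hf; split.
- by apply: wge_fcomp hf => i; case: (hh i).
- by apply: wge_fcomp hf => i; case: (hh i).
move=> a Qa lta; rewrite fcoefD fcoefN !FpsE -sumrB big1 // => b _.
rewrite -mulrBr; have [ltb|leb] := ltnP (wt w b) N; first by rewrite hf ?mul0r.
have [_ _ hb] := near_mmap1 b dQ hh.
have := hb a Qa; rewrite fcoefD fcoefN => ->; rewrite ?mulr0 //.
by rewrite (leq_trans lta) // leq_add2r.
Qed.

Lemma eq_fcomp (h h' : 'I_n -> fps K p) f : h =1 h' -> fps_comp f h = fps_comp f h'.
Proof. by move=> /funext ->. Qed.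

End Comp.

Section FpsC.
Variables (K : fieldType) (n : nat).

Fact fpsC_zmod_morphism : zmod_morphism (@fpsC K n).
Proof. by move=> c d; apply: fpsP => a; rewrite fcoefD fcoefN !FpsE mulrnBl. Qed.

Fact fpsC_monoid_morphism : monoid_morphism (@fpsC K n).
Proof.
split=> // c d; apply: fpsP => a.
by rewrite fcoefCM !FpsE -mulrnAr.
Qed.

HB.instance Definition _ := GRing.isZmodMorphism.Build K (fps K n) (@fpsC K n)
  fpsC_zmod_morphism.
HB.instance Definition _ := GRing.isMonoidMorphism.Build K (fps K n) (@fpsC K n)
  fpsC_monoid_morphism.

Lemma fcoefC (c : K) (a : multinom n) : fpsC n c a = c *+ (a == mnm0).
Proof. by []. Qed.

Lemma fcoef0 (a : multinom n) : (0 : fps K n) a = 0. Proof. by []. Qed.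

Lemma fcoefMn (f : fps K n) i (a : multinom n) : (f *+ i) a = f a *+ i.
Proof. by elim: i => [|i IHi]; rewrite ?mulr0n // !mulrS fcoefD IHi. Qed.

End FpsC.

Section Monomials.
Variables (K : fieldType) (n : nat).
Implicit Types (a b c : multinom n) (f g : fps K n).

Definition fmon b : fps K n := Fps (fun a => (a == b)%:R).

Lemma fcoef_fmonM b f a :
  (fmon b * f) a = if lem b a then f (mnm_sub a b) else 0.
Proof.
pose N := (maxn (mdeg a) (mdeg b)).+1.
have ltb : (mdeg b < N)%N by rewrite ltnS leq_maxr.
rewrite (@fcoefM_wide _ _ N); last by rewrite ltnS leq_maxl.
rewrite (bigD1 (BMultinom ltb)) //= [X in _ + X]big1 ?addr0 => [|c nc]; last first.
  rewrite big1 // => d _; rewrite FpsE (_ : (c == b :> multinom n) = false) ?mul0r //.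
  by apply/negbTE.
rewrite FpsE eqxx; case: ifP => leba; last first.
  rewrite big1 // => c /eqP defa; move: leba; rewrite defa => /negP[].
  by apply/mnm_lepP => i; rewrite mnmDE leq_addr.
have lts : (mdeg (mnm_sub a b) < N)%N.
  by rewrite ltnS leq_max (leq_trans (mdegB _ _)).
rewrite (bigD1 (BMultinom lts)) /=; last by rewrite addmC submK.
rewrite mul1r big1 ?addr0 // => c /andP[/eqP defa nc]; case/eqP: nc.
by apply/val_inj; rewrite /= defa addmC addmK.
Qed.

Lemma fcoef_fmonMD b f a : (fmon b * f) (b +m a) = f a.
Proof.
rewrite fcoef_fmonM (_ : lem b _); first by rewrite addmC addmK.
by apply/mnm_lepP => i; rewrite mnmDE leq_addr.
Qed.

Lemma fmonI b f g : fmon b * f = fmon b * g -> f = g.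
Proof. by move=> e; apply: fpsP => a; rewrite -(fcoef_fmonMD b) e fcoef_fmonMD. Qed.

Lemma fmonM b c : fmon b * fmon c = fmon (b +m c).
Proof.
apply: fpsP => a; rewrite fcoef_fmonM !FpsE; case: ifP => [leba|].
  by congr (_ %:R); rewrite -{2}(submK leba) [b +m c]addmC eqm_add2r.
case: eqP => // -> /negP[].
by apply/mnm_lepP => i; rewrite mnmDE leq_addr.
Qed.

Lemma fmonX b i : fmon b ^+ i = fmon (mnm_muln b i).
Proof. by elim: i => [|i IHi]; rewrite ?expr0 ?mulm0n // exprS mulmS -fmonM IHi. Qed.

Lemma mmap1_fpsX b : mmap1 (@fpsX K n) b = fmon b.
Proof.
rewrite /mmap1 [in RHS](multinomUE_id b).
rewrite (big_morph fmon (id1 := 1) (op1 := *%R)) => [|x y|] //; last by rewrite fmonM.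
by apply: eq_bigr => i _; rewrite -fmonX.
Qed.

Lemma fcoef_trunc N f a :
  (\sum_(b : bmultinom n N) fpsC n (f b) * fmon b) a =
  if (mdeg a < N)%N then f a else 0.
Proof.
rewrite fcoef_sum; under eq_bigr => b _ do rewrite fcoefCM FpsE.
case: ltnP => [lt|le].
  rewrite (bigD1 (BMultinom lt)) //= eqxx mulr1 big1 ?addr0 // => b nb.
  rewrite (_ : (a == b :> multinom n) = false) ?mulr0 //.
  by apply: contraNF nb => /eqP eab; apply/eqP/val_inj.
rewrite big1 // => b _; case: eqP => [eab|]; rewrite ?mulr0 //.
by move: (bmdeg b); rewrite -eab ltnNge le.
Qed.

Lemma fcomp_id f : fps_comp f (@fpsX K n) = f.
Proof.
apply: fpsP => a; rewrite (@fcomp_truncE _ _ _ _ _ (mdeg a).+1) //.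
  rewrite /fcomp_trunc; under eq_bigr => b _ do rewrite mmap1_fpsX.
  by rewrite fcoef_trunc ltnSn.
move=> i; rewrite FpsE; case: eqP => // /(congr1 (@mdeg n)).
by rewrite mdeg0 mdeg1.
Qed.

(** An induction principle: a continuous identity whose validity is stable under sums and products
    need only be checked on constants and variables. *)
Lemma fps_approx (P : fps K n -> Prop) :
  (forall f g, P f -> P g -> P (f + g)) -> (forall f g, P f -> P g -> P (f * g)) ->
  (forall c : K, P (fpsC n c)) -> (forall i, P (fpsX K i)) ->
  forall N f, exists2 g, P g & wge deg1 N (f - g).
Proof.
move=> PD PM PC PX N f; exists (\sum_(b : bmultinom n N) fpsC n (f b) * fmon b).
  elim/big_ind: _ => // [|b _]; first by rewrite -(rmorph0 (fpsC n)); apply: PC.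
  apply: (PM) => //; rewrite -mmap1_fpsX /mmap1.
  have P1 : P 1 by rewrite -(rmorph1 (fpsC n)); apply: PC.
  elim/big_ind: _ => // i _; elim: (b i) => // j Pj.
  by rewrite exprS; apply: PM.
move=> a; rewrite wt_mdeg fcoefD fcoefN fcoef_trunc => ->.
by rewrite subrr.
Qed.

End Monomials.

Lemma wge_deg1 (K : fieldType) n (w : 'I_n -> nat) N (f : fps K n) :
  (forall i, 0 < w i)%N -> wge deg1 N f -> wge w N f.
Proof.
by move=> w0 hf a lta; apply: hf; apply: leq_ltn_trans lta; apply: leq_wt.
Qed.

Lemma fps_eq_wge (K : fieldType) n (w : 'I_n -> nat) (f g : fps K n) :
  (forall N, wge w N (f - g)) -> f = g.
Proof.
move=> h; apply: fpsP => a; apply/eqP; rewrite -subr_eq0.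
by rewrite -fcoefN -fcoefD (h (wt w a).+1).
Qed.

(** By density of the polynomials. Positive weights turn approximation in degree into approximation
    in weight, for which both maps are continuous. *)
Lemma fps_morph_ext (K : fieldType) n p (w : 'I_n -> nat) (w' : 'I_p -> nat)
    (F G : fps K n -> fps K p) :
  (forall i, 0 < w i)%N ->
  (forall N f g, wge w N (f - g) -> wge w' N (F f - F g)) ->
  (forall N f g, wge w N (f - g) -> wge w' N (G f - G g)) ->
  (forall f g, F (f + g) = F f + F g) -> (forall f g, F (f * g) = F f * F g) ->
  (forall f g, G (f + g) = G f + G g) -> (forall f g, G (f * g) = G f * G g) ->
  (forall c, F (fpsC n c) = G (fpsC n c)) ->
  (forall i, F (fpsX K i) = G (fpsX K i)) ->
  F =1 G.
Proof.
move=> w0 cF cG FD FM GD GM FGC FGX f; apply: (@fps_eq_wge _ _ w') => N.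
have [g Eg fg] : exists2 g, F g = G g & wge deg1 N (f - g).
  by apply: fps_approx => // g h Eg Eh; rewrite ?FD ?GD ?FM ?GM Eg Eh.
have {}fg := wge_deg1 w0 fg.
rewrite (_ : _ - _ = (F f - F g) - (G f - G g)); last by rewrite Eg; ring.
by apply: wgeD; [exact: cF|apply: wgeN; exact: cG].
Qed.

Section CompMorph.
Variables (K : fieldType) (n p : nat) (h : 'I_n -> fps K p).
Hypothesis h0 : forall i, h i mnm0 = 0.
Implicit Types f g : fps K n.

Lemma fcompB f g : fps_comp (f - g) h = fps_comp f h - fps_comp g h.
Proof. by rewrite fcompD fcompN. Qed.

Lemma fcompXn f i : fps_comp (f ^+ i) h = fps_comp f h ^+ i.
Proof. by elim: i => [|i IHi]; rewrite ?expr0 ?fcomp1 // !exprS fcompM // IHi. Qed.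

Lemma fcomp_sum I (r : seq I) (P : pred I) (F : I -> fps K n) :
  fps_comp (\sum_(i <- r | P i) F i) h = \sum_(i <- r | P i) fps_comp (F i) h.
Proof.
apply: (big_morph (fun f => fps_comp f h)) => [f g|]; first exact: fcompD.
by rewrite -(rmorph0 (fpsC n)) fcompC // rmorph0.
Qed.

Lemma fcomp_comp q (h' : 'I_p -> fps K q) f : (forall i, h' i mnm0 = 0) ->
  fps_comp (fps_comp f h) h' = fps_comp f (fun i => fps_comp (h i) h').
Proof.
move=> h'0; pose k i := fps_comp (h i) h'.
have k0 i : k i mnm0 = 0 by rewrite fcomp0.
have c n1 p1 (u : 'I_n1 -> fps K p1) N (f1 g : fps K n1) : (forall i, u i mnm0 = 0) ->
    wge deg1 N (f1 - g) -> wge deg1 N (fps_comp f1 u - fps_comp g u).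
  move=> u0 fg; rewrite -fcompN -fcompD; apply: wge_fcomp fg => i.
  exact/ord1_mdeg.
apply: (@fps_morph_ext _ _ _ deg1 deg1 (fun f => fps_comp (fps_comp f h) h')
         (fun f => fps_comp f k)) => // [N f1 g /(c _ _ h)|N f1 g|f1 g|f1 g|f1 g|f1 g|e|i].
- by move=> /(_ h0) /(c _ _ h'); apply.
- exact: c.
- by rewrite !fcompD.
- by rewrite !fcompM.
- exact: fcompD.
- exact: fcompM.
- by rewrite !fcompC.
- by rewrite !fcompX.
Qed.

Lemma fcompV f : f mnm0 != 0 -> fps_comp f^-1 h = (fps_comp f h)^-1.
Proof.
move=> f0; have uf : f \is a GRing.unit by rewrite fps_unitE.
have uc : fps_comp f h \is a GRing.unit by rewrite fps_unitE fcomp0.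
by apply: (mulIr uc); rewrite -fcompM // !mulVr // fcomp1.
Qed.

End CompMorph.

Section Diagonal.
Variables (K : fieldType) (n : nat) (l : multinom n -> K).
Hypothesis lD : forall a b, l (a +m b) = l a + l b.

(** A derivation, as [l] is additive. The field [x d/dx], the Euler field and the rescaled [x d/dx]
    of the residue computation are all of this form. *)
Definition ddiag (f : fps K n) : fps K n := Fps (fun a => l a * f a).

Lemma ddiagE f a : ddiag f a = l a * f a. Proof. by []. Qed.

Lemma ddiagM f g : ddiag (f * g) = ddiag f * g + f * ddiag g.
Proof.
apply: fpsP => a; rewrite fcoefD ddiagE !fcoefM mulr_sumr -big_split.
by apply: eq_bigr => -[b c] /= /eqP /(congr1 l) ea; rewrite !ddiagE ea lD; ring.
Qed.

Lemma ddiagC (c : K) : ddiag (fpsC n c) = 0.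
Proof.
have l0 : l mnm0 = 0 by apply: (addrI (l mnm0)); rewrite -lD addm0 addr0.
apply: fpsP => a; rewrite ddiagE fcoefC fcoef0.
by case: eqP => [->|]; rewrite ?l0 ?mul0r ?mulr0.
Qed.

End Diagonal.

Section Dx.
Variables (K : fieldType) (m : nat).
Implicit Types f g : fps K m.+1.

Local Notation e0 := (mnm1 (@ord0 m)).

Lemma dxE f a : dx f a = f (a +m e0) *+ (a ord0).+1. Proof. by []. Qed.

Lemma xvarE : xvar K m = fmon K e0. Proof. by []. Qed.

Lemma xvarXE i : xvar K m ^+ i = fmon K (mnm_muln e0 i).
Proof. by rewrite xvarE fmonX. Qed.

Lemma xvarI f g : xvar K m * f = xvar K m * g -> f = g.
Proof. exact: fmonI. Qed.

Lemma xvarXI i f g : xvar K m ^+ i * f = xvar K m ^+ i * g -> f = g.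
Proof. by rewrite xvarXE; apply: fmonI. Qed.

Lemma xdxE f : xvar K m * dx f = ddiag (fun a => (a ord0)%:R) f.
Proof.
apply: fpsP => a; rewrite xvarE fcoef_fmonM lep1mP ddiagE.
case: eqVneq => [->|a0 /=]; first by rewrite mul0r.
rewrite dxE mnmBE mnm1E eqxx subn1 prednK ?lt0n //.
by rewrite submK ?mulr_natl // lep1mP.
Qed.

Lemma dxD f g : dx (f + g) = dx f + dx g.
Proof. by apply: fpsP => a; rewrite fcoefD !dxE fcoefD mulrnDl. Qed.

Lemma dxN f : dx (- f) = - dx f.
Proof. by apply: fpsP => a; rewrite fcoefN !dxE fcoefN mulNrn. Qed.

Lemma dxB f g : dx (f - g) = dx f - dx g. Proof. by rewrite dxD dxN. Qed.

(** [x d/dx] is diagonal on monomials, so the rule holds for it; the factor [x] is then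
    cancelled. *)
Lemma dxM f g : dx (f * g) = dx f * g + f * dx g.
Proof.
apply: xvarI; rewrite xdxE ddiagM => [|a b]; last by rewrite mnmDE natrD.
by rewrite -!xdxE; ring.
Qed.

Lemma dxC (c : K) : dx (fpsC m.+1 c) = 0.
Proof.
apply: xvarI; rewrite xdxE ddiagC ?mulr0 // => a b.
by rewrite mnmDE natrD.
Qed.

Lemma dx0 : dx (0 : fps K m.+1) = 0.
Proof. by have := dxC 0; rewrite rmorph0. Qed.

Lemma dx_fpsX i : dx (fpsX K i) = fpsC m.+1 (i == ord0)%:R.
Proof.
apply: xvarI; rewrite xdxE; apply: fpsP => a.
rewrite mulrC fcoefCM ddiagE !FpsE; case: (eqVneq a) => [->|na].
  by rewrite mnm1E (mulrC _%:R) mul1r; case: eqVneq => [->|]; rewrite ?eqxx ?mul1r ?mul0r.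
rewrite mulr0; case: (eqVneq i) => [ei|]; last by rewrite mul0r.
by rewrite -ei (negbTE na) mulr0.
Qed.

Lemma dx_xvar : dx (xvar K m) = 1.
Proof. by rewrite dx_fpsX eqxx rmorph1. Qed.

Lemma dx_lamvar (j : 'I_m) : dx (lamvar K j) = 0.
Proof. by rewrite dx_fpsX rmorph0. Qed.

Lemma dxXn f i : dx (f ^+ i) = f ^+ i.-1 * dx f *+ i.
Proof.
elim: i => [|[|i] IHi]; first by rewrite expr0 dxC mulr0n.
  by rewrite !expr1 mulr1n mul1r.
rewrite exprS dxM IHi /= exprS [in RHS]mulrS -mulrnAr.
by rewrite -[X in _ = _ + X]mulrnAr; ring.
Qed.

Lemma dx_sum I (r : seq I) (P : pred I) (F : I -> fps K m.+1) :
  dx (\sum_(i <- r | P i) F i) = \sum_(i <- r | P i) dx (F i).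
Proof. by apply: (big_morph (@dx K m)) => [f g|]; rewrite ?dxD ?dx0. Qed.

Lemma wge_dx (w : 'I_m.+1 -> nat) N f :
  wge w N f -> wge w (N - w ord0) (dx f).
Proof.
move=> hf a lta; rewrite dxE hf ?mul0rn //.
by rewrite wtD wt1; lia.
Qed.

End Dx.

Section Subst.
Variables (K : fieldType) (m p : nat) (phi : fps K m.+1) (psi : 'I_p -> fps K m.+1).
Hypothesis (phi0 : phi mnm0 = 0) (psi0 : forall j, psi j mnm0 = 0).
Implicit Types f g : fps K p.+1.

Let h (i : 'I_p.+1) := if unlift ord0 i is Some j then psi j else phi.

Let h0 i : h i mnm0 = 0.
Proof. by rewrite /h; case: unliftP. Qed.

Lemma substD f g : subst (f + g) phi psi = subst f phi psi + subst g phi psi.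
Proof. exact: fcompD. Qed.
Lemma substB f g : subst (f - g) phi psi = subst f phi psi - subst g phi psi.
Proof. exact: fcompB. Qed.
Lemma substM f g : subst (f * g) phi psi = subst f phi psi * subst g phi psi.
Proof. exact: fcompM. Qed.
Lemma substXn f i : subst (f ^+ i) phi psi = subst f phi psi ^+ i.
Proof. exact: fcompXn. Qed.
Lemma substC (c : K) : subst (fpsC p.+1 c) phi psi = fpsC m.+1 c.
Proof. exact: fcompC. Qed.
Lemma subst_sum I (r : seq I) (P : pred I) (F : I -> fps K p.+1) :
  subst (\sum_(i <- r | P i) F i) phi psi = \sum_(i <- r | P i) subst (F i) phi psi.
Proof. exact: fcomp_sum. Qed.
Lemma substV f : f mnm0 != 0 -> subst f^-1 phi psi = (subst f phi psi)^-1.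
Proof. exact: fcompV. Qed.
Lemma subst_xvar : subst (xvar K p) phi psi = phi.
Proof. by rewrite /subst fcompX // unlift_none. Qed.
Lemma subst_lamvar j : subst (lamvar K j) phi psi = psi j.
Proof. by rewrite /subst fcompX // liftK. Qed.
Lemma subst0 f : subst f phi psi mnm0 = f mnm0.
Proof. exact: fcomp0. Qed.

Lemma dx_subst f : (forall j, dx (psi j) = 0) ->
  dx (subst f phi psi) = subst (dx f) phi psi * dx phi.
Proof.
move=> dpsi; pose P g := dx (subst g phi psi) = subst (dx g) phi psi * dx phi.
apply: (@fps_eq_wge _ _ deg1) => N.
(* Precision [N.+1], because [dx] loses one degree. *)
have [||c|i|g Pg fg] := @fps_approx K p.+1 P _ _ _ _ N.+1 f.
- by move=> g g' Pg Pg'; rewrite /P dxD !substD dxD Pg Pg' mulrDl.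
- move=> g g' Pg Pg'; rewrite /P dxM substD !substM dxM Pg Pg'; ring.
- by rewrite /P substC !dxC -(rmorph0 (fpsC p.+1)) substC rmorph0 mul0r.
- rewrite /P dx_fpsX substC; case: (unliftP ord0 i) => [j|] ->.
    by rewrite subst_lamvar dpsi rmorph0 mul0r.
  by rewrite eqxx subst_xvar rmorph1 mul1r.
have cs M u : wge deg1 M u -> wge deg1 M (subst u phi psi).
  by apply: wge_fcomp => i; apply/ord1_mdeg; apply: h0.
rewrite (_ : _ - _ = dx (subst (f - g) phi psi) - subst (dx (f - g)) phi psi * dx phi).
  apply: wgeD; first by move/cs: fg => /wge_dx; rewrite subSS subn0.
  apply: wgeN; rewrite -[N]addn0; apply: wgeM => //; apply: cs.
  by have /wge_dx := fg; rewrite subSS subn0.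
by rewrite substB !dxB substB Pg; ring.
Qed.

End Subst.

(** * Series in (x, lambda) *)

Section Mcons.
Variable m : nat.
Implicit Types (a : multinom m.+1) (b : multinom m).
Local Notation e0 := (mnm1 (@ord0 m)).

Lemma mcons0 i b : mcons i b ord0 = i.
Proof. by rewrite multinomE tnth0. Qed.

Lemma mconsS i b j : mcons i b (lift ord0 j) = b j.
Proof. by rewrite multinomE tnthS. Qed.

Lemma mtailE a j : mtail a j = a (lift ord0 j).
Proof. exact: mnmE. Qed.

Lemma mconsK i b : mtail (mcons i b) = b.
Proof. by apply/mnmP => j; rewrite mtailE mconsS. Qed.

Lemma mcons_eta a : mcons (a ord0) (mtail a) = a.
Proof.
apply/mnmP => i; case: (unliftP ord0 i) => [j|] ->; last by rewrite mcons0.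
by rewrite mconsS mtailE.
Qed.

Lemma mcons_inj i j b b' : mcons i b = mcons j b' -> i = j /\ b = b'.
Proof.
move=> e; split; first by rewrite -(mcons0 i b) e mcons0.
by rewrite -(mconsK i b) e mconsK.
Qed.

Lemma mconsD i j b b' : mcons i b +m mcons j b' = mcons (i + j) (b +m b').
Proof.
apply/mnmP => l; rewrite mnmDE; case: (unliftP ord0 l) => [l'|] ->.
  by rewrite !mconsS mnmDE.
by rewrite !mcons0.
Qed.

Lemma mtailD a a' : mtail (a +m a') = mtail a +m mtail a'.
Proof. by apply/mnmP => j; rewrite mnmDE !mtailE mnmDE. Qed.

Lemma mcons00 : mcons 0 (@mnm0 m) = mnm0.
Proof.
apply/mnmP => i; rewrite mnm0E; case: (unliftP ord0 i) => [j|] ->.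
  by rewrite mconsS mnm0E.
by rewrite mcons0.
Qed.

Lemma mtail0 : mtail (@mnm0 m.+1) = mnm0.
Proof. by rewrite -mcons00 mconsK. Qed.

Lemma mnm_muln_e0 i : mnm_muln e0 i = mcons i mnm0.
Proof.
apply/mnmP => l; rewrite mulmnE mnm1E; case: (unliftP ord0 l) => [l'|] ->.
  by rewrite mconsS mnm0E (negbTE (neq_lift _ _)).
by rewrite mcons0 eqxx mul1n.
Qed.

Lemma mnm1_e0 : e0 = mcons 1 mnm0.
Proof. by rewrite -mnm_muln_e0 mulm1n. Qed.

Lemma wt_mcons (w : 'I_m.+1 -> nat) i b :
  wt w (mcons i b) = (w ord0 * i + wt (fun j => w (lift ord0 j)) b)%N.
Proof.
rewrite /wt big_ord_recl mcons0; congr (_ + _)%N.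
by apply: eq_bigr => j _; rewrite mconsS.
Qed.

Lemma mdeg_mcons i b : mdeg (mcons i b) = (i + mdeg b)%N.
Proof. by rewrite -wt_mdeg wt_mcons wt_mdeg mul1n. Qed.

End Mcons.

Section OfLam.
Variables (K : fieldType) (m : nat).
Implicit Types (c d : fps K m) (f : fps K m.+1) (P : {poly fps K m}).
Local Notation x := (xvar K m).

Lemma of_lamE c a : of_lam c a = if a ord0 == 0%N then c (mtail a) else 0.
Proof. by rewrite /of_lam FpsE coefC; case: ifP. Qed.

Lemma of_lam_cons c b : of_lam c (mcons 0 b) = c b.
Proof. by rewrite of_lamE mcons0 mconsK. Qed.

Lemma lamvar0 (j : 'I_m) : lamvar K j mnm0 = 0.
Proof. by rewrite FpsE eq_sym mnm1_eq0. Qed.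

Lemma xvar0 : x mnm0 = 0.
Proof. by rewrite FpsE eq_sym mnm1_eq0. Qed.

(** Seen as a composition, [of_lam] inherits ring laws and order estimates. *)
Lemma of_lam_comp c : of_lam c = fps_comp c (@lamvar K m).
Proof.
have mon b : mmap1 (@lamvar K m) b = fmon K (mcons 0 b).
  have -> : mcons 0 b = \big[@mnm_add _/mnm0]_j mnm_muln (mnm1 (lift ord0 j)) (b j).
    apply/mnmP => i; rewrite mnm_sumE; case: (unliftP ord0 i) => [j|] ->.
      rewrite mconsS (bigD1 j) //= mulmnE mnm1E eqxx mul1n big1 ?addn0 // => l nl.
      by rewrite mulmnE mnm1E (inj_eq (@lift_inj _ _)) (negbTE nl).
    by rewrite mcons0 big1 // => l _; rewrite mulmnE mnm1E eq_sym (negbTE (neq_lift _ _)).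
  rewrite /mmap1 (big_morph (@fmon K m.+1) (id1 := 1) (op1 := *%R)) => [|u v|] //.
    by apply: eq_bigr => j _; rewrite -fmonX.
  by rewrite fmonM.
apply: fpsP => a; rewrite (@fcompE _ _ _ _ lamvar0 (mdeg a).+1) //.
under eq_bigr => b _ do rewrite mon FpsE.
rewrite of_lamE; case: eqP => [a0|na0].
  have lt : (mdeg (mtail a) < (mdeg a).+1)%N.
    by rewrite -[in X in (_ < X)%N](mcons_eta a) mdeg_mcons ltnS leq_addl.
  rewrite (bigD1 (BMultinom lt)) //= -{1}a0 mcons_eta eqxx mulr1 big1 ?addr0 // => b nb.
  case: eqP => [eab|]; rewrite ?mulr0 //; case/eqP: nb; apply/val_inj => /=.
  by have /esym := congr1 (@mtail m) eab; rewrite mconsK.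
rewrite big1 // => b _; case: eqP => [eab|]; rewrite ?mulr0 //.
by case: na0; have := congr1 (fun u : multinom m.+1 => u ord0) eab; rewrite mcons0.
Qed.

Fact of_lam_zmod_morphism : zmod_morphism (@of_lam K m).
Proof. by move=> c d; rewrite !of_lam_comp fcompB. Qed.

Fact of_lam_monoid_morphism : monoid_morphism (@of_lam K m).
Proof.
split=> [|c d]; rewrite !of_lam_comp; first exact: (fcomp1 lamvar0).
exact: (fcompM lamvar0).
Qed.

HB.instance Definition _ := GRing.isZmodMorphism.Build (fps K m) (fps K m.+1)
  (@of_lam K m) of_lam_zmod_morphism.
HB.instance Definition _ := GRing.isMonoidMorphism.Build (fps K m) (fps K m.+1)
  (@of_lam K m) of_lam_monoid_morphism.

Lemma of_lamC (e : K) : of_lam (fpsC m e) = fpsC m.+1 e.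
Proof. by rewrite of_lam_comp fcompC //; apply: lamvar0. Qed.

Lemma of_lam0 c : of_lam c mnm0 = c mnm0.
Proof. by rewrite -mcons00 of_lam_cons. Qed.

Lemma dx_of_lam c : dx (of_lam c) = 0.
Proof.
apply: fpsP => a; rewrite dxE of_lamE mnmDE mnm1E eqxx addn1 /= mul0rn.
by rewrite fcoef0.
Qed.

Lemma wge_of_lam (w : 'I_m.+1 -> nat) N c :
  wge (fun j => w (lift ord0 j)) N c -> wge w N (of_lam c).
Proof.
move=> hc; rewrite of_lam_comp; apply: wge_fcomp hc => j.
exact: wgeX1.
Qed.

Lemma fcoef_xvarM i f a :
  (x ^+ i * f) a = if (i <= a ord0)%N then f (mcons (a ord0 - i) (mtail a)) else 0.
Proof.
rewrite xvarXE mnm_muln_e0 fcoef_fmonM.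
have -> : lem (mcons i mnm0) a = (i <= a ord0)%N.
  apply/mnm_lepP/idP => [/(_ ord0)|le l]; first by rewrite mcons0.
  case: (unliftP ord0 l) => [j|] ->; last by rewrite mcons0.
  by rewrite mconsS mnm0E.
case: ifP => // _; congr (fcoef _ _); apply/mnmP => l.
rewrite mnmBE; case: (unliftP ord0 l) => [j|] ->; last by rewrite !mcons0.
by rewrite !mconsS mnm0E subn0 mtailE.
Qed.

Lemma fcoef_of_lamX c i a :
  (of_lam c * x ^+ i) a = if a ord0 == i then c (mtail a) else 0.
Proof.
rewrite mulrC fcoef_xvarM of_lamE mcons0 mconsK.
by case: (ltngtP i (a ord0)) => [lt|lt|->]; rewrite ?subnn ?eqxx // subn_eq0 leqNgt lt.
Qed.

Lemma of_polyE P a : of_poly P a = P`_(a ord0) (mtail a). Proof. by []. Qed.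

Lemma of_polyD P Q : of_poly (P + Q) = of_poly P + of_poly Q.
Proof. by apply: fpsP => a; rewrite of_polyE coefD. Qed.

Lemma of_poly0 : of_poly (0 : {poly fps K m}) = 0.
Proof. by apply: fpsP => a; rewrite of_polyE coef0. Qed.

Lemma of_poly_sum I (r : seq I) (Q : pred I) (F : I -> {poly fps K m}) :
  of_poly (\sum_(i <- r | Q i) F i) = \sum_(i <- r | Q i) of_poly (F i).
Proof. exact: (big_morph (@of_poly K m) of_polyD of_poly0). Qed.

Lemma of_polyZX c i : of_poly (c *: 'X^i) = of_lam c * x ^+ i.
Proof.
apply: fpsP => a; rewrite of_polyE fcoef_of_lamX coefZ coefXn.
by case: eqP; rewrite ?mulr1 ?mulr0.
Qed.

End OfLam.

Lemma subst_of_lam (K : fieldType) m p (c : fps K p) (phi : fps K m.+1) (psi : 'I_p -> fps K m.+1) :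
  phi mnm0 = 0 -> (forall j, psi j mnm0 = 0) ->
  subst (of_lam c) phi psi = fps_comp c psi.
Proof.
move=> phi0 psi0; rewrite of_lam_comp /subst fcomp_comp.
- by apply: eq_fcomp => j; rewrite fcompX ?liftK // => i; case: unliftP.
- by move=> j; rewrite FpsE eq_sym mnm1_eq0.
- by move=> i; case: unliftP.
Qed.

Lemma subst_lam_of_lam (K : fieldType) m (c : fps K m) (phi : fps K m.+1) :
  phi mnm0 = 0 -> subst (of_lam c) phi (@lamvar K m) = of_lam c.
Proof. by move=> phi0; rewrite subst_of_lam ?of_lam_comp //; apply: lamvar0. Qed.

Section AtLam0.
Variables (K : fieldType) (m : nat).
Implicit Types (f g : fps K m.+1).

Lemma at_lam0_subst f : at_lam0 f = subst f (xvar K 0) (fun=> 0).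
Proof.
pose h (i : 'I_m.+1) := if unlift ord0 i is Some _ then 0 : fps K 1 else xvar K 0.
have h0 i : h i mnm0 = 0 by rewrite /h; case: unliftP => // _; rewrite xvar0.
have mon b : mmap1 h b = if mtail b == mnm0 then fmon K (mcons (b ord0) mnm0) else 0.
  rewrite /mmap1 big_ord_recl {1}/h unlift_none xvarXE mnm_muln_e0.
  case: eqP => [tb|/eqP tb].
    rewrite big1 ?mulr1 // => j _; rewrite /h liftK -mtailE tb mnm0E expr0 //.
  suff [j bj] : exists j, b (lift ord0 j) != 0%N.
    by rewrite (bigD1 j) //= /h liftK expr0n (negbTE bj) mul0r mulr0.
  apply/existsP; apply: contraR tb => /existsPn tb; apply/eqP/mnmP => j.
  by rewrite mtailE mnm0E; apply/eqP; move: (tb j); rewrite negbK.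
apply: fpsP => a; rewrite /subst (@fcompE _ _ _ _ h0 (mdeg a).+1) //.
have ta (b : multinom 1) : b = mcons (b ord0) mnm0.
  by rewrite -{1}(mcons_eta b); congr mcons; apply/mnmP => -[].
have lt : (mdeg (mcons (a ord0) (@mnm0 m)) < (mdeg a).+1)%N.
  by rewrite [in X in (_ < X)%N](ta a) !mdeg_mcons !mdeg0.
rewrite FpsE (bigD1 (BMultinom lt)) //= mon mconsK eqxx mcons0 FpsE -ta eqxx mulr1.
rewrite big1 ?addr0 // => b nb; rewrite mon; case: eqP => [tb|]; last by rewrite mulr0.
rewrite FpsE; case: eqP => [eab|]; rewrite ?mulr0 //; case/eqP: nb; apply/val_inj => /=.
by have := congr1 (fun u : multinom 1 => u ord0) eab; rewrite mcons0 => ->; rewrite -tb mcons_eta.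
Qed.

Let s0 := at_lam0_subst.

Lemma at_lam0D f g : at_lam0 (f + g) = at_lam0 f + at_lam0 g.
Proof. by []. Qed.
Lemma at_lam0B f g : at_lam0 (f - g) = at_lam0 f - at_lam0 g.
Proof. by []. Qed.
Lemma at_lam0M f g : at_lam0 (f * g) = at_lam0 f * at_lam0 g.
Proof. by rewrite !s0 substM // xvar0. Qed.
Lemma at_lam0Xn f i : at_lam0 (f ^+ i) = at_lam0 f ^+ i.
Proof. by rewrite !s0 substXn // xvar0. Qed.
Lemma at_lam0V f : f mnm0 != 0 -> at_lam0 f^-1 = (at_lam0 f)^-1.
Proof. by move=> f0; rewrite !s0 substV // xvar0. Qed.
Lemma at_lam0C (c : K) : at_lam0 (fpsC m.+1 c) = fpsC 1 c.
Proof. by rewrite !s0 substC // xvar0. Qed.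
Lemma at_lam0_sum I (r : seq I) (P : pred I) (F : I -> fps K m.+1) :
  at_lam0 (\sum_(i <- r | P i) F i) = \sum_(i <- r | P i) at_lam0 (F i).
Proof.
rewrite s0 subst_sum ?xvar0 //.
by apply: eq_bigr => i _; rewrite s0.
Qed.
Lemma at_lam0_xvar : at_lam0 (xvar K m) = xvar K 0.
Proof. by rewrite !s0 subst_xvar // xvar0. Qed.
Lemma at_lam0_of_lam (c : fps K m) : at_lam0 (of_lam c) = fpsC 1 (c mnm0).
Proof.
apply: fpsP => a; rewrite FpsE of_lamE mcons0 mconsK fcoefC.
rewrite (_ : (a == mnm0) = (a ord0 == 0%N)); first by case: eqP.
apply/eqP/eqP => [->|a0]; first by rewrite mnm0E.
by apply/mnmP => i; rewrite ord1 a0 mnm0E.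
Qed.

End AtLam0.

Section NormalForms.
Variables (K : fieldType) (m k : nat).
Implicit Types (y : 'I_k -> fps K m) (mu : fps K m) (e : K) (f phi a : fps K m.+1).
Local Notation lam := (@lamvar K m).

Definition nf_num y f := f ^+ k.+1 + \sum_(j < k) of_lam (y j) * f ^+ j.
Definition nf_den e mu f := fpsC m.+1 e + of_lam mu * f ^+ k.

Lemma nfBE e y mu :
  nfB e y mu = nf_num y (xvar K m) / nf_den e mu (xvar K m).
Proof.
rewrite /nfB /nfB_num /nfB_den !of_polyD of_poly_sum.
rewrite -['X^(k.+1)]scale1r !of_polyZX rmorph1 mul1r /nf_num /nf_den.
congr (_ / (_ + _)); first by congr (_ + _); apply: eq_bigr => j _; rewrite of_polyZX.
by rewrite -of_lamC.
Qed.

(** For [k = 0] the monomial [x^k] is 1, and [mu] contributes to the constant term of the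
    denominator. *)
Definition den_ok e mu := e + mu mnm0 * (k == 0)%:R != 0.

Lemma den_okP e mu f : f mnm0 = 0 -> den_ok e mu = (nf_den e mu f mnm0 != 0).
Proof.
move=> f0; rewrite /den_ok /nf_den fcoefD fcoefM0 of_lam0 fcoefC eqxx mulr1n.
have -> : (f ^+ k) mnm0 = (k == 0%N)%:R; last by [].
by case: k => [|l]; rewrite ?expr0 ?fcoef1 ?eqxx // exprS fcoefM0 f0 mul0r.
Qed.

Lemma subst_nf_num y phi : phi mnm0 = 0 ->
  subst (nf_num y (xvar K m)) phi lam = nf_num y phi.
Proof.
move=> phi0; have l0 := @lamvar0 K m.
rewrite /nf_num substD substXn // subst_xvar // subst_sum //; congr (_ + _).
by apply: eq_bigr => j _; rewrite substM // substXn // subst_xvar // subst_lam_of_lam.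
Qed.

Lemma subst_nf_den e mu phi : phi mnm0 = 0 ->
  subst (nf_den e mu (xvar K m)) phi lam = nf_den e mu phi.
Proof.
move=> phi0; have l0 := @lamvar0 K m.
by rewrite /nf_den substD substC // substM // substXn // subst_xvar // subst_lam_of_lam.
Qed.

Lemma subst_nfB e y mu phi : den_ok e mu -> phi mnm0 = 0 ->
  subst (nfB e y mu) phi lam = nf_num y phi / nf_den e mu phi.
Proof.
move=> ok phi0; have l0 := @lamvar0 K m.
rewrite nfBE substM // substV // -?den_okP ?xvar0 //.
by rewrite subst_nf_num // subst_nf_den.
Qed.

Lemma nf_eqP e mu y a phi : den_ok e mu -> phi mnm0 = 0 ->
  nf_num y phi / nf_den e mu phi = a <-> nf_num y phi = a * nf_den e mu phi.
Proof.
move=> ok phi0; have u : nf_den e mu phi \is a GRing.unit by rewrite fps_unitE -den_okP.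
by split=> [<-|->]; rewrite ?divrK ?mulrK.
Qed.

Lemma conj_nfBP e y mu a phi : den_ok e mu ->
  conjugacy a (nfB e y mu) phi <->
  coord_change phi /\ nf_num y phi = a * dx phi * nf_den e mu phi.
Proof.
move=> ok; split=> -[cc]; have [phi0 _] := cc.
  by rewrite subst_nfB // nf_eqP.
by move=> h; split=> //; rewrite subst_nfB // nf_eqP.
Qed.

End NormalForms.

(** * The conjugacy equation as a fixed point equation *)

Section FixedPoint.
Variables (K : fieldType) (n : nat) (w : 'I_n -> nat) (p : nat).
Implicit Types (f g : fps K n).

(** Successive iterates agree to one more order each time, so every coefficient becomes stationary.
    The last clause records when; bounds on the iterates pass to the fixed point through it. *)
Lemma fps_fix (F : fps K n -> fps K n) :
  (forall s f g, near predT w p s f g -> near predT w p s.+1 (F f) (F g)) ->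
  exists f, [/\ wge w p f, F f = f
    & forall a i, (wt w a < i)%N -> f a = iter i F 0 a].
Proof.
move=> cF; pose u i := iter i F 0.
have nu i : near predT w p i (u i) (u i.+1).
  elim: i => [|i IHi]; last exact: cF.
  have [_ h _] := cF 0%N 0 0 (near_refl _ _ (@wge0 _ _ _ _)).
  by split=> // a _; rewrite addn0 fcoefD fcoefN => lta; rewrite h // subr0.
have pu i : wge w p (u i) by case: (nu i).
have du i N : (N <= i)%N -> wge w N (u i - u N).
  move=> /subnK <-; elim: (i - N)%N => [|j IHj]; first by rewrite subrr.
  rewrite -(subrK (u (j + N)%N) (u _)) -addrA; apply: wgeD => //.
  move=> a lta; have [_ _ h] := nu (j + N)%N.
  apply/eqP; rewrite -oppr_eq0 -fcoefN opprB; apply/eqP/h => //.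
  by rewrite (leq_trans lta) // addnA leq_addl.
have uE a i : (wt w a < i)%N -> u i a = u (wt w a).+1 a.
  by move=> /du /(_ a (ltnSn _)); rewrite fcoefD fcoefN => /subr0_eq.
pose f : fps K n := Fps (fun a => u (wt w a).+1 a).
have pf : wge w p f by move=> a lta; rewrite FpsE pu.
have fu i : wge w i (f - u i).
  by move=> a lta; rewrite fcoefD fcoefN FpsE (uE _ i) // subrr.
exists f; split=> // [|a i lta]; last by rewrite FpsE -/(u i) (uE a i).
apply: (@fps_eq_wge _ _ w) => s.
have /cF [_ _ h] : near predT w p s f (u (p + s)%N).
  by split=> // a _; apply: fu.
rewrite (_ : F f - f = (F f - u (p + s).+1) - (f - u (p + s).+1)); last by ring.
apply: wgeD => [a lta|]; first apply: h => //.
  by rewrite (leq_trans lta) ?leq_addl // addnS leqW ?leq_addl.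
by apply: wgeN; apply: wgeW (fu _); rewrite leqW // leq_addl.
Qed.

(** No common map is involved, so that fixed points of two different maps can be compared, provided
    the two maps together gain an order on [Q]. *)
Lemma fps_fix_eq Q (f g : fps K n) : wge w p f -> wge w p g ->
  (forall s, near Q w p s f g -> near Q w p s.+1 f g) ->
  forall a, Q a -> f a = g a.
Proof.
move=> pf pg c a Qa; have [_ _] : near Q w p (wt w a).+1 f g.
  elim: (wt w a).+1 => [|s /c //]; split=> // b _ lt.
  by move: lt; rewrite addn0 fcoefD fcoefN => lt; rewrite pf ?pg ?subrr.
move=> /(_ a Qa); rewrite fcoefD fcoefN => h; apply/subr0_eq/h.
by rewrite addnS ltnS leq_addl.
Qed.

End FixedPoint.

Section Shift.
Variables (K : fieldType) (m : nat).
Implicit Types (f g : fps K m.+1) (c : nat -> K).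
Local Notation x := (xvar K m).

(* c is a diagonal operator in the exponent of x, applied after division by x^j. *)
Definition shop c j f : fps K m.+1 := Fps (fun a => c (a ord0) * f (a +m mcons j mnm0)).

Lemma shopE c j f a : shop c j f a = c (a ord0) * f (a +m mcons j mnm0).
Proof. by []. Qed.

Lemma shopB c j f g : shop c j (f - g) = shop c j f - shop c j g.
Proof.
apply: fpsP => a; rewrite fcoefD fcoefN !shopE fcoefD fcoefN.
by rewrite mulrBr.
Qed.

Lemma shopD c j f g : shop c j (f + g) = shop c j f + shop c j g.
Proof. by apply: fpsP => a; rewrite fcoefD !shopE fcoefD mulrDr. Qed.

Lemma shopE' c j f i b : shop c j f (mcons i b) = c i * f (mcons (i + j) b).
Proof. by rewrite shopE mcons0 mconsD addm0. Qed.

Lemma dx_shop f : dx f = shop (fun i => i.+1%:R) 1 f.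
Proof. by apply: fpsP => a; rewrite dxE shopE mnm1_e0 mulr_natl. Qed.

(** The operators [shop] read a coefficient at a higher power of [x], so [Q] has to allow raising
    that exponent. *)
Definition estable (Q : pred (multinom m.+1)) :=
  forall a i, Q a -> Q (a +m mcons i mnm0).

Definition xcoef j f : fps K m := Fps (fun b => f (mcons j b)).

Lemma xcoefE j f b : xcoef j f b = f (mcons j b). Proof. by []. Qed.

Lemma xcoefD j f g : xcoef j (f + g) = xcoef j f + xcoef j g. Proof. by []. Qed.
Lemma xcoefN j f : xcoef j (- f) = - xcoef j f. Proof. by []. Qed.
Lemma xcoef_sum j I (r : seq I) (P : pred I) (F : I -> fps K m.+1) :
  xcoef j (\sum_(i <- r | P i) F i) = \sum_(i <- r | P i) xcoef j (F i).
Proof. exact: (big_morph (xcoef j)). Qed.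

Lemma xcoef_of_lamX i j (c : fps K m) :
  xcoef j (of_lam c * x ^+ i) = if j == i then c else 0.
Proof.
by apply: fpsP => b; rewrite xcoefE fcoef_of_lamX mcons0 mconsK; case: ifP.
Qed.

Lemma of_lam_xcoef j f : of_lam (xcoef j f) = shop (fun i => (i == 0%N)%:R) j f.
Proof.
apply: fpsP => a; rewrite -(mcons_eta a) shopE' of_lamE mcons0 mconsK.
by case: eqP => [->|]; rewrite ?mul1r ?mul0r.
Qed.

(* Giving lambda a weight W > k + 1 makes every unfolding a perturbation of higher
   weight of its part x^(k+1). *)
Definition xw W (i : 'I_m.+1) := if unlift ord0 i is Some _ then W else 1%N.

Lemma xw0 W : xw W ord0 = 1%N. Proof. by rewrite /xw unlift_none. Qed.
Lemma xwS W j : xw W (lift ord0 j) = W. Proof. by rewrite /xw liftK. Qed.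

Lemma wt_xw W i b : wt (xw W) (mcons i b) = (i + W * mdeg b)%N.
Proof.
rewrite wt_mcons xw0 mul1n; congr (_ + _)%N.
rewrite mdegE big_distrr /=; apply: eq_bigr => j _; by rewrite xwS.
Qed.

Section WithQ.
Variables (Q : pred (multinom m.+1)) (W : nat).
Hypotheses (dQ : dclosed Q) (eQ : estable Q).

Lemma wge_shop N c j f : wge (xw W) N f -> wge (xw W) (N - j) (shop c j f).
Proof.
move=> hf a lta; rewrite shopE hf ?mulr0 // wtD wt_xw mdeg0 muln0.
by lia.
Qed.

Lemma near_shop p s c j f g :
  near Q (xw W) (p + j) s f g -> near Q (xw W) p s (shop c j f) (shop c j g).
Proof.
move=> [hf hg hfg]; split.
- by rewrite -(addnK j p); apply: wge_shop.
- by rewrite -(addnK j p); apply: wge_shop.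
rewrite -shopB => a Qa lta; rewrite shopE hfg ?mulr0 //; first exact: eQ.
by rewrite wtD wt_xw mdeg0; lia.
Qed.

End WithQ.

Lemma wge_xcoef W N j (f : fps K m.+1) :
  wge (xw W) N f -> wge (xw W) (N - j) (of_lam (xcoef j f)).
Proof. by move=> hf; rewrite of_lam_xcoef; apply: wge_shop. Qed.

End Shift.

(** * The homological operator *)

Section Homological.
Variables (K : numFieldType) (m k : nat).
Implicit Types (f g al xi mu : fps K m.+1) (tau : fps K m).
Local Notation x := (xvar K m).

(* The linearisation of the conjugacy equation at x^(k+1) d/dx. *)
Definition hom_op f := k.+1%:R * x ^+ k * f - x ^+ k.+1 * dx f.

(** Division by [x^k] and by the eigenvalue [k+1-i]. The value 0 at the resonance [i = k+1] selects
    the preimage without a term in the kernel. *)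
Definition hom_inv g : fps K m.+1 :=
  shop (fun i => if i == k.+1 then 0 else (k.+1%:R - i%:R)^-1) k g.

Lemma hom_opE f i b : hom_op f (mcons i b) =
  if (k <= i)%N then (k.+1%:R - (i - k)%:R) * f (mcons (i - k) b) else 0.
Proof.
have -> : hom_op f = x ^+ k * (fpsC m.+1 k.+1%:R * f - ddiag (fun a => (a ord0)%:R) f).
  by rewrite -xdxE /hom_op exprS rmorph_nat; ring.
rewrite fcoef_xvarM mcons0 mconsK; case: ifP => // _.
by rewrite fcoefD fcoefN fcoefCM ddiagE mcons0 mulrBl.
Qed.

Lemma natk_neq0 i : i != k.+1 -> k.+1%:R - i%:R != 0 :> K.
Proof. by move=> ni; rewrite subr_eq0 eqr_nat eq_sym. Qed.

Lemma hom_opK f : hom_inv (hom_op f) = f - of_lam (xcoef k.+1 f) * x ^+ k.+1.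
Proof.
apply: fpsP => a; rewrite -(mcons_eta a) shopE' hom_opE leq_addl addnK.
rewrite fcoefD fcoefN fcoef_of_lamX mcons0 mconsK; case: ifP => [/eqP ->|/negbT na].
  by rewrite mul0r xcoefE subrr.
by rewrite subr0 mulKf // natk_neq0.
Qed.

(** The corrections are the monomials outside the image: those not divisible by [x^k], and
    [x^(k+(k+1))], where the eigenvalue vanishes. *)
Lemma hom_invK g : hom_op (hom_inv g) =
  g - \sum_(j < k) of_lam (xcoef j g) * x ^+ j
    - of_lam (xcoef (k + k.+1) g) * x ^+ (k + k.+1).
Proof.
apply: fpsP => a; rewrite -(mcons_eta a) hom_opE !fcoefD !fcoefN fcoef_sum.
rewrite fcoef_of_lamX mcons0 mconsK xcoefE.
under eq_bigr => j _ do rewrite fcoef_of_lamX mcons0 mconsK xcoefE.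
have [lek|ltk] := leqP k (a ord0).
  rewrite big1 ?subr0 => [|j _]; last by rewrite gtn_eqF // (leq_trans (ltn_ord j)).
  rewrite shopE' subnK //; case: ifP => [/eqP e|/negbT ne].
    have -> : a ord0 = (k + k.+1)%N by lia.
    by rewrite eqxx mul0r mulr0 subrr.
  rewrite mulVKf ?natk_neq0 //; case: eqP => [e|]; last by rewrite subr0.
  by move: ne; rewrite e addnC addnK eqxx.
rewrite (bigD1 (Ordinal ltk)) //= eqxx big1 ?addr0 ?subrr => [|j nj]; last first.
  by case: eqP => // e; case/eqP: nj; apply: val_inj.
by case: eqP => [e|]; rewrite ?subr0 //; move: ltk; rewrite e ltnNge leq_addr.
Qed.

Lemma xcoef_hom_op j f : (j < k)%N || (j == k + k.+1)%N -> xcoef j (hom_op f) = 0.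
Proof.
move=> hj; apply: fpsP => b; rewrite xcoefE hom_opE; case: ifP => // lekj.
case/orP: hj => [|/eqP ->]; first by rewrite ltnNge lekj.
by rewrite addnC addnK subrr mul0r.
Qed.

Lemma hom_inv_of_lamX j (c : fps K m) : (j < k)%N || (j == k + k.+1)%N ->
  hom_inv (of_lam c * x ^+ j) = 0.
Proof.
move=> hj; apply: fpsP => a; rewrite -(mcons_eta a) shopE' fcoef_of_lamX mcons0 mconsK.
case: (eqVneq (a ord0 + k)%N j) => [e|]; last by rewrite mulr0.
case/orP: hj => [|/eqP ej]; first by rewrite -e ltnNge leq_addl.
have ea : a ord0 = k.+1 by lia.
by rewrite ea eqxx mul0r.
Qed.

Definition dpow xi j := (x + xi) ^+ j - x ^+ j.

(** This is [(x^(k+1) + al) (1 + xi') (x + xi)^k - x^(2k+1)], arranged so that every term contains a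
    small factor [dpow xi k], [dx xi] or [al]. *)
Definition conj_fac al xi :=
  x ^+ k.+1 * dpow xi k
  + (x ^+ k.+1 * dx xi + al * (1 + dx xi)) * (x + xi) ^+ k.

Definition conj_rhs al xi (y : 'I_k -> fps K m) mu :=
  al * (1 + dx xi) - xi * (\sum_(i < k.+1) dpow xi (k - i) * x ^+ i)
  - \sum_(j < k) of_lam (y j) * dpow xi j
  + mu * conj_fac al xi.

Lemma conj_eqE al xi y mu :
  nf_num y (x + xi) - (x ^+ k.+1 + al) * (1 + dx xi) * (1 + mu * (x + xi) ^+ k) =
  (hom_op xi + \sum_(j < k) of_lam (y j) * x ^+ j - mu * x ^+ (k + k.+1))
  - conj_rhs al xi y mu.
Proof.
(* The difference of powers is [xi] times the sum of the [(x + xi)^(k-i) x^i]. Replacing each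
   summand by [x^k] isolates the linear part, with error [dpow xi (k - i) * x^i]. *)
have e1 : (x + xi) ^+ k.+1 = x ^+ k.+1 + k.+1%:R * x ^+ k * xi
    + xi * (\sum_(i < k.+1) dpow xi (k - i) * x ^+ i).
  rewrite /dpow; under eq_bigr => i _ do rewrite mulrBl -exprD subnK ?leq_ord //.
  rewrite sumrB sumr_const card_ord -[x ^+ k *+ _]mulr_natl.
  have dxi : x + xi - x = xi by ring.
  have := subrXX (x + xi) x k.+1; rewrite dxi => e.
  under eq_bigr => i _ do rewrite -[k in (k - i)%N]/(k.+1.-1) -subSS.
  have -> : \sum_(i < k.+1) (x + xi) ^+ (k.+1.-1.+1 - i.+1) * x ^+ i =
            \sum_(i < k.+1) (x + xi) ^+ (k.+1.-1 - i) * x ^+ i.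
    by apply: eq_bigr => i _; rewrite subSS.
  rewrite mulrBr -e; move: (x ^+ k) ((x + xi) ^+ k.+1) (x ^+ k.+1) (k.+1%:R) => X P c d.
  by ring.
have e2 : \sum_(j < k) of_lam (y j) * (x + xi) ^+ j =
    \sum_(j < k) of_lam (y j) * x ^+ j + \sum_(j < k) of_lam (y j) * dpow xi j.
  by rewrite -big_split; apply: eq_bigr => j _; rewrite /dpow /=; ring.
rewrite /nf_num e1 e2 /conj_rhs /conj_fac /hom_op [dpow xi k]/dpow exprD !exprS.
move: (\sum_(i < k.+1) _) (\sum_(j < k) _) (\sum_(j < k) _) => A B C.
move: (dx xi) (x ^+ k) ((x + xi) ^+ k) (k.+1%:R) => d X P c.
ring.
Qed.

End Homological.

Section Agree.
Variables (K : fieldType) (m : nat) (P : pred (multinom m)).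
Implicit Types (f g : fps K m.+1).

(** For [P] everything, [{0}] or the exponents of degree below [n], this is equality, equality at
    [lambda = 0], or congruence modulo the [n]-th power of the ideal of lambda. *)
Definition agree f g := forall a, P (mtail a) -> f a = g a.

Lemma agreeD f g f' g' : agree f f' -> agree g g' -> agree (f + g) (f' + g').
Proof. by move=> hf hg a Pa; rewrite !fcoefD (hf _ Pa) (hg _ Pa). Qed.

Lemma agreeB f g f' g' : agree f f' -> agree g g' -> agree (f - g) (f' - g').
Proof. by move=> hf hg a Pa; rewrite !fcoefD !fcoefN (hf _ Pa) (hg _ Pa). Qed.

Lemma agreeCM c f f' : agree f f' -> agree (fpsC m.+1 c * f) (fpsC m.+1 c * f').
Proof. by move=> hf a Pa; rewrite !fcoefCM (hf _ Pa). Qed.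

Lemma agree_vge w N f f' : agree f f' -> vge (fun a => P (mtail a)) w N (f - f').
Proof. by move=> hf a Pa _; rewrite fcoefD fcoefN (hf _ Pa) subrr. Qed.

Lemma agree_shop c j f f' : agree f f' -> agree (shop c j f) (shop c j f').
Proof.
move=> hf a Pa; rewrite !shopE; congr (_ * _); apply: hf.
by rewrite mtailD mconsK addm0.
Qed.

Lemma agree_of_lamX i (c c' : fps K m) : (forall b, P b -> c b = c' b) ->
  agree (of_lam c * xvar K m ^+ i) (of_lam c' * xvar K m ^+ i).
Proof.
move=> hc a Pa; rewrite (fcoef_of_lamX c) (fcoef_of_lamX c').
by case: ifP => [_|_]; [exact: hc|].
Qed.

Lemma agree_xcoef f f' j b : agree f f' -> P b -> xcoef j f b = xcoef j f' b.
Proof. by move=> hf Pb; rewrite !xcoefE; apply: hf; rewrite mconsK. Qed.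

End Agree.

Section NormalFormEquation.
Variables (K : numFieldType) (m k : nat).
Implicit Types (al xi g T : fps K m.+1) (y : 'I_k -> fps K m) (mu tau : fps K m).
Local Notation x := (xvar K m).
Local Notation wx := (@xw m k.+2).

Lemma wge_xvarX i : wge wx i (x ^+ i).
Proof. by rewrite -{1}(muln1 i); apply: wgeX; rewrite -(xw0 m k.+2); apply: wgeX1. Qed.

Lemma wx_gt0 i : (0 < wx i)%N.
Proof. by rewrite /xw; case: unliftP. Qed.

Lemma wge_of_lamX (c : fps K m) j : c mnm0 = 0 ->
  wge wx (k.+2 + j) (of_lam c * x ^+ j).
Proof.
move=> c0 a lta; rewrite fcoef_of_lamX; case: eqP => // ea.
have [->|nb] := eqVneq (mtail a) mnm0; first by [].
rewrite -mdeg_eq0 -lt0n in nb; move: lta; rewrite -(mcons_eta a) wt_xw ea mconsK.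
by case: (mdeg _) nb => // d _; rewrite mulnS; lia.
Qed.

Lemma dpowE xi j : dpow xi j =
  xi * \sum_(i < j) (x + xi) ^+ (j.-1 - i) * x ^+ i.
Proof.
have dxi : x + xi - x = xi by ring.
by have := subrXX (x + xi) x j; rewrite dxi.
Qed.

(* g = hom_op xi + sum_(j < k) y_j x^j - mu x^(2k+1) encodes all the unknowns of
   the conjugacy equation. *)
Definition fix_rhs al T g := conj_rhs al (hom_inv k g + T)
  (fun j : 'I_k => xcoef j g) (- of_lam (xcoef (k + k.+1) g)).

Section Near.
Variables (Q : pred (multinom m.+1)).
Hypotheses (dQ : dclosed Q) (eQ : estable Q).
Local Notation near := (near Q wx).

Lemma near_dx p s f g : near p.+1 s f g -> near p s (dx f) (dx g).
Proof. by move=> h; rewrite !dx_shop; apply: near_shop => //; rewrite addn1. Qed.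

Lemma near_dpow s xi xi' j : near 2 s xi xi' -> near j.+1 s (dpow xi j) (dpow xi' j).
Proof.
move=> h; rewrite !dpowE; case: j => [|j].
  by rewrite !big_ord0 !mulr0; apply: near_refl.
apply: (nearM dQ (p := 2) (q := j)) => //.
apply: near_sum => i _ /=; rewrite -{1}(@subnK i j) ?leq_ord //.
have hx : near 1 s x x by apply: near_refl; rewrite -[x]expr1; apply: wge_xvarX.
apply: nearM => //; last by apply: near_refl; apply: wge_xvarX.
by rewrite -[X in near X](muln1); apply: nearX => //; apply: nearD => //; apply: nearW h; lia.
Qed.

(** Apart from [al], every term is a product of at least two small quantities. It has order [k+3]
    with precision [s], which is as good as order [k+2] with precision [s+1]. *)
Lemma near_fix_rhs al al' T T' g g' s :
  near k.+2 s.+1 al al' -> near 2 s T T' -> near k.+2 s g g' ->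
  near k.+2 s.+1 (fix_rhs al T g) (fix_rhs al' T' g').
Proof.
move=> hal hT hg.
have hal' : near k.+2 s al al' by apply: nearW hal; lia.
rewrite /fix_rhs; set xi := _ + T; set xi' := _ + T'.
have hxi : near 2 s xi xi' by apply: nearD => //; apply: near_shop => //; rewrite addnC addn2.
have hdx : near 1 s (dx xi) (dx xi') by apply: near_dx.
have hx i : near i s (x ^+ i) (x ^+ i) by apply: near_refl; apply: wge_xvarX.
have hx1 : near 1 s (x + xi) (x + xi').
  by rewrite -[x]expr1; apply: nearD => //; apply: nearW hxi; lia.
have hx1X i : near i s ((x + xi) ^+ i) ((x + xi') ^+ i).
  by rewrite -[X in near X](muln1); apply: nearX.
have hD j : near j.+1 s (dpow xi j) (dpow xi' j) by apply: near_dpow.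
have hone : near 0 s (1 + dx xi) (1 + dx xi').
  by apply: nearD; [apply: near_refl|apply: nearW hdx; lia].
have up (u u' : fps K m.+1) : near k.+3 s u u' -> near k.+2 s.+1 u u' by apply: nearW; lia.
rewrite /conj_rhs; apply: nearD; first apply: nearB; first apply: nearB.
- rewrite !mulrDr !mulr1; apply: nearD => //; apply: up.
  by apply: nearW (nearM dQ hal' hdx); lia.
- apply: up; apply: (nearM dQ (p := 2) (q := k.+1)) => //.
  apply: near_sum => i _; have := leq_ord i => le.
  by apply: nearW (nearM dQ (hD (k - i)%N) (hx i)); lia.
- apply: up; apply: near_sum => j _; have ltj := ltn_ord j.
  have hy : near (k.+2 - j) s (of_lam (xcoef j g)) (of_lam (xcoef j g')).
    by rewrite !of_lam_xcoef; apply: near_shop => //; rewrite subnK //; lia.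
  by apply: nearW (nearM dQ hy (hD j)); lia.
have hB : near (k + k.+2) s (conj_fac k al xi) (conj_fac k al' xi').
  rewrite /conj_fac; apply: nearD; first by apply: nearW (nearM dQ (hx k.+1) (hD k)); lia.
  have h : near k.+2 s (x ^+ k.+1 * dx xi + al * (1 + dx xi))
      (x ^+ k.+1 * dx xi' + al' * (1 + dx xi')).
    apply: nearD; first by apply: nearW (nearM dQ (hx k.+1) hdx); lia.
    by apply: nearW (nearM dQ hal' hone); lia.
  by apply: nearW (nearM dQ h (hx1X k)); lia.
have [wB wB' vB] := hB.
have [wg wg' vg] := hg.
(* The coefficient of [x^(2k+1)] would have order [k+2-(2k+1)], which is negative for [k > 1] and is
   cut off at 0, so [near] cannot express its precision. The order [2k+2] of [conj_fac] makes up for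
   the deficit. *)
have wM (h : fps K m.+1) : wge wx k.+2 h ->
    wge wx (k.+2 - (k + k.+1)) (- of_lam (xcoef (k + k.+1) h)).
  by move=> /(wge_xcoef (j := (k + k.+1)%N)) /wgeN.
have [wM1 wM2] := (wM _ wg, wM _ wg').
have vM : vge Q wx (k.+2 + s - (k + k.+1))
    (- of_lam (xcoef (k + k.+1) g) - - of_lam (xcoef (k + k.+1) g')).
  rewrite -opprD; apply: vgeN; rewrite !of_lam_xcoef -shopB => a Qa lta.
  rewrite shopE vg ?mulr0 //; first exact: eQ.
  by rewrite wtD wt_xw mdeg0; lia.
move: (- of_lam (xcoef (k + k.+1) g)) (- of_lam (xcoef (k + k.+1) g'))
  (conj_fac k al xi) (conj_fac k al' xi')
  wM1 wM2 vM wB wB' vB => M M' B B' wM1 wM2 vM wB wB' vB.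
split.
- apply: wgeW (wgeM wM1 wB); lia.
- apply: wgeW (wgeM wM2 wB'); lia.
rewrite (_ : M * B - M' * B' = B * (M - M') + M' * (B - B')); last by ring.
apply: vgeD; first by apply: vgeW (vgeM dQ wB vM); lia.
by apply: vgeW (vgeM dQ wM2 vB); lia.
Qed.

End Near.

(** The order condition on [mu] is a uniform way to impose [mu(0) = 0] when [k = 0], where
    [x^(2k+1)] is [x] itself. *)
Definition nf_sol al xi y mu :=
  [/\ wge wx 2 xi, forall j, y j mnm0 = 0,
      wge wx k.+2 (of_lam mu * x ^+ (k + k.+1))
    & hom_op k xi + \sum_(j < k) of_lam (y j) * x ^+ j - of_lam mu * x ^+ (k + k.+1) =
      conj_rhs al xi y (of_lam mu)].

Lemma wge_hom_inv g : wge wx k.+2 g -> wge wx 2 (hom_inv k g).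
Proof. by move=> wg; apply: wgeW (wge_shop _ wg); lia. Qed.

(** [T] lies in the kernel of [hom_op], so adding it to [hom_inv k g] keeps the left side; and since
    [hom_inv k g] has no term in [x^(k+1)], the coefficient there is exactly [tau]. *)
Lemma fix_nf_sol al tau g : let T := of_lam tau * x ^+ k.+1 in
  wge wx 2 T -> wge wx k.+2 g -> fix_rhs al T g = g ->
  nf_sol al (hom_inv k g + T) (fun j => xcoef j g) (- xcoef (k + k.+1) g) /\
  xcoef k.+1 (hom_inv k g + T) = tau.
Proof.
move=> T wT wg fixg; split.
  split.
  - by apply: wgeD => //; apply: wge_hom_inv.
  - move=> j; rewrite xcoefE wg // wt_xw mdeg0 muln0 addn0.
    by have := ltn_ord j; lia.
  - rewrite rmorphN mulNr; apply: wgeN => a lta; rewrite fcoef_of_lamX.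
    by case: eqP => // e; rewrite xcoefE -e mcons_eta wg.
  have hT : hom_op k T = 0.
    rewrite /hom_op /T dxM dx_of_lam dxXn dx_xvar /= mulr1 exprS -mulr_natl.
    by ring.
  have hom_opD (f h : fps K m.+1) : hom_op k (f + h) = hom_op k f + hom_op k h.
    by rewrite /hom_op dxD; ring.
  rewrite hom_opD hT hom_invK addr0 rmorphN.
  rewrite -[RHS]/(fix_rhs al T g) fixg mulNr opprK.
  by move: (\sum_(j < k) _) (_ * _) => A B; ring.
apply: fpsP => b; rewrite xcoefE fcoefD shopE' eqxx mul0r add0r.
by rewrite fcoef_of_lamX mcons0 mconsK eqxx.
Qed.

(** [g] is the left side of the equation. Its projections onto the image of [hom_op] and onto the
    missing monomials recover the unknowns. *)
Lemma nf_sol_fix al xi y mu : nf_sol al xi y mu ->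
  exists g, [/\ wge wx k.+2 g, fix_rhs al (of_lam (xcoef k.+1 xi) * x ^+ k.+1) g = g,
    xi = hom_inv k g + of_lam (xcoef k.+1 xi) * x ^+ k.+1,
    forall j : 'I_k, y j = xcoef j g & mu = - xcoef (k + k.+1) g].
Proof.
move=> [wxi y0 wmu eqn].
have [g eg] : exists g, g = hom_op k xi + \sum_(j < k) of_lam (y j) * x ^+ j
    - of_lam mu * x ^+ (k + k.+1) by eexists.
rewrite -eg in eqn.
have hinvD (f h : fps K m.+1) : hom_inv k (f + h) = hom_inv k f + hom_inv k h by exact: shopD.
have hinv0 : hom_inv k (0 : fps K m.+1) = 0.
  by apply: (addrI (hom_inv k 0)); rewrite -hinvD !addr0.
have exi : xi = hom_inv k g + of_lam (xcoef k.+1 xi) * x ^+ k.+1.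
  rewrite eg -mulNr -rmorphN 2!hinvD hom_opK hom_inv_of_lamX ?eqxx ?orbT // addr0.
  rewrite (big_morph _ hinvD hinv0) big1 ?addr0 ?subrK // => j _.
  by rewrite hom_inv_of_lamX // ltn_ord.
have ey (j : 'I_k) : y j = xcoef j g.
  rewrite eg 2!xcoefD xcoefN xcoef_sum xcoef_hom_op ?ltn_ord // xcoef_of_lamX.
  rewrite add0r (bigD1 j) //= xcoef_of_lamX eqxx big1 => [|i ni]; last first.
    by rewrite xcoef_of_lamX (negbTE (_ : (j : nat) != i)) // eq_sym.
  have -> : (j == k + k.+1 :> nat) = false by have := ltn_ord j; lia.
  by rewrite subr0 addr0.
have emu : mu = - xcoef (k + k.+1) g.
  rewrite eg 2!xcoefD xcoefN xcoef_sum xcoef_hom_op ?eqxx ?orbT // xcoef_of_lamX eqxx.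
  rewrite big1 ?addr0 ?add0r ?opprK // => j _; rewrite xcoef_of_lamX.
  by have -> : (k + k.+1 == j :> nat)%N = false by have := ltn_ord j; lia.
have wg : wge wx k.+2 g.
  rewrite eg; apply: wgeD; last exact: wgeN.
  apply: wgeD.
    apply: wgeD; last apply: wgeN.
      rewrite -mulrA -(rmorph_nat (fpsC m.+1)); apply: wgeCM.
      by apply: wgeW (wgeM (wge_xvarX (i := k)) wxi); lia.
    have wd : wge wx 1 (dx xi) by move/wge_dx: wxi; rewrite xw0.
    by apply: wgeW (wgeM (wge_xvarX (i := k.+1)) wd); lia.
  apply: wge_sum => j _; by apply: wgeW (wge_of_lamX (j := j) (y0 j)); lia.
exists g; split; [exact: wg| |exact: exi|exact: ey|exact: emu].
rewrite /fix_rhs -exi; transitivity (conj_rhs al xi y (of_lam mu)); last by rewrite -eqn.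
have -> : - of_lam (xcoef (k + k.+1) g) = of_lam mu by rewrite emu rmorphN.
by have <- : y = (fun j : 'I_k => xcoef j g) by apply/funext => j; exact: ey.
Qed.

Lemma nf_sol_exists al tau : let T := of_lam tau * x ^+ k.+1 in
  wge wx k.+2 al -> wge wx 2 T ->
  exists g, [/\ wge wx k.+2 g, fix_rhs al T g = g
    & forall a i, (wt wx a < i)%N -> g a = iter i (fix_rhs al T) 0 a].
Proof.
move=> T wal wT; apply: fps_fix => s f g hfg.
by apply: near_fix_rhs => //; apply: near_refl.
Qed.

(** The lift of [P] to exponents in [(x, lambda)] is closed under divisors and under raising the
    power of [x], so the contraction estimate can be run on it alone. *)
Lemma nf_sol_unique (P : pred (multinom m)) al al' xi xi' y y' mu mu' :
  dclosed P -> wge wx k.+2 al -> wge wx k.+2 al' ->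
  agree P al al' ->
  (forall b, P b -> xcoef k.+1 xi b = xcoef k.+1 xi' b) ->
  nf_sol al xi y mu -> nf_sol al' xi' y' mu' ->
  [/\ agree P xi xi',
      forall j b, P b -> y j b = y' j b & forall b, P b -> mu b = mu' b].
Proof.
move=> dP wal wal' hal htau sol sol'; pose Q (a : multinom m.+1) := P (mtail a).
have dQ : dclosed Q by move=> a b; rewrite /Q mtailD; apply: dP.
have eQ : estable Q by move=> a i; rewrite /Q mtailD mconsK addm0.
have wT (f : fps K m.+1) : wge wx 2 f -> wge wx 2 (of_lam (xcoef k.+1 f) * x ^+ k.+1).
  move=> wf a lta; rewrite fcoef_of_lamX; case: eqP => // e.
  by rewrite xcoefE -e mcons_eta wf.
have [g [wg fg exi ey emu]] := nf_sol_fix sol.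
have [g' [wg' fg' exi' ey' emu']] := nf_sol_fix sol'.
have wxi : wge wx 2 xi by case: sol.
have wxi' : wge wx 2 xi' by case: sol'.
have hT : agree P (of_lam (xcoef k.+1 xi) * x ^+ k.+1) (of_lam (xcoef k.+1 xi') * x ^+ k.+1).
  exact: agree_of_lamX.
have gg' : agree P g g'.
  apply: (fps_fix_eq wg wg') => s h; rewrite -fg -fg'; apply: (near_fix_rhs dQ eQ).
  - by split; [exact: wal|exact: wal'|exact: agree_vge].
  - by split; [exact: wT|exact: wT|exact: agree_vge].
  exact: h.
split=> [|j b Pb|b Pb].
- by rewrite exi exi'; apply: agreeD => //; exact: agree_shop.
- by rewrite ey ey'; exact: agree_xcoef gg' Pb.
- by rewrite emu emu' !fcoefN (agree_xcoef _ gg' Pb).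
Qed.

End NormalFormEquation.

(** * Conjugacies tangent to the identity *)

Section TangentConjugacy.
Variables (K : numFieldType) (m k : nat).
Implicit Types (a phi : fps K m.+1) (y : 'I_k -> fps K m) (mu tau : fps K m) (e : K).
Local Notation x := (xvar K m).
Local Notation wx := (@xw m k.+2).

Definition tangent_nf e a phi y mu :=
  [/\ wge wx 2 (phi - x), forall j, y j mnm0 = 0, k = 0%N -> mu mnm0 = 0
    & conjugacy a (nfB e y mu) phi].

(** For an unfolding, [e] is [omega(0)], the reciprocal of the coefficient of [x^(k+1)]. *)
Definition leading e a := wge wx k.+2 (fpsC m.+1 e * a - x ^+ k.+1).

Lemma wge_mu mu : (k = 0%N -> mu mnm0 = 0) -> wge wx k.+2 (of_lam mu * x ^+ (k + k.+1)).
Proof.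
case: (posnP k) => [k0 /(_ k0) mu0|k0 _]; last first.
  have := wgeM (wge_0 (w := wx) (of_lam mu)) (@wge_xvarX K m k (k + k.+1)).
  by apply: wgeW; lia.
by apply: wgeW (wge_of_lamX mu0); rewrite leq_addr.
Qed.

Lemma den_ok_mu e mu : e != 0 -> (k = 0%N -> mu mnm0 = 0) -> den_ok k e mu.
Proof.
rewrite /den_ok => e0; case: (eqVneq k 0%N) => [k0 /(_ k0) ->|_ _].
  by rewrite mul0r addr0.
by rewrite mulr0 addr0.
Qed.

(** Writing the denominator as [e (1 + (mu/e) phi^k)] moves [e] over to [a] and replaces [mu] by
    [mu/e]. *)
Lemma nf_solP e a phi y mu : e != 0 -> (forall j, y j mnm0 = 0) ->
  (k = 0%N -> mu mnm0 = 0) -> wge wx 2 (phi - x) ->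
  tangent_nf e a phi y mu <->
  nf_sol (fpsC m.+1 e * a - x ^+ k.+1) (phi - x) y (fpsC m e^-1 * mu).
Proof.
move=> e0 y0 mu0 wphi; have ok := den_ok_mu e0 mu0.
have wlt b : (wt wx b < 2)%N -> phi b = x b.
  by move=> /wphi; rewrite fcoefD fcoefN => /subr0_eq.
have cc : coord_change phi.
  split; first by rewrite wlt ?wt0 // xvar0.
  rewrite dxE mnm0E mulr1n add0m wlt ?wt1 ?xw0 //.
  by rewrite FpsE eqxx oner_neq0.
have imu : k = 0%N -> (fpsC m e^-1 * mu) mnm0 = 0.
  by move=> /mu0 h; rewrite fcoefM0 h mulr0.
have ephi : phi = x + (phi - x) by ring.
have edx : dx phi = 1 + dx (phi - x) by rewrite {1}ephi dxD dx_xvar.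
have eden : nf_den k e mu phi =
    fpsC m.+1 e * (1 + of_lam (fpsC m e^-1 * mu) * phi ^+ k).
  rewrite /nf_den mulrDr mulr1 rmorphM /= of_lamC !mulrA -rmorphM mulfV //.
  by rewrite rmorph1 mul1r.
have key : nf_num y phi - a * dx phi * nf_den k e mu phi =
    (hom_op k (phi - x) + \sum_(j < k) of_lam (y j) * x ^+ j
     - of_lam (fpsC m e^-1 * mu) * x ^+ (k + k.+1))
    - conj_rhs (fpsC m.+1 e * a - x ^+ k.+1) (phi - x) y (of_lam (fpsC m e^-1 * mu)).
  rewrite -conj_eqE -ephi -edx eden.
  have -> : x ^+ k.+1 + (fpsC m.+1 e * a - x ^+ k.+1) = fpsC m.+1 e * a by ring.
  by congr (_ - _); ring.
split=> [[_ _ _ /(conj_nfBP _ _ _ ok) [_ h]]|[_ _ _ h]].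
  split; [exact: wphi|exact: y0|exact: wge_mu|].
  by apply/subr0_eq; rewrite -key h subrr.
split; [exact: wphi|exact: y0|exact: mu0|].
apply/(conj_nfBP _ _ _ ok); split; first exact: cc.
by apply/subr0_eq; rewrite key h subrr.
Qed.

(** The iterates producing [g] are part of the conclusion because convergence is later proved on
    them. *)
Lemma tangent_nf_iter e a tau : e != 0 -> leading e a ->
  (k = 0%N -> tau mnm0 = 0) ->
  exists (g : fps K m.+1) (y : 'I_k -> fps K m) (mu : fps K m),
    [/\ forall b i, (wt wx b < i)%N ->
          g b = iter i (fix_rhs k (fpsC m.+1 e * a - x ^+ k.+1)
                                  (of_lam tau * x ^+ k.+1)) 0 b,
        tangent_nf e a (x + (hom_inv k g + of_lam tau * x ^+ k.+1)) y mu
      & xcoef k.+1 (hom_inv k g + of_lam tau * x ^+ k.+1) = tau].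
Proof.
move=> e0 la tau0.
have wT : wge wx 2 (of_lam tau * x ^+ k.+1).
  case: (posnP k) => [k0|k0].
    by apply: wgeW (wge_of_lamX (tau0 k0)); rewrite leq_addr.
  have := wgeM (wge_0 (w := wx) (of_lam tau)) (@wge_xvarX K m k k.+1).
  by apply: wgeW; lia.
have [g [wg fg iterg]] := nf_sol_exists la wT.
have [sol etau] := fix_nf_sol wT wg fg.
have [wxi y0 wmu _] := sol.
exists g, (fun j => xcoef j g), (fpsC m e * - xcoef (k + k.+1) g).
have mu0 : k = 0%N -> (fpsC m e * - xcoef (k + k.+1) g) mnm0 = 0.
  move=> k0; have := wmu (mcons (k + k.+1) mnm0).
  rewrite fcoef_of_lamX mcons0 mconsK eqxx wt_xw mdeg0 fcoefM0 => ->.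
    by rewrite mulr0.
  by lia.
split; [exact: iterg| |exact: etau].
have exi : x + (hom_inv k g + of_lam tau * x ^+ k.+1) - x =
          hom_inv k g + of_lam tau * x ^+ k.+1 by ring.
apply/(nf_solP _ e0 y0 mu0); rewrite exi; first exact: wxi.
have ec (c : fps K m) : fpsC m e^-1 * (fpsC m e * c) = c.
  by rewrite mulrA -rmorphM mulVf // rmorph1 mul1r.
by rewrite ec; exact: sol.
Qed.

Lemma tangent_nf_exists e a tau : e != 0 -> leading e a ->
  (k = 0%N -> tau mnm0 = 0) ->
  exists phi y mu, tangent_nf e a phi y mu /\ xcoef k.+1 (phi - x) = tau.
Proof.
move=> e0 la /(tangent_nf_iter e0 la)[g [y [mu [_ tg etau]]]].
exists (x + (hom_inv k g + of_lam tau * x ^+ k.+1)), y, mu; split; first exact: tg.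
by rewrite addrC addKr.
Qed.

Lemma tangent_nf_unique (P : pred (multinom m)) e a a' phi phi' y y' mu mu' :
  dclosed P -> e != 0 -> leading e a -> leading e a' ->
  agree P a a' ->
  (forall b, P b -> xcoef k.+1 phi b = xcoef k.+1 phi' b) ->
  tangent_nf e a phi y mu -> tangent_nf e a' phi' y' mu' ->
  [/\ agree P phi phi',
      forall j b, P b -> y j b = y' j b & forall b, P b -> mu b = mu' b].
Proof.
move=> dP e0 la la' haa' htau t t'.
have [w1 y0 mu0 _] := t; have [w1' y0' mu0' _] := t'.
move/(nf_solP _ e0 y0 mu0 w1): t => t; move/(nf_solP _ e0 y0' mu0' w1'): t' => t'.
have [||h1 h2 h3] := nf_sol_unique dP la la' _ _ t t'.
- by apply: agreeB => //; exact: agreeCM.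
- by move=> b Pb; rewrite !xcoefD !fcoefD htau.
split=> // [|b /h3].
  by move=> b Pb; move: (h1 b Pb); rewrite !fcoefD => /addIr.
by rewrite !fcoefCM => /mulfI; apply; rewrite invr_eq0.
Qed.

End TangentConjugacy.

(** * Coordinate changes and leading terms *)

Section CoordinateChanges.
Variables (K : fieldType) (m : nat).
Implicit Types (a b c f phi psi sig xi : fps K m.+1).
Local Notation x := (xvar K m).
Local Notation lam := (@lamvar K m).
Local Notation w2 := (@xw m 2).

Lemma subst_id f : subst f x lam = f.
Proof.
rewrite -[RHS]fcomp_id; apply: eq_fcomp => i.
by case: (unliftP ord0 i) => [j|] ->.
Qed.

Lemma subst_subst f phi psi : phi mnm0 = 0 -> psi mnm0 = 0 ->
  subst (subst f phi lam) psi lam = subst f (subst phi psi lam) lam.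
Proof.
move=> phi0 psi0; have l0 := @lamvar0 K m.
rewrite {1 2 3}/subst fcomp_comp => [|i|i]; try by case: unliftP.
apply: eq_fcomp => i; case: (unliftP ord0 i) => [j _|_ //].
by rewrite fcompX ?liftK // => i'; case: unliftP.
Qed.

Lemma dx_subst_lam f phi : phi mnm0 = 0 ->
  dx (subst f phi lam) = subst (dx f) phi lam * dx phi.
Proof. by move=> phi0; apply: dx_subst => // j; rewrite ?lamvar0 ?dx_lamvar. Qed.

Lemma coord_change_subst phi psi : coord_change phi -> coord_change psi ->
  coord_change (subst phi psi lam).
Proof.
move=> [phi0 dphi] [psi0 dpsi]; have l0 := @lamvar0 K m.
by split; rewrite ?dx_subst_lam ?fcoefM0 ?subst0 ?mulf_neq0.
Qed.

Lemma conj_trans a b c phi psi :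
  conjugacy a b phi -> conjugacy b c psi -> conjugacy a c (subst psi phi lam).
Proof.
move=> [cphi ephi] [cpsi epsi]; split; first exact: coord_change_subst.
have [phi0 _] := cphi; have [psi0 _] := cpsi; have l0 := @lamvar0 K m.
by rewrite -subst_subst // epsi substM // ephi dx_subst_lam // mulrAC mulrA.
Qed.

Lemma conj_inv a b phi sig : coord_change sig -> subst phi sig lam = x ->
  conjugacy a b phi -> conjugacy b a sig.
Proof.
move=> csig inv [[phi0 _] ephi]; split=> //.
have [sig0 _] := csig; have l0 := @lamvar0 K m.
have := congr1 (fun f => subst f sig lam * dx sig) ephi.
rewrite /= subst_subst // inv subst_id => ->; rewrite substM // -mulrA.
by rewrite -dx_subst_lam // inv dx_xvar mulr1.
Qed.

Lemma wge_linear W phi : (1 < W)%N ->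
  wge (xw W) 2 (phi - fpsC m.+1 (dx phi mnm0) * x) <-> phi mnm0 = 0.
Proof.
move=> W1; split=> [h|phi0 a].
  have := h mnm0; rewrite wt0 fcoefD fcoefN fcoefCM xvar0 mulr0 subr0.
  exact.
rewrite -(mcons_eta a) wt_xw fcoefD fcoefN fcoefCM => lta.
have [tb|nb] := eqVneq (mtail a) mnm0; last first.
  rewrite -mdeg_eq0 -lt0n in nb; move: lta.
  by case: (mdeg _) nb => // d _; rewrite mulnS => lt; exfalso; lia.
rewrite tb; case: (a ord0) lta => [|[|i]]; last first.
- by [].
- by rewrite dxE mnm0E add0m xvarE FpsE mnm1_e0 eqxx mulr1n mulr1 subrr.
by rewrite mcons00 phi0 xvar0 mulr0 subrr.
Qed.

Lemma wge_tangent W phi : (1 < W)%N ->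
  wge (xw W) 2 (phi - x) <-> phi mnm0 = 0 /\ dx phi mnm0 = 1.
Proof.
move=> W1; split=> [h|[phi0 phi1]]; last first.
  by have /(wge_linear _ W1) := phi0; rewrite phi1 rmorph1 mul1r.
split; first by have := h mnm0; rewrite wt0 fcoefD fcoefN xvar0 subr0; apply.
have := h (mnm1 ord0); rewrite wt1 xw0 dxE mnm0E add0m mulr1n fcoefD fcoefN FpsE eqxx.
by move=> /(_ isT) /subr0_eq.
Qed.

Lemma wge_lamvar W (j : 'I_m) : wge (xw W) W (lamvar K j).
Proof. by move: (@wgeX1 K m.+1 (xw W) (lift ord0 j)); rewrite xwS. Qed.

Lemma wge_xvar W : wge (xw W) 1 x.
Proof. by move: (@wgeX1 K m.+1 (xw W) ord0); rewrite xw0. Qed.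

(** For [phi = e x + xi], the equation [phi(sig) = x] reads [sig = e^-1 (x - xi(sig))], which is
    contracting as [xi] has order 2. *)
Definition inv_rhs (e : K) xi sig := fpsC m.+1 e^-1 * (x - subst xi sig lam).

Lemma near_inv_rhs (e : K) xi s sig sig' : wge w2 2 xi ->
  near predT w2 1 s sig sig' ->
  near predT w2 1 s.+1 (inv_rhs e xi sig) (inv_rhs e xi sig').
Proof.
move=> wxi h; rewrite /inv_rhs.
have hs : near predT w2 1 s.+1 (subst xi sig lam) (subst xi sig' lam).
  have : near predT w2 2 s (subst xi sig lam) (subst xi sig' lam).
    apply: near_fcomp wxi => // i; rewrite /xw; case: (unliftP ord0 i) => // j _.
    by apply: near_refl; exact: wge_lamvar.
  by apply: nearW; lia.
have hx : near predT w2 1 s.+1 x x by apply: near_refl; exact: wge_xvar.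
have hc : near predT w2 0 s.+1 (fpsC m.+1 e^-1) (fpsC m.+1 e^-1) by exact: near_refl.
exact: (nearM (@dclosed_predT _) hc (nearB hx hs)).
Qed.

Lemma inv_exists phi (e := dx phi mnm0) : coord_change phi ->
  exists sig, [/\ coord_change sig, dx sig mnm0 = e^-1, subst phi sig lam = x
  & forall (d : multinom m.+1) i, (wt w2 d < i)%N ->
      sig d = iter i (inv_rhs e (phi - fpsC m.+1 e * x)) 0 d].
Proof.
move=> [phi0 e0]; pose xi := phi - fpsC m.+1 e * x; have l0 := @lamvar0 K m.
have wxi : wge w2 2 xi by apply/wge_linear.
have [sig [wsig fsig itsig]] := fps_fix (fun s f g => @near_inv_rhs e xi s f g wxi).
have sig0 : sig mnm0 = 0 by rewrite wsig // wt0.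
have dsig : dx sig mnm0 = e^-1.
  rewrite -fsig /inv_rhs dxM dxC mul0r add0r fcoefCM dxB dx_xvar dx_subst_lam //.
  rewrite fcoefD fcoefN fcoef1 eqxx fcoefM0 subst0 // dxE add0m mnm0E mulr1n.
  by rewrite wxi ?wt1 ?xw0 // mul0r subr0 mulr1.
exists sig; split=> //; first by split=> //; rewrite dsig invr_eq0.
have -> : phi = xi + fpsC m.+1 e * x by rewrite /xi subrK.
rewrite substD // substM // substC // subst_xvar // -{2}fsig /inv_rhs mulrA.
by rewrite -rmorphM divff // rmorph1 mul1r addrC subrK.
Qed.

(** [sig] has itself a right inverse, and associativity identifies it with [phi]. *)
Lemma inv_left phi sig : coord_change phi -> coord_change sig ->
  subst phi sig lam = x -> subst sig phi lam = x.
Proof.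
move=> [phi0 _] csig inv; have [rho [[rho0 _] _ inv' _]] := inv_exists csig.
have [sig0 _] := csig; have l0 := @lamvar0 K m.
suff -> : phi = rho by [].
by rewrite -[phi]subst_id -inv' -subst_subst // inv subst_xvar.
Qed.

Lemma formally_conjugate_cancel a b c phi psi :
  conjugacy a b phi -> conjugacy a c psi ->
  exists chi, [/\ conjugacy b c chi, psi = subst chi phi lam
    & dx chi mnm0 = dx psi mnm0 / dx phi mnm0].
Proof.
move=> cab cac; have [cphi _] := cab; have [cpsi _] := cac.
have [sig [csig dsig inv _]] := inv_exists cphi.
have [phi0 _] := cphi; have [psi0 _] := cpsi; have [sig0 _] := csig.
exists (subst psi sig lam); split.
- exact: conj_trans (conj_inv csig inv cab) cac.
- by rewrite subst_subst // (inv_left cphi csig inv) subst_id.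
by rewrite dx_subst_lam // fcoefM0 subst0 ?dsig //; apply: lamvar0.
Qed.

End CoordinateChanges.

Section Leading.
Variables (K : numFieldType) (m k : nat).
Implicit Types (a b f phi : fps K m.+1) (y : 'I_k -> fps K m) (mu : fps K m) (e c : K).
Local Notation x := (xvar K m).
Local Notation lam := (@lamvar K m).
Local Notation wx := (@xw m k.+2).

Definition lead p c f := wge wx p.+1 (f - fpsC m.+1 c * x ^+ p).

Lemma lead_wge p c f : lead p c f -> wge wx p f.
Proof.
move=> h; rewrite -(subrK (fpsC m.+1 c * x ^+ p) f); apply: wgeD.
  exact: wgeW (leqnSn _) h.
by apply: wgeCM; apply: wge_xvarX.
Qed.

Lemma leadM p q c d f g : lead p c f -> lead q d g -> lead (p + q) (c * d) (f * g).
Proof.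
move=> hf hg; rewrite /lead rmorphM exprD.
have -> : f * g - fpsC m.+1 c * fpsC m.+1 d * (x ^+ p * x ^+ q) =
    f * (g - fpsC m.+1 d * x ^+ q) + (f - fpsC m.+1 c * x ^+ p) * (fpsC m.+1 d * x ^+ q).
  by ring.
apply: wgeD; first by rewrite -addnS; exact: (wgeM (lead_wge hf) hg).
by rewrite -addSn; apply: (wgeM hf); apply: wgeCM; apply: wge_xvarX.
Qed.

Lemma leadX c f i : lead 1 c f -> lead i (c ^+ i) (f ^+ i).
Proof.
move=> hf; elim: i => [|i IHi]; last by rewrite !exprS; exact: leadM hf IHi.
by rewrite /lead !expr0 rmorph1 mulr1 subrr.
Qed.

Lemma lead_inj p c d f : lead p c f -> lead p d f -> c = d.
Proof.
move=> hc hd; have := hc (mcons p mnm0); have := hd (mcons p mnm0).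
rewrite wt_xw mdeg0 muln0 addn0 => /(_ (ltnSn _)) + /(_ (ltnSn _)).
rewrite !fcoefD !fcoefN !fcoefCM xvarXE mnm_muln_e0 FpsE eqxx !mulr1.
by move=> /subr0_eq <- /subr0_eq.
Qed.

Lemma lead_coord phi : phi mnm0 = 0 -> lead 1 (dx phi mnm0) phi.
Proof. by move=> phi0; rewrite /lead expr1; apply/wge_linear. Qed.

Lemma lead_dx phi : phi mnm0 = 0 -> lead 0 (dx phi mnm0) (dx phi).
Proof.
move=> phi0; rewrite /lead expr0 mulr1.
have /wge_dx := lead_coord phi0; rewrite xw0 expr1 dxB dxM dxC mul0r add0r dx_xvar.
by rewrite mulr1.
Qed.

Lemma leadingP e a : e != 0 -> leading k e a <-> lead k.+1 e^-1 a.
Proof.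
move=> e0; split=> /wgeCM.
  move=> /(_ e^-1); rewrite mulrBr mulrA -rmorphM mulVf // rmorph1 mul1r.
  exact.
by move=> /(_ e); rewrite mulrBr mulrA -rmorphM divff // rmorph1 mul1r.
Qed.

Lemma lead_subst e b phi : lead k.+1 e b -> phi mnm0 = 0 ->
  lead k.+1 (e * dx phi mnm0 ^+ k.+1) (subst b phi lam).
Proof.
move=> hb phi0; have l0 := @lamvar0 K m.
have hphi := leadX (i := k.+1) (lead_coord phi0).
have w1 : wge wx 1 phi by apply: lead_wge (lead_coord phi0).
have -> : b = (b - fpsC m.+1 e * x ^+ k.+1) + fpsC m.+1 e * x ^+ k.+1 by rewrite subrK.
rewrite substD // substM // substC // substXn // subst_xvar // /lead -addrA.
apply: wgeD; last by rewrite rmorphM -mulrA -mulrBr; apply: wgeCM.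
apply: wge_fcomp hb => i; case: (unliftP ord0 i) => [j|] ->.
  by rewrite xwS; exact: wge_lamvar.
by rewrite xw0.
Qed.

(** With [c] the linear coefficient of [phi], the coefficients of [x^(k+1)] on both sides of the
    conjugacy equation are [c^(k+1) / e'] and [c / e]. *)
Lemma conj_leading e e' a b phi : e != 0 -> e' != 0 -> leading k e a ->
  leading k e' b -> conjugacy a b phi -> e' = e * dx phi mnm0 ^+ k.
Proof.
move=> e0 e'0 /(leadingP _ e0) la /(leadingP _ e'0) lb [[phi0 c0] eqn].
have := lead_subst lb phi0; rewrite eqn => h1.
have := leadM la (lead_dx phi0); rewrite addn0 => h2.
have := lead_inj h1 h2; rewrite exprSr mulrA => /(mulIf c0) h.
by rewrite -(mulVKf e'0 (_ ^+ k)) h mulrCA divff // mulr1.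
Qed.

(** Below weight [k+2] there are only pure powers of [x], so the field at [lambda = 0] decides. *)
Lemma unfolds_leading a omega : unfolds k a omega -> leading k (omega mnm0) a.
Proof.
move=> [w0 ea]; apply/leadingP => // b ltb; move: ltb.
rewrite -(mcons_eta b) wt_xw => ltb; have b0 : mtail b = mnm0.
  apply/eqP; rewrite -mdeg_eq0 -leqn0 leqNgt; apply/negP => h.
  by move: ltb; case: (mdeg _) h => // d _; rewrite mulnS; lia.
rewrite b0; rewrite b0 mdeg0 muln0 addn0 in ltb.
have -> : (a - fpsC m.+1 (omega mnm0)^-1 * x ^+ k.+1) (mcons (b ord0) mnm0) =
  at_lam0 (a - fpsC m.+1 (omega mnm0)^-1 * x ^+ k.+1) (mcons (b ord0) mnm0).
  by rewrite [RHS]FpsE mcons0.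
rewrite at_lam0B at_lam0M at_lam0C at_lam0Xn at_lam0_xvar ea.
rewrite [fpsC _ _ * _]mulrC -mulrBr fcoef_xvarM mcons0 mconsK.
case: leqP => // le; have -> : (b ord0 - k.+1)%N = 0%N by lia.
rewrite mcons00 fcoefD fcoefN fcoefC eqxx mulr1n.
suff -> : omega^-1 mnm0 = (omega mnm0)^-1 by rewrite subrr.
by apply: (mulfI w0); rewrite -fcoefM0 mulrV ?fps_unitE // divff // fcoef1 eqxx.
Qed.

Lemma xvarX0 n i : (xvar K n ^+ i) mnm0 = (i == 0%N)%:R.
Proof. by case: i => [|i]; rewrite ?expr0 ?fcoef1 ?eqxx // exprS fcoefM0 xvar0 mul0r. Qed.

Lemma at_lam0_nfB e y mu : e != 0 -> (forall j, y j mnm0 = 0) ->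
  den_ok k e mu ->
  at_lam0 (nfB e y mu) =
    xvar K 0 ^+ k.+1 / (fpsC 1 e + fpsC 1 (mu mnm0) * xvar K 0 ^+ k).
Proof.
move=> e0 y0 ok; rewrite nfBE at_lam0M at_lam0V -?den_okP ?xvar0 //.
rewrite /nf_num /nf_den !at_lam0D at_lam0_sum at_lam0Xn at_lam0_xvar big1 => [|j _].
  by rewrite addr0 at_lam0C at_lam0M at_lam0Xn at_lam0_xvar at_lam0_of_lam.
by rewrite at_lam0M at_lam0_of_lam y0 rmorph0 mul0r.
Qed.

Lemma unfolds_nfB e y mu : e != 0 -> (forall j, y j mnm0 = 0) ->
  den_ok k e mu ->
  unfolds k (nfB e y mu) (fpsC 1 e + fpsC 1 (mu mnm0) * xvar K 0 ^+ k).
Proof.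
move=> e0 y0 ok; split; last exact: at_lam0_nfB.
rewrite fcoefD fcoefCM fcoefC eqxx mulr1n.
rewrite xvarX0; exact: ok.
Qed.

Lemma leading_nfB e y mu : e != 0 -> (forall j, y j mnm0 = 0) ->
  (k = 0%N -> mu mnm0 = 0) -> leading k e (nfB e y mu).
Proof.
move=> e0 y0 mu0; have := unfolds_leading (unfolds_nfB e0 y0 (den_ok_mu e0 mu0)).
rewrite fcoefD fcoefCM fcoefC eqxx mulr1n xvarX0.
by case: (eqVneq k 0%N) => [/mu0 ->|_]; rewrite ?mul0r ?mulr0 addr0.
Qed.

Lemma of_lamCM c (f : fps K m) : of_lam (fpsC m c * f) = fpsC m.+1 c * of_lam f.
Proof. by rewrite -of_lamC -(rmorphM (@of_lam K m)). Qed.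

(** Under [phi -> c phi] the numerator scales by [c^(k+1)], the denominator by [c^k] and the
    derivative by [c]. The power [c^(k+1-j)] on [y_j] makes the numerator homogeneous, while [mu], a
    residue, is unaffected. *)
Lemma conj_scale e c y mu a phi : c != 0 -> den_ok k e mu ->
  conjugacy a (nfB (e * c ^+ k) (fun j => fpsC m (c ^+ (k.+1 - j)) * y j) mu)
    (fpsC m.+1 c * phi) <->
  conjugacy a (nfB e y mu) phi.
Proof.
move=> c0 ok; have ok' : den_ok k (e * c ^+ k) mu.
  move: ok; rewrite /den_ok; case: (eqVneq k 0%N) => [->|_].
    by rewrite expr0 mulr1.
  by rewrite mulr0 !addr0 => e0; rewrite mulf_neq0 ?expf_neq0.
have dxc : dx (fpsC m.+1 c * phi) = fpsC m.+1 c * dx phi.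
  by rewrite dxM dxC mul0r add0r.
have enum : nf_num (fun j => fpsC m (c ^+ (k.+1 - j)) * y j) (fpsC m.+1 c * phi) =
    fpsC m.+1 (c ^+ k.+1) * nf_num y phi.
  rewrite /nf_num exprMn -rmorphXn mulrDr mulr_sumr; congr (_ + _).
  apply: eq_bigr => j _; rewrite exprMn -rmorphXn of_lamCM.
  have -> : c ^+ k.+1 = c ^+ (k.+1 - j) * c ^+ j.
    by rewrite -exprD subnK //; have := ltn_ord j; lia.
  by rewrite (rmorphM (fpsC m.+1)) /=; ring.
have eden : nf_den k (e * c ^+ k) mu (fpsC m.+1 c * phi) =
    fpsC m.+1 (c ^+ k) * nf_den k e mu phi.
  by rewrite /nf_den exprMn -rmorphXn rmorphM /=; ring.
have cc : coord_change (fpsC m.+1 c * phi) <-> coord_change phi.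
  rewrite /coord_change dxc !fcoefCM; split=> -[]; last first.
    by move=> -> h; rewrite mulr0; split=> //; rewrite mulf_neq0.
  move/eqP; rewrite mulf_eq0 (negbTE c0) /= => /eqP h1.
  by rewrite mulf_eq0 negb_or => /andP[].
have u : fpsC m.+1 (c ^+ k.+1) \is a GRing.unit.
  by rewrite fps_unitE fcoefC eqxx mulr1n expf_neq0.
have erhs : a * dx (fpsC m.+1 c * phi) * nf_den k (e * c ^+ k) mu (fpsC m.+1 c * phi) =
    fpsC m.+1 (c ^+ k.+1) * (a * dx phi * nf_den k e mu phi).
  by rewrite eden dxc exprS (rmorphM (fpsC m.+1)) /=; ring.
split=> [/(conj_nfBP _ _ _ ok') [/cc h1 h2]|/(conj_nfBP _ _ _ ok) [/cc h1 h2]].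
  apply/(conj_nfBP _ _ _ ok); split; first exact: h1.
  by apply: (mulrI u); rewrite -enum -erhs.
apply/(conj_nfBP _ _ _ ok'); split; first exact: h1.
by rewrite enum erhs h2.
Qed.

End Leading.

(** * Flows *)

Section XcoefM.
Variables (K : fieldType) (m : nat).

Lemma of_lam_fpsX (j : 'I_m) : of_lam (fpsX K j) = lamvar K j.
Proof. by rewrite of_lam_comp fcompX // => i; apply: lamvar0. Qed.

Lemma xcoef_of_lamM (c : fps K m) f j : xcoef j (of_lam c * f) = c * xcoef j f.
Proof.
pose P (g : fps K m) := forall f, xcoef j (of_lam g * f) = g * xcoef j f.
have subD g h f' : xcoef j (of_lam (g - h) * f') =
    xcoef j (of_lam g * f') - xcoef j (of_lam h * f').
  by rewrite rmorphB mulrBl xcoefD xcoefN.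
apply: (@fps_eq_wge _ _ deg1) => N.
have [||e|i|g Pg cg] := @fps_approx K m P _ _ _ _ N c.
- by move=> g h Pg Ph f'; rewrite rmorphD !mulrDl xcoefD Pg Ph.
- by move=> g h Pg Ph f'; rewrite rmorphM -!mulrA Pg Ph.
- by move=> f'; apply: fpsP => b; rewrite of_lamC xcoefE !fcoefCM xcoefE.
- move=> f'; rewrite of_lam_fpsX; apply: fpsP => b.
  rewrite xcoefE -[lamvar K i]/(fmon K (mnm1 (lift ord0 i))) fcoef_fmonM.
  rewrite -[fpsX K i]/(fmon K (mnm1 i)) fcoef_fmonM !lep1mP mconsS.
  case: ifP => // _; rewrite xcoefE; congr (fcoef f' _); apply/mnmP => l.
  rewrite mnmBE mnm1E; case: (unliftP ord0 l) => [l'|] ->.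
    by rewrite !mconsS mnmBE mnm1E (inj_eq (@lift_inj _ _)).
  by rewrite !mcons0 eq_sym (negbTE (neq_lift _ _)) subn0.
have -> : xcoef j (of_lam c * f) - c * xcoef j f =
    xcoef j (of_lam (c - g) * f) - (c - g) * xcoef j f.
  by rewrite subD Pg; ring.
apply: wgeD; last first.
  by apply: wgeN; rewrite -[N]addn0; apply: wgeM => //; apply: wge_0.
(* [x] has weight 0: multiplication by the arbitrary series [f] then preserves the order in lambda
   of [c - g]. *)
pose wl (i : 'I_m.+1) := if unlift ord0 i is Some _ then 1%N else 0%N.
have wcg : wge wl N (of_lam (c - g)).
  apply: wge_of_lam => b; rewrite (_ : wt _ b = wt deg1 b); first exact: cg.
  by apply: eq_bigr => i _; rewrite /wl liftK.
have wcgf : wge wl N (of_lam (c - g) * f) by rewrite -[N]addn0; exact: (wgeM wcg (wge_0 f)).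
move=> b ltb; rewrite xcoefE wcgf // wt_mcons /wl unlift_none mul0n add0n.
rewrite (_ : wt _ b = wt deg1 b) //.
by apply: eq_bigr => i _; rewrite liftK.
Qed.

End XcoefM.

Section Flow.
Variables (K : numFieldType) (m k : nat) (a : fps K m.+1).
Local Notation x := (xvar K m).
Local Notation lam := (@lamvar K m).
Local Notation wx := (@xw m k.+2).
Hypotheses (k0 : (0 < k)%N) (wa : wge wx k.+1 a).
Implicit Types (f g : fps K m.+1).

Definition lie f := a * dx f.

(** Each application of the field gains [k > 0] orders, which makes the exponential series
    converge. *)
Lemma wge_lie p f : wge wx p f -> wge wx (p + k) (lie f).
Proof.
move=> wf; have wd : wge wx (p - 1) (dx f) by move/wge_dx: wf; rewrite xw0.
by apply: wgeW (wgeM wa wd); lia.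
Qed.

Lemma lieM f g : lie (f * g) = lie f * g + f * lie g.
Proof. by rewrite /lie dxM; ring. Qed.

Lemma lieCM c f : lie (fpsC m.+1 c * f) = fpsC m.+1 c * lie f.
Proof. by rewrite /lie dxM dxC; ring. Qed.

Lemma lie_of_lamM (c : fps K m) f : lie (of_lam c * f) = of_lam c * lie f.
Proof. by rewrite /lie dxM dx_of_lam; ring. Qed.

Lemma lieD f g : lie (f + g) = lie f + lie g.
Proof. by rewrite /lie dxD mulrDr. Qed.

Lemma lie_sum I (r : seq I) (P : pred I) (F : I -> fps K m.+1) :
  lie (\sum_(i <- r | P i) F i) = \sum_(i <- r | P i) lie (F i).
Proof. by rewrite /lie dx_sum mulr_sumr. Qed.

(** Divided powers of the field, for which the Leibniz rule has no binomial coefficients. *)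
Definition lied i f := fpsC m.+1 (i`!%:R^-1) * iter i lie f.

Lemma lied0 f : lied 0 f = f.
Proof. by rewrite /lied fact0 invr1 rmorph1 mul1r. Qed.

Lemma liedS i f : fpsC m.+1 i.+1%:R * lied i.+1 f = lie (lied i f).
Proof.
rewrite /lied lieCM mulrA -(rmorphM (fpsC m.+1)) factS natrM invfM.
by rewrite mulVKf ?pnatr_eq0.
Qed.

Lemma lied_lie i f : lied i (lie f) = lie (lied i f).
Proof. by rewrite /lied lieCM -iterSr. Qed.

Lemma wge_lied p i f : wge wx p f -> wge wx (p + i * k) (lied i f).
Proof.
move=> wf; apply: wgeCM; elim: i => [|i IHi]; first by rewrite addn0.
by rewrite mulSn [(k + _)%N]addnC addnA; exact: wge_lie.
Qed.

Lemma natC_inj i f g : fpsC m.+1 i.+1%:R * f = fpsC m.+1 i.+1%:R * g -> f = g.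
Proof.
move=> e; apply: fpsP => b; have := congr1 (fun f : fps K m.+1 => f b) e.
by rewrite /= !fcoefCM => /mulfI; apply; rewrite pnatr_eq0.
Qed.

Lemma liedD i f g : lied i (f + g) = lied i f + lied i g.
Proof.
rewrite /lied -mulrDr; congr (_ * _).
by elim: i => // i IHi; rewrite !iterS IHi lieD.
Qed.

Lemma liedM n f g :
  lied n (f * g) = \sum_(i < n.+1) lied i f * lied (n - i) g.
Proof.
elim: n => [|n IHn]; first by rewrite big_ord1 subn0 !lied0.
apply: (@natC_inj n); rewrite liedS IHn lie_sum mulr_sumr.
(* Splitting [n+1 = i + (n+1-i)] produces the two sums that arise when the field is applied to the
   product formula for [n]. *)
have -> : \sum_(i < n.+2) fpsC m.+1 n.+1%:R * (lied i f * lied (n.+1 - i) g) =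
    \sum_(i < n.+2) fpsC m.+1 i%:R * lied i f * lied (n.+1 - i) g +
    \sum_(i < n.+2) lied i f * (fpsC m.+1 (n.+1 - i)%:R * lied (n.+1 - i) g).
  rewrite -big_split; apply: eq_bigr => i _ /=.
  have -> : n.+1%:R = i%:R + (n.+1 - i)%:R :> K by rewrite -natrD subnKC ?leq_ord.
  by rewrite (rmorphD (fpsC m.+1)) /=; ring.
rewrite [X in _ = X + _]big_ord_recl [X in _ = _ + X]big_ord_recr /=.
rewrite subnn rmorph0 !mul0r mulr0 add0r addr0 -big_split; apply: eq_bigr => i _ /=.
have -> : bump 0 i = i.+1 by [].
rewrite lieM liedS subSS; congr (_ + _ * _).
by rewrite subSn ?leq_ord // liedS.
Qed.

Variable t : fps K m.

Definition flow_term i f := of_lam t ^+ i * lied i f.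
Definition flow_sum N f := \sum_(i < N) flow_term i f.
Definition flow f : fps K m.+1 := Fps (fun d => flow_sum (wt wx d).+1 f d).

Lemma wge_flow_term p i f : wge wx p f -> wge wx (p + i) (flow_term i f).
Proof.
move=> /(wge_lied (i := i)) h; have h0 := wge_0 (w := wx) (of_lam t ^+ i).
by apply: wgeW (wgeM h0 h); rewrite add0n leq_add2l leq_pmulr.
Qed.

Lemma flow_term_small i f d : (wt wx d < i)%N -> flow_term i f d = 0.
Proof. by move=> lt; apply: (wge_flow_term (p := 0)); rewrite ?add0n //; apply: wge_0. Qed.

Lemma flow_sumE N f d : (wt wx d < N)%N -> flow_sum N f d = flow f d.
Proof.
move=> lt; rewrite /flow FpsE /flow_sum !fcoef_sum.
rewrite [RHS](big_ord_widen N (fun i => flow_term i f d)) // [RHS]big_mkcond /=.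
apply: eq_bigr => i _; case: ltnP => // le.
by rewrite flow_term_small.
Qed.

Lemma flow_approx N M f : (N <= M)%N -> wge wx N (flow f - flow_sum M f).
Proof.
by move=> le d lt; rewrite fcoefD fcoefN flow_sumE ?subrr // (leq_trans lt).
Qed.

Lemma flow_eq f g : (forall N, wge wx N (flow_sum N f - g)) -> flow f = g.
Proof.
move=> h; apply: (@fps_eq_wge _ _ wx) => N.
rewrite (_ : _ - _ = (flow f - flow_sum N f) + (flow_sum N f - g)); last by ring.
by apply: wgeD => //; apply: flow_approx.
Qed.

Lemma wge_flow p f : wge wx p f -> wge wx p (flow f).
Proof.
move=> wf d lt; rewrite /flow FpsE; apply: (wge_sum (N := p)) lt => i _.
by apply: wgeW (wge_flow_term wf); rewrite leq_addr.
Qed.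

Lemma flowD f g : flow (f + g) = flow f + flow g.
Proof.
apply: fpsP => d; rewrite fcoefD -!(flow_sumE _ (ltnSn (wt wx d))) -fcoefD.
rewrite /flow_sum -big_split; congr (fcoef _ d); apply: eq_bigr => i _.
by rewrite /flow_term liedD mulrDr.
Qed.

Lemma flowM f g : flow (f * g) = flow f * flow g.
Proof.
apply: flow_eq => N.
suff h : wge wx N (flow_sum N f * flow_sum N g - flow_sum N (f * g)).
  rewrite (_ : _ - _ = - (flow_sum N f * flow_sum N g - flow_sum N (f * g))
    - ((flow f - flow_sum N f) * flow g + (flow g - flow_sum N g) * flow_sum N f));
    last by ring.
  apply: wgeD; apply: wgeN => //.
  have h0 (u : fps K m.+1) : wge wx 0 u by exact: wge_0.
  have hf := wgeM (flow_approx f (leqnn N)) (h0 (flow g)).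
  have hg := wgeM (flow_approx g (leqnn N)) (h0 (flow_sum N f)).
  by rewrite addn0 in hf hg; apply: wgeD.
(* The partial sums are values at 1 of polynomials. Below index [N] the coefficients of [A * B] are
   the terms of the flow of [f * g]; the remaining ones have order at least [N]. *)
pose A := \poly_(i < N) flow_term i f; pose B := \poly_(i < N) flow_term i g.
have hP h : (\poly_(i < N) flow_term i h).[1] = flow_sum N h.
  by rewrite horner_poly; apply: eq_bigr => i _; rewrite expr1n mulr1.
have sAB : (size (A * B)%R <= N + N)%N.
  by rewrite (leq_trans (size_polyMleq _ _)) // (leq_trans (leq_pred _)) // leq_add ?size_poly.
rewrite -!hP -/A -/B -hornerM (horner_coef_wide _ sAB) big_split_ord /=.
rewrite horner_poly.
have coefAB i : (i < N)%N -> (A * B)`_i = flow_term i (f * g).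
  move=> lti; rewrite coefM /flow_term liedM mulr_sumr; apply: eq_bigr => j _.
  rewrite !coef_poly (leq_ltn_trans (leq_ord j) lti) (leq_ltn_trans (leq_subr _ _) lti).
  rewrite /flow_term; have -> : of_lam t ^+ i = of_lam t ^+ j * of_lam t ^+ (i - j).
    by rewrite -exprD subnKC ?leq_ord.
  by ring.
have -> : \sum_(i < N) (A * B)`_i * 1 ^+ i = \sum_(i < N) flow_term i (f * g) * 1 ^+ i.
  by apply: eq_bigr => i _; rewrite coefAB.
have addAK (u v : fps K m.+1) : u + v - u = v by ring.
rewrite addAK; apply: wge_sum => i _; rewrite expr1n mulr1 coefM.
apply: wge_sum => j _; rewrite !coef_poly.
case: ifP => _; last by rewrite mul0r.
case: ifP => _; last by rewrite mulr0.
have hf := wge_flow_term (i := j) (wge_0 (w := wx) f).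
have hg := wge_flow_term (i := (N + i - j)%N) (wge_0 (w := wx) g).
by apply: wgeW (wgeM hf hg); have := leq_ord j; lia.
Qed.

Lemma flow_const f : dx f = 0 -> flow f = f.
Proof.
move=> df; apply: flow_eq => -[|N]; first exact: wge_0.
rewrite /flow_sum big_ord_recl /flow_term lied0 expr0 mul1r big1 ?addr0 ?subrr // => i _.
have -> : lied (lift ord0 i) f = 0; last by rewrite mulr0.
rewrite /lied /= -iterS iterSr /lie df mulr0.
have -> : iter i lie 0 = 0 by elim: (nat_of_ord i) => // j IHj; rewrite iterS IHj /lie dx0 mulr0.
by rewrite mulr0.
Qed.

Lemma flow_lie f : flow (lie f) = lie (flow f).
Proof.
apply: flow_eq => N; rewrite (_ : flow_sum N (lie f) = lie (flow_sum N f)).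
  rewrite -mulrBr -dxB -[_ * _]/(lie _); have h : wge wx N (flow_sum N f - flow f).
    by rewrite -opprB; apply: wgeN; exact: flow_approx.
  by apply: wgeW (wge_lie h); rewrite leq_addr.
rewrite /flow_sum lie_sum; apply: eq_bigr => i _.
by rewrite /flow_term -rmorphXn lie_of_lamM lied_lie.
Qed.

Lemma flow_tangent : wge wx 2 (flow x - x).
Proof.
have h : wge wx 2 (flow_sum 2 x - x).
  rewrite /flow_sum big_ord_recl big_ord1 /= {1}/flow_term lied0 expr0 mul1r addrC addKr.
  by apply: wgeW (wge_flow_term (i := 1) (wge_xvar K (W := k.+2))).
rewrite (_ : _ - _ = (flow x - flow_sum 2 x) + (flow_sum 2 x - x)); last by ring.
by apply: wgeD => //; exact: flow_approx.
Qed.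

Lemma flow_x0 : flow x mnm0 = 0.
Proof. by rewrite (wge_flow (wge_xvar K (W := k.+2))) // wt0. Qed.

(** Both sides are continuous ring maps in [f] that agree on the variables, since [flow] fixes
    series free of [x]. *)
Lemma flow_subst f : flow f = subst f (flow x) lam.
Proof.
have l0 := @lamvar0 K m; have fx0 := flow_x0.
apply: (@fps_morph_ext _ _ _ wx wx flow (fun f => subst f (flow x) lam)).
- exact: wx_gt0.
- move=> N f1 f2 h; have -> : flow f1 = flow (f1 - f2) + flow f2.
    by rewrite -flowD subrK.
  by rewrite addrK; exact: wge_flow.
- move=> N f1 f2 h; rewrite -substB //; apply: wge_fcomp h => i.
  case: (unliftP ord0 i) => [j|] ->; first by rewrite xwS; exact: wge_lamvar.
  by rewrite xw0; apply: wge_flow; exact: wge_xvar.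
- exact: flowD.
- exact: flowM.
- by move=> f1 f2; rewrite substD.
- by move=> f1 f2; rewrite substM.
- by move=> c; rewrite substC // flow_const // dxC.
move=> i; case: (unliftP ord0 i) => [j|] ->.
  by rewrite subst_lamvar // flow_const // dx_lamvar.
by rewrite subst_xvar.
Qed.

(** As [a] is the field applied to [x], and the flow commutes with the field,
    [a(flow x) = flow (lie x) = lie (flow x)]. *)
Lemma flow_conj : conjugacy a a (flow x).
Proof.
have /(wge_tangent (flow x) (isT : 1 < k.+2)%N) [x0 dx1] := flow_tangent.
split; first by split; rewrite // dx1 oner_neq0.
by rewrite -flow_subst {1}(_ : a = lie x) ?flow_lie // /lie dx_xvar mulr1.
Qed.

Lemma flow_is_flow : is_flow a t (flow x).
Proof.
move=> d; exists (wt wx d).+1 => N lt; rewrite -(flow_sumE _ lt) /flow_sum.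
congr (fcoef _ d); apply: eq_bigr => i _.
by rewrite /flow_term /lied rmorphXn mulrA.
Qed.

End Flow.

Section FlowTime.
Variables (K : numFieldType) (m k : nat) (a : fps K m.+1) (e : K).
Local Notation x := (xvar K m).
Local Notation wx := (@xw m k.+2).
Hypotheses (k0 : (0 < k)%N) (e0 : e != 0) (la : leading k e a).

Lemma leading_wge : wge wx k.+1 a.
Proof. by apply: lead_wge; apply/leadingP; [exact: e0|exact: la]. Qed.

(** The coefficient of [x^(k+1)] in the flow is [t / e] plus a series in [t] whose coefficients
    [h' i] vanish at [lambda = 0], so prescribing it is a fixed point equation for [t]. *)
Lemma flow_time tau : exists t, xcoef k.+1 (flow k a t x) = tau.
Proof.
have wa := leading_wge; pose h i := xcoef k.+1 (lied a i x).
pose h' i := h i - fpsC m (e^-1 *+ (i == 1)%N).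
have wl i : wge wx (1 + i * k) (lied a i x) by apply: wge_lied => //; exact: wge_xvar.
have h'1 i : wge deg1 1 (h' i).
  apply/ord1_mdeg; rewrite fcoefD fcoefN fcoefC eqxx mulr1n /h xcoefE.
  case: i => [|[|i]].
  - by rewrite lied0 xvarE FpsE mnm1_e0 subr0; case: eqP => // /mcons_inj [] /eqP;
       rewrite eqSS (gtn_eqF k0).
  - have /(_ (mcons k.+1 mnm0)) := proj1 (leadingP k a e0) la.
    rewrite wt_xw mdeg0 muln0 addn0 => /(_ (ltnSn _)).
    rewrite fcoefD fcoefN fcoefCM xvarXE mnm_muln_e0 FpsE eqxx mulr1.
    by rewrite /lied factS fact0 muln1 invr1 rmorph1 mul1r /= /lie dx_xvar mulr1 mulr1n.
  rewrite wl ?subr0 // wt_xw mdeg0 muln0 addn0.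
  by rewrite !mulSn; lia.
(* From index [M b] on, the terms of the flow do not reach the coefficient of [x^(k+1) lambda^b].
   The map [H] is therefore defined coefficient by coefficient. *)
pose M (b : multinom m) := (wt wx (mcons k.+1 b)).+1.
have [H HE] : exists H : fps K m -> fps K m, forall t b,
    H t b = e * (tau b - (\sum_(i < M b) t ^+ i * h' i) b).
  exists (fun t => Fps (fun b => (fpsC m e * (tau - \sum_(i < M b) t ^+ i * h' i)) b)).
  by move=> t b; rewrite -fcoefN -fcoefD -fcoefCM.
have [t [_ fixt _]] : exists t, [/\ wge deg1 0 t, H t = t
    & forall b i, (wt deg1 b < i)%N -> t b = iter i H 0 b].
  (* The order gained comes from [h' i], which vanishes at [lambda = 0]. *)
  apply: fps_fix => s t t' tt'; split; try exact: wge_0.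
  move=> b _; rewrite add0n => ltb; rewrite fcoefD fcoefN (HE t) (HE t').
  suff -> : (\sum_(i < M b) t ^+ i * h' i) b = (\sum_(i < M b) t' ^+ i * h' i) b.
    by rewrite subrr.
  apply/subr0_eq; rewrite -fcoefN -fcoefD -sumrB.
  apply: (vge_sum (Q := predT) (w := deg1) (N := s.+1)) => // i _.
  rewrite -mulrBl mulrC; have [_ _ /(vgeM (@dclosed_predT _) (h'1 i))] :=
    nearX (@dclosed_predT _) i tt'.
  by rewrite muln0 add0n.
exists t; apply: fpsP => b.
rewrite xcoefE -(flow_sumE k0 wa _ _ (ltnSn _)) -/(M b) -xcoefE xcoef_sum fcoef_sum.
under eq_bigr => i _ do rewrite /flow_term -rmorphXn xcoef_of_lamM -/(h i).
have := congr1 (fun f : fps K m => f b) fixt; rewrite (HE t b) fcoef_sum => tb.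
have hE i : h i = h' i + fpsC m (e^-1 *+ (i == 1)%N) by rewrite subrK.
under eq_bigr => i _ do rewrite hE mulrDr fcoefD.
rewrite big_split /=.
have M2 : (1 < M b)%N by rewrite ltnS wt_xw.
rewrite [X in _ + X](bigD1 (Ordinal M2)) //= [X in _ + (_ + X)]big1 => [|i ni]; last first.
  case: eqP => [i1|_]; first by case/eqP: ni; apply/val_inj.
  by rewrite mulr0n rmorph0 mulr0.
by rewrite addr0 expr1 mulr1n mulrC fcoefCM -tb mulKf // addrC subrK.
Qed.

End FlowTime.

(** * Conjugacies between normal forms and universality *)

Section NormalFormConjugacies.
Variables (K : numFieldType) (m k : nat).
Implicit Types (a phi : fps K m.+1) (y : 'I_k -> fps K m) (mu : fps K m) (e c : K).
Local Notation x := (xvar K m).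
Local Notation wx := (@xw m k.+2).

(** [phi] and the flow with the same coefficient of [x^(k+1)] are both tangent conjugacies from
    [nfB e y mu] to a normal form, so uniqueness identifies them together with their targets. *)
Lemma nf_conj_tangent e y y' mu mu' phi : (0 < k)%N -> e != 0 ->
  (forall j, y j mnm0 = 0) -> (forall j, y' j mnm0 = 0) ->
  conjugacy (nfB e y mu) (nfB e y' mu') phi -> dx phi mnm0 = 1 ->
  [/\ y' = y, mu' = mu & exists t, is_flow (nfB e y mu) t phi].
Proof.
move=> k0 e0 y0 y'0 cphi dphi.
have nk mu1 : k = 0%N -> mu1 mnm0 = 0 :> K by move=> ek; rewrite ek in k0.
have la := leading_nfB e0 y0 (nk mu).
have [t tE] := flow_time k0 e0 la (xcoef k.+1 phi).
have wa := leading_wge e0 la.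
have tf : tangent_nf e (nfB e y mu) (flow k (nfB e y mu) t x) y mu.
  by split; [exact: flow_tangent|exact: y0|exact: nk|exact: flow_conj].
have wphi : wge wx 2 (phi - x).
  apply/(wge_tangent _ (isT : 1 < k.+2)%N); split; last exact: dphi.
  by case: cphi => [[]].
have tphi : tangent_nf e (nfB e y mu) phi y' mu'.
  by split; [exact: wphi|exact: y'0|exact: nk|exact: cphi].
have [//||h1 h2 h3] := @tangent_nf_unique _ _ _ predT _ _ _ _ _ _ _ _ _
    (@dclosed_predT _) e0 la la _ _ tphi tf.
  by move=> b _; rewrite tE.
split.
- by apply/funext => j; apply: fpsP => b; exact: h2.
- by apply: fpsP => b; exact: h3.
exists t; have -> : phi = flow k (nfB e y mu) t x by apply: fpsP => b; exact: h1.
exact: flow_is_flow.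
Qed.

Lemma nf_conj e e' y y' mu mu' phi (c := dx phi mnm0) :
  (0 < k)%N -> e != 0 -> e' != 0 ->
  (forall j, y j mnm0 = 0) -> (forall j, y' j mnm0 = 0) ->
  conjugacy (nfB e y mu) (nfB e' y' mu') phi ->
  [/\ e' = e * c ^+ k, mu' = mu,
      forall j : 'I_k, y' j = fpsC m (c ^+ (k.+1 - j)) * y j
    & exists t psi, is_flow (nfB e y mu) t psi /\ phi = fpsC m.+1 c * psi].
Proof.
move=> k0 e0 e'0 y0 y'0 cphi.
have nk mu1 : k = 0%N -> mu1 mnm0 = 0 :> K by move=> ek; rewrite ek in k0.
have c0 : c != 0 by case: cphi => [[]].
have ee := conj_leading e0 e'0 (leading_nfB e0 y0 (nk mu)) (leading_nfB e'0 y'0 (nk mu')) cphi.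
rewrite -/c in ee.
pose y2 (j : 'I_k) := fpsC m (c ^- (k.+1 - j)) * y' j.
have cX i : c ^+ i != 0 by rewrite expf_neq0.
have y'E : y' = (fun j : 'I_k => fpsC m (c ^+ (k.+1 - j)) * y2 j).
  apply/funext => j; rewrite /y2 mulrA -(rmorphM (fpsC m)) divff //.
  by rewrite rmorph1 mul1r.
have [chi phiE dchi] : exists2 chi, phi = fpsC m.+1 c * chi & dx chi mnm0 = 1.
  exists (fpsC m.+1 c^-1 * phi).
    by rewrite mulrA -(rmorphM (fpsC m.+1)) divff // rmorph1 mul1r.
  by rewrite dxM dxC mul0r add0r fcoefCM mulVf.
have cchi : conjugacy (nfB e y mu) (nfB e y2 mu') chi.
  have [sc _] := @conj_scale K m k e c y2 mu' (nfB e y mu) chi c0 (den_ok_mu e0 (nk mu')).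
  by apply: sc; rewrite -phiE -ee -y'E; exact: cphi.
have y20 j : y2 j mnm0 = 0 by rewrite fcoefCM y'0 mulr0.
have [ey emu [t ft]] := nf_conj_tangent k0 e0 y0 y20 cchi dchi.
split=> //; first by move=> j; rewrite y'E ey.
by exists t, chi.
Qed.

End NormalFormConjugacies.

Section Universal.
Variables (K : numFieldType) (k : nat).
Hypothesis k0 : (0 < k)%N.

Let nk n (mu1 : fps K n) : k = 0%N -> mu1 mnm0 = 0.
Proof. by move=> ek; have := k0; rewrite ek. Qed.

Lemma at_lam0_X3 (e mu : K) : e != 0 ->
  at_lam0 (X3 k e mu) =
    xvar K 0 ^+ k.+1 / (fpsC 1 e + fpsC 1 mu * xvar K 0 ^+ k).
Proof.
move=> e0; have y0 (j : 'I_k) : fpsX K (widen_ord (leqnSn k) j) mnm0 = 0.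
  by rewrite FpsE eq_sym mnm1_eq0.
rewrite /X3 (at_lam0_nfB e0 y0 (den_ok_mu e0 (nk _))).
by rewrite fcoefD fcoefC eqxx mulr1n FpsE eq_sym mnm1_eq0 addr0.
Qed.

Lemma induced_X3 (e mu : K) n (psi : 'I_k.+1 -> fps K n) :
  e != 0 -> (forall j, psi j mnm0 = 0) ->
  induced (X3 k e mu) psi =
    nfB e (fun j : 'I_k => psi (widen_ord (leqnSn k) j)) (fpsC n mu + psi ord_max).
Proof.
move=> e0 psi0; have x0 := xvar0 K n.
have p0 j : of_lam (psi j) mnm0 = 0 by rewrite of_lam0.
have ok : den_ok k e (fpsC k.+1 mu + fpsX K (@ord_max k)) by apply: den_ok_mu => //; apply: nk.
have ok' : den_ok k e (fpsC n mu + psi ord_max) by apply: den_ok_mu => //; apply: nk.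
have sl (c : fps K k.+1) : subst (of_lam c) (xvar K n) (fun j => of_lam (psi j)) =
    fps_comp c (fun j => of_lam (psi j)) by exact: subst_of_lam.
have SM := substM x0 p0; have SX := substXn x0 p0.
have SD := substD (xvar K n) (fun j => of_lam (psi j)).
have SV := substV x0 p0; have SS := subst_sum x0 p0; have SC := substC x0 p0.
have Sx := subst_xvar x0 p0.
have d1 : nf_den k e (fpsC k.+1 mu + fpsX K (@ord_max k)) (xvar K k.+1) mnm0 != 0.
  by rewrite -den_okP ?xvar0.
rewrite /induced /X3 !nfBE SM (SV _ d1).
congr (_ / _).
  rewrite /nf_num SD SX Sx SS; congr (_ + _).
  apply: eq_bigr => j _; rewrite SM SX Sx sl.
  by rewrite fcompX.
rewrite /nf_den SD SC SM SX Sx sl.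
by rewrite fcompD fcompC // fcompX // [in RHS]rmorphD /= of_lamC.
Qed.

Lemma versal_X3 (e mu : K) : e != 0 -> versal (X3 k e mu).
Proof.
move=> e0 m a ea; rewrite at_lam0_X3 // in ea.
have la : leading k e a.
  have om : (fpsC 1 e + fpsC 1 mu * xvar K 0 ^+ k) mnm0 = e.
    by rewrite fcoefD fcoefCM fcoefC eqxx mulr1n xvarX0 (gtn_eqF k0) mulr0 addr0.
  rewrite -om; apply: unfolds_leading; split; last exact: ea.
  by rewrite om.
have [phi [y [mu' [tphi etau]]]] :=
  tangent_nf_exists (tau := 0 : fps K m) e0 la (fun _ => erefl).
(* The constant deformation [a'] agrees with [a] at [lambda = 0], and the identity is a tangent
   conjugacy for it with the same coefficient of [x^(k+1)] as [phi]. Uniqueness on the exponent 0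
   gives [phi(x;0) = x] and [mu'(0) = mu]. *)
pose a' := nfB e (fun _ : 'I_k => 0 : fps K m) (fpsC m mu).
have ok : den_ok k e (fpsC m mu) by apply: den_ok_mu => //; apply: nk.
have la' : leading k e a' by apply: leading_nfB => //; apply: nk.
have tx : tangent_nf e a' (xvar K m) (fun _ : 'I_k => 0 : fps K m) (fpsC m mu).
  split; [by rewrite subrr; exact: wge0|by []|exact: nk|].
  split; first by split; rewrite ?xvar0 // dx_xvar fcoef1 eqxx oner_neq0.
  by rewrite subst_id dx_xvar mulr1.
pose P (b : multinom m) := b == mnm0.
have dP : dclosed P by move=> b c; rewrite /P mnmD_eq0 => /andP[].
have ea' : at_lam0 a' =
    xvar K 0 ^+ k.+1 / (fpsC 1 e + fpsC 1 mu * xvar K 0 ^+ k).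
  have y00 (j : 'I_k) : (0 : fps K m) mnm0 = 0 by [].
  by rewrite /a' (at_lam0_nfB e0 y00 ok) fcoefC eqxx mulr1n.
have aa' : agree P a a'.
  move=> b /eqP tb; rewrite -(mcons_eta b) tb.
  have e1 (f : fps K m.+1) i : f (mcons i mnm0) = at_lam0 f (mcons i mnm0).
    by rewrite [RHS]FpsE mcons0.
  by rewrite e1 [RHS]e1 ea ea'.
have tau0 b : P b -> xcoef k.+1 phi b = xcoef k.+1 (xvar K m) b.
  move=> _; apply/subr0_eq; rewrite -fcoefN -fcoefD -xcoefN -xcoefD etau.
  by [].
have [h1 _ h3] := tangent_nf_unique dP e0 la la' aa' tau0 tphi tx.
have [_ y0 _ cphi] := tphi.
exists (fun i => if unlift ord_max i is Some j then y j else mu' - fpsC m mu).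
have psi0 i : (if unlift ord_max i is Some j then y j else mu' - fpsC m mu) mnm0 = 0.
  case: unliftP => [j _|_]; first exact: y0.
  by rewrite fcoefD fcoefN h3 ?subrr // /P.
split=> //; exists phi; split; last first.
  apply: fpsP => b; rewrite -(mcons_eta b).
  have -> : mtail b = mnm0 by apply/mnmP => -[].
  rewrite FpsE mcons0 h1; last by rewrite mconsK /P.
  by rewrite -(at_lam0_xvar K m) [RHS]FpsE mcons0.
rewrite (induced_X3 _ e0 psi0) unlift_none.
have -> : (fun j : 'I_k => if unlift ord_max (widen_ord (leqnSn k) j) is Some j0
    then y j0 else mu' - fpsC m mu) = y.
  apply/funext => j; have -> : widen_ord (leqnSn k) j = lift ord_max j.
    by apply/val_inj; rewrite /= /bump leqNgt ltn_ord.
  by rewrite liftK.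
by rewrite addrC subrK.
Qed.

(** The condition [phi(x;0) = x] makes both conjugacies tangent to the identity, which excludes the
    rotations between the two induced normal forms. *)
Lemma universal_X3 (e mu : K) : e != 0 -> universal (X3 k e mu).
Proof.
move=> e0; split; first exact: versal_X3.
move=> m a ea psi psi' [psi0 [phi [cphi phi0]]] [psi'0 [phi' [cphi' phi'0]]].
rewrite (induced_X3 _ e0 psi0) in cphi; rewrite (induced_X3 _ e0 psi'0) in cphi'.
have d1 (f : fps K m.+1) : at_lam0 f = xvar K 0 -> dx f mnm0 = 1.
  move=> ef; rewrite dxE mnm0E mulr1n add0m mnm1_e0.
  have -> : f (mcons 1 mnm0) = at_lam0 f (mcons 1 mnm0) by rewrite [RHS]FpsE mcons0.
  by rewrite ef xvarE FpsE mnm1_e0 eqxx.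
have [chi [cchi _ dchi]] := formally_conjugate_cancel cphi cphi'.
rewrite (d1 _ phi0) (d1 _ phi'0) divr1 in dchi.
have [||ey emu _] := nf_conj_tangent k0 e0 _ _ cchi dchi; try by move=> j; rewrite ?psi0 ?psi'0.
apply/funext => i; case: (unliftP ord_max i) => [j|] ->; last by have /addrI := emu.
have -> : lift ord_max j = widen_ord (leqnSn k) j.
  by apply/val_inj; rewrite /= /bump leqNgt ltn_ord.
by have := congr1 (fun f => f j) ey.
Qed.

End Universal.

(** * Residues *)

Section XcoefProduct.
Variables (K : fieldType) (m : nat).
Implicit Types (f g : fps K m.+1).
Local Notation x := (xvar K m).

Lemma xcoef_xvarM i j f : xcoef j (x ^+ i * f) = if (i <= j)%N then xcoef (j - i) f else 0.
Proof.
apply: fpsP => b; rewrite xcoefE fcoef_xvarM mcons0 mconsK.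
by case: ifP.
Qed.

Lemma xdivE i f : (forall j, (j < i)%N -> xcoef j f = 0) ->
  f = x ^+ i * shop (fun=> 1) i f.
Proof.
move=> h; apply: fpsP => a; rewrite fcoef_xvarM -{1}(mcons_eta a).
case: leqP => [le|lt]; first by rewrite shopE' mul1r subnK.
by rewrite -xcoefE h.
Qed.

Lemma xcoefM N f g : xcoef N (f * g) = \sum_(j < N.+1) xcoef j f * xcoef (N - j) g.
Proof.
pose f1 := \sum_(j < N.+1) of_lam (xcoef j f) * x ^+ j.
have ef : f = f1 + x ^+ N.+1 * shop (fun=> 1) N.+1 (f - f1).
  rewrite -xdivE ?[f1 + _]addrC ?subrK // => j ltj.
  rewrite xcoefD xcoefN xcoef_sum (bigD1 (Ordinal ltj)) //= xcoef_of_lamX eqxx.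
  rewrite big1 ?addr0 ?subrr // => i ni; rewrite xcoef_of_lamX.
  by case: eqP => // ej; case/eqP: ni; apply: val_inj.
rewrite {1}ef mulrDl xcoefD -mulrA xcoef_xvarM ltnn addr0 /f1 mulr_suml xcoef_sum.
apply: eq_bigr => j _; rewrite -mulrA xcoef_of_lamM xcoef_xvarM.
by rewrite leq_ord.
Qed.

End XcoefProduct.

Section ResidueAtInfinity.
Variables (K : numFieldType) (m k : nat) (e : K) (y : 'I_k -> fps K m) (mu : fps K m).
Local Notation x := (xvar K m).
Local Notation P := (nfB_num y).
Local Notation Q := (nfB_den k e mu).
Hypothesis k0 : (0 < k)%N.

Lemma nfB_numE i : P`_i = (i == k.+1)%:R + \sum_(j < k) y j * (i == j :> nat)%:R.
Proof.
rewrite /nfB_num coefD coefXn coef_sum; congr (_ + _).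
by apply: eq_bigr => j _; rewrite coefZ coefXn.
Qed.

Lemma nfB_num_top : P`_k.+1 = 1.
Proof.
rewrite nfB_numE eqxx big1 ?addr0 // => j _.
by rewrite gtn_eqF ?mulr0 // (leq_trans (ltn_ord j)).
Qed.

Lemma nfB_num_out i : (k.+1 < i)%N -> P`_i = 0.
Proof.
move=> lt; rewrite nfB_numE gtn_eqF // add0r big1 // => j _.
by rewrite gtn_eqF ?mulr0 // (leq_trans (ltn_ord j)) //; lia.
Qed.

Lemma nfB_den_out i : (k < i)%N -> Q`_i = 0.
Proof.
move=> lt; rewrite /nfB_den coefD coefC coefZ coefXn !gtn_eqF ?mulr0 ?addr0 //.
exact: leq_ltn_trans lt.
Qed.

Lemma nfB_den_top : Q`_k = mu.
Proof. by rewrite /nfB_den coefD coefC coefZ coefXn eqxx mulr1 gtn_eqF // add0r. Qed.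

Lemma residue_infty_nfB : residue_infty Q P (- mu).
Proof.
(* Here [x] plays the role of [w = 1/x]. With the reversed polynomials, [Q/P = w Qrev/Prev], so the
   coefficient of [x^-(j+1)] is the [j]-th one of [V], stored at [Negz j]. *)
pose Prev := \sum_(i < k.+2) of_lam P`_i * x ^+ (k.+1 - i).
pose Qrev := \sum_(i < k.+1) of_lam Q`_i * x ^+ (k - i).
have uP : Prev \is a GRing.unit.
  rewrite fps_unitE /Prev fcoef_sum big_ord_recr /= subnn expr0 mulr1 nfB_num_top.
  rewrite rmorph1 fcoef1 eqxx big1 ?add0r ?oner_neq0 // => i _.
  by rewrite fcoefM0 xvarX0 subn_eq0 leqNgt ltnS leq_ord mulr0.
pose V := Qrev / Prev; have PV : Prev * V = Qrev by rewrite mulrC divrK.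
pose v (i : int) : fps K m := if i is Negz j then xcoef j V else 0.
have vp j : v (Posz j) = 0 by [].
have vE l i : (i <= k.+1)%N -> v (k%:Z - l%:Z - i%:Z) =
    if (k.+1 - i <= l)%N then xcoef (l - (k.+1 - i)) V else 0.
  move=> lei; case: leqP => le.
    have -> : k%:Z - l%:Z - i%:Z = Negz (l - (k.+1 - i)) by lia.
    by [].
  by have -> : k%:Z - l%:Z - i%:Z = Posz (k - l - i) by lia.
have sum_size (F : nat -> fps K m) :
    \sum_(i < size P) P`_i * F i = \sum_(i < k.+2) P`_i * F i.
  have sP : (size P <= k.+2)%N by apply/leq_sizeP => i /nfB_num_out.
  rewrite (big_ord_widen k.+2 (fun i => P`_i * F i)) // big_mkcond.
  by apply: eq_bigr => i _; case: ltnP => // le; rewrite nth_default ?mul0r.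
have main l : \sum_(i < k.+2) P`_i * v (k%:Z - l%:Z - i%:Z) =
    if (l <= k)%N then Q`_(k - l) else 0.
  have := congr1 (xcoef l) PV; rewrite /Prev mulr_suml xcoef_sum.
  under eq_bigr => i _ do rewrite -mulrA xcoef_of_lamM xcoef_xvarM.
  under [in X in _ -> X]eq_bigr => i _ do rewrite vE ?leq_ord //.
  move=> ->; rewrite /Qrev xcoef_sum.
  under eq_bigr => i _ do rewrite xcoef_of_lamX.
  case: leqP => le.
    have lt : (k - l < k.+1)%N by rewrite ltnS leq_subr.
    rewrite (bigD1 (Ordinal lt)) //= subKn // eqxx big1 ?addr0 // => i ni.
    case: eqP => // el; case/eqP: ni; apply: val_inj => /=.
    by have := leq_ord i; lia.
  by rewrite big1 // => i _; case: eqP => // el; move: le; rewrite el ltnNge leq_subr.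
exists v; split.
- by exists 0%N => -[].
- move=> n; rewrite (sum_size (fun i => v (n - i%:Z))).
  have [le|lt] := lerP n k%:Z.
    have -> : n = k%:Z - `|k%:Z - n|%N%:Z by lia.
    set l := `|_|%N; rewrite main; case: leqP => lel.
      by have -> : k%:Z - l%:Z = Posz (k - l) by lia.
    by have -> : k%:Z - l%:Z = Negz (l - k).-1 by lia.
  case: n lt => // n lt; rewrite nfB_den_out; last by lia.
  rewrite big1 // => i _; have lei := leq_ord i; rewrite ltz_nat in lt.
  by rewrite subzn ?(leq_trans lei) // vp mulr0.
have := main 0%N; rewrite leq0n subn0 nfB_den_top => <-.
rewrite big_ord_recr /= nfB_num_top mul1r big1 ?add0r => [|i _].
  by have -> : k%:Z - 0%:Z - k.+1%:Z = - 1 by lia.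
have lei := leq_ord i; rewrite vE; last exact: leqW.
by rewrite leqn0 subn_eq0 leqNgt ltnS lei mulr0.
Qed.

End ResidueAtInfinity.

(** * The residue sum in rescaled coordinates *)

Section ResidueSum.
Variables (K : numFieldType) (m k : nat).
Implicit Types (f g c : fps K m.+1) (a b d : multinom m.+1).
Local Notation x := (xvar K m).
Local Notation W := (k.+1).

(* In the coordinates (x, lambda / x^W), a Laurent series in K((x))[[lambda]] with
   poles of order at most W |b| + O(1) at lambda^b is a power series up to a
   power of x; rk is then the exponent of x in the original coordinates. *)
Definition rsc f : fps K m.+1 := subst f x (fun j => lamvar K j * x ^+ W).

Definition rk a : int := (a ord0)%:Z - (W * mdeg (mtail a))%:Z.

Let psi0 (j : 'I_m) : (lamvar K j * x ^+ W) mnm0 = 0.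
Proof. by rewrite fcoefM0 lamvar0 mul0r. Qed.
Let x0 := xvar0 K m.

Lemma rscE f i (b : multinom m) : rsc f (mcons i b) =
  if (W * mdeg b <= i)%N then f (mcons (i - W * mdeg b) b) else 0.
Proof.
pose h (i : 'I_m.+1) := if unlift ord0 i is Some j then lamvar K j * x ^+ W else x.
have h0 l : h l mnm0 = 0 by rewrite /h; case: unliftP.
have mon d : mmap1 h d = fmon K (mcons (d ord0 + W * mdeg (mtail d)) (mtail d)).
  rewrite /mmap1 big_ord_recl {1}/h unlift_none.
  under eq_bigr => j _ do rewrite /h liftK exprMn -exprM
    -[lamvar K j]/(fmon K (mnm1 (lift ord0 j))) fmonX.
  rewrite big_split /= prodrXr -big_distrr /=.
  rewrite -(big_morph (@fmon K m.+1) (id1 := 1) (op1 := *%R) (fun u v => esym (fmonM K u v)) erefl).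
  rewrite mulrCA -exprD xvarXE mnm_muln_e0 fmonM; congr fmon.
  apply/mnmP => l; rewrite mnmDE mnm_sumE; case: (unliftP ord0 l) => [j|] ->.
    rewrite !mconsS mnm0E addn0 mtailE (bigD1 j) //= mulmnE mnm1E eqxx mul1n.
    rewrite big1 ?addn0 // => l' nl.
    by rewrite mulmnE mnm1E (inj_eq (@lift_inj _ _)) (negbTE nl).
  rewrite !mcons0 big1 ?add0n => [|l' _]; last first.
    by rewrite mulmnE mnm1E eq_sym (negbTE (neq_lift _ _)).
  congr (_ + _ * _)%N; rewrite mdegE; apply: eq_bigr => j _; by rewrite mtailE.
rewrite /rsc /subst (@fcompE _ _ _ _ h0 (mdeg (mcons i b)).+1) //.
under eq_bigr => d _ do rewrite mon FpsE.
case: leqP => le.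
  have lt : (mdeg (mcons (i - W * mdeg b) b) < (mdeg (mcons i b)).+1)%N.
    by rewrite !mdeg_mcons; lia.
  rewrite (bigD1 (BMultinom lt)) //= mcons0 mconsK subnK // eqxx mulr1.
  rewrite big1 ?addr0 // => d nd; case: eqP => [/mcons_inj[e1 e2]|]; rewrite ?mulr0 //.
  case/eqP: nd; apply/val_inj; rewrite /= -[LHS]mcons_eta -e2; congr mcons.
  by rewrite -e2 in e1; move: e1; lia.
rewrite big1 // => d _; case: eqP => [/mcons_inj[e1 e2]|]; rewrite ?mulr0 //.
by rewrite -e2 in e1; move: e1 le; lia.
Qed.

Lemma rscM f g : rsc (f * g) = rsc f * rsc g. Proof. exact: substM. Qed.
Lemma rscD f g : rsc (f + g) = rsc f + rsc g. Proof. exact: substD. Qed.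
Lemma rscX f i : rsc (f ^+ i) = rsc f ^+ i. Proof. exact: substXn. Qed.
Lemma rscC (e : K) : rsc (fpsC m.+1 e) = fpsC m.+1 e. Proof. exact: substC. Qed.
Lemma rsc_x : rsc x = x. Proof. exact: subst_xvar. Qed.
Lemma rsc_sum I (r : seq I) (P : pred I) (F : I -> fps K m.+1) :
  rsc (\sum_(i <- r | P i) F i) = \sum_(i <- r | P i) rsc (F i).
Proof. exact: subst_sum. Qed.

Lemma rkD a b : rk (a +m b) = rk a + rk b.
Proof. by rewrite /rk mnmDE mtailD mdegD mulnDr; lia. Qed.

Definition rkop f := ddiag (fun a => (rk a)%:~R) f.

Let rkRD a b : (rk (a +m b))%:~R = (rk a)%:~R + (rk b)%:~R :> K.
Proof. by rewrite rkD rmorphD. Qed.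

Lemma rkopM f g : rkop (f * g) = rkop f * g + f * rkop g.
Proof. exact: ddiagM. Qed.

Lemma rkop_x : rkop x = x.
Proof.
apply: fpsP => a; rewrite ddiagE xvarE FpsE; case: eqP => [->|_]; last by rewrite mulr0.
by rewrite /rk mnm1_e0 mcons0 mconsK mdeg0 muln0 subr0 mul1r.
Qed.

(** [rk] is the exponent of [x] before rescaling, so [rkop] is [x d/dx] transported to the new
    coordinates. *)
Lemma rkop_rsc f : rkop (rsc f) = rsc (x * dx f).
Proof.
apply: fpsP => a; rewrite -(mcons_eta a) ddiagE !rscE xdxE.
case: leqP => le; last by rewrite mulr0.
rewrite ddiagE mcons0 /rk mcons0 mconsK; congr (_ * _).
by rewrite subzn.
Qed.

Section UnitSeries.
Variable Phi : fps K m.+1.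
Hypothesis Phi0 : Phi mnm0 != 0.

Let uPhi : Phi \is a GRing.unit. Proof. by rewrite fps_unitE. Qed.

(** The logarithmic derivative [x phi' / phi] of [phi = x Phi]. *)
Definition rkG := 1 + Phi^-1 * rkop Phi.

Lemma ddiagV (l : multinom m.+1 -> K) : (forall a b, l (a +m b) = l a + l b) ->
  ddiag l Phi^-1 = - Phi^-1 ^+ 2 * ddiag l Phi.
Proof.
move=> lD; have := ddiagC lD 1; rewrite -[fpsC _ 1]/(1 : fps K m.+1).
rewrite -{1}(mulVr uPhi) (ddiagM lD) => /addr0_eq h.
apply: (mulIr uPhi); rewrite -[LHS]opprK h.
have -> : - Phi^-1 ^+ 2 * ddiag l Phi * Phi = - (Phi^-1 * ddiag l Phi * (Phi^-1 * Phi)).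
  by ring.
by rewrite mulVr // mulr1.
Qed.

Lemma ddiagVX (l : multinom m.+1 -> K) i : (forall a b, l (a +m b) = l a + l b) ->
  ddiag l (Phi^-1 ^+ i) = - i%:R * Phi^-1 ^+ i.+1 * ddiag l Phi.
Proof.
move=> lD; elim: i => [|i IHi].
  by rewrite mulr0n oppr0 !mul0r; exact: (ddiagC lD 1).
rewrite exprS (ddiagM lD) IHi (ddiagV lD) !exprS -[i.+1]addn1 natrD.
by move: (Phi^-1) (Phi^-1 ^+ i) (ddiag l Phi) => P Pi D; ring.
Qed.

(** For [l > 0] the form [phi^-l dphi/phi] is exact, hence has no residue. The factor [x^l] between
    [phi^-l] and [Phi^-l] moves the residue to [rk = l]. *)
Lemma rkG_pos l a : (0 < l)%N -> rk a = l -> (Phi^-1 ^+ l * rkG) a = 0.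
Proof.
move=> l0 ra; have h : fpsC m.+1 l%:R * (Phi^-1 ^+ l * rkG) =
    fpsC m.+1 l%:R * Phi^-1 ^+ l - rkop (Phi^-1 ^+ l).
  rewrite /rkop (ddiagVX _ rkRD) /rkG rmorph_nat exprS -/(rkop Phi).
  by move: (Phi^-1) (Phi^-1 ^+ l) (rkop Phi) => P Pi D; ring.
have := congr1 (fun f : fps K m.+1 => f a) h.
rewrite fcoefCM fcoefD fcoefN fcoefCM ddiagE ra subrr => /eqP.
by rewrite mulf_eq0 pnatr_eq0 (gtn_eqF l0) => /eqP.
Qed.

(* The logarithmic derivatives of Phi along two commuting derivations form a
   closed form, hence the one along rkop vanishes where rk does. *)
Lemma rkG_zero a : rk a = 0 -> rkG a = (a == mnm0)%:R.
Proof.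
move=> ra; rewrite /rkG fcoefD fcoef1.
suff -> : (Phi^-1 * rkop Phi) a = 0 by rewrite addr0.
have [->|na] := eqVneq a mnm0.
  by rewrite fcoefM0 ddiagE /rk mnm0E mtail0 mdeg0 muln0 subrr mul0r mulr0.
pose dg (d : multinom m.+1) : K := (mdeg d)%:R.
have dgD b d : dg (b +m d) = dg b + dg d by rewrite /dg mdegD natrD.
have h : ddiag dg (Phi^-1 * rkop Phi) = rkop (Phi^-1 * ddiag dg Phi).
  have comm : ddiag dg (rkop Phi) = rkop (ddiag dg Phi).
    by apply: fpsP => b; rewrite !ddiagE mulrCA.
  have rV : rkop Phi^-1 = - Phi^-1 ^+ 2 * rkop Phi := ddiagV rkRD.
  rewrite rkopM (ddiagM dgD) (ddiagV dgD) comm rV.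
  by ring.
have := congr1 (fun f : fps K m.+1 => f a) h.
rewrite !ddiagE ra mul0r => /eqP; rewrite mulf_eq0 pnatr_eq0 mdeg_eq0 (negbTE na).
by move=> /eqP.
Qed.

Definition homog (s : int) c := forall a, rk a != s -> c a = 0.

Lemma homogM s r c f : homog s c -> homog r f -> homog (s + r) (c * f).
Proof.
move=> hc hf a na; apply: fcoefM_eq0 => b d eab.
case: (eqVneq (rk b) s) => [eb|nb]; last by left; apply: hc.
right; apply: hf; apply: contraNneq na => ed.
by rewrite eab rkD eb ed.
Qed.

(** The quantification over [l] and [c] is what the induction on powers of [geoq] needs: a factor
    [Y j * Phi^-1 ^+ s j] is absorbed into [c] and [l]. *)
Definition res0 f := forall (p : int) l c, homog (p - l%:Z) c ->
  forall a, rk a = p -> (c * (Phi^-1 ^+ l * rkG) * f) a = 0.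

Lemma res0_pos p l c a : (0 < l)%N -> homog (p - l%:Z) c -> rk a = p ->
  (c * (Phi^-1 ^+ l * rkG)) a = 0.
Proof.
move=> l0 hc ra; apply: fcoefM_eq0 => b d eab.
case: (eqVneq (rk b) (p - l%:Z)) => [eb|nb]; last by left; apply: hc.
right; apply: rkG_pos => //; move: ra; rewrite eab rkD eb.
by lia.
Qed.

Variables (n : nat) (Y : 'I_n -> fps K m.+1) (s : 'I_n -> nat).
Hypotheses (s0 : forall j, (0 < s j)%N) (hY : forall j, homog (- (s j)%:Z) (Y j)).

(** The ratio of a geometric series: the rescaled numerator of the normal form at [phi] is
    [(x Phi)^(k+1) (1 - geoq)]. *)
Definition geoq := - \sum_(j < n) Y j * Phi^-1 ^+ s j.

Lemma res0_geoq i : res0 (geoq ^+ i.+1).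
Proof.
elim: i => [|i IHi] p l c hc a ra.
  rewrite expr1 /geoq mulrN fcoefN mulr_sumr fcoef_sum big1 ?oppr0 // => j _.
  have -> : c * (Phi^-1 ^+ l * rkG) * (Y j * Phi^-1 ^+ s j) =
      c * Y j * (Phi^-1 ^+ (l + s j) * rkG) by rewrite exprD; ring.
  apply: (res0_pos (p := p)) => //; first by rewrite addn_gt0 s0 orbT.
  rewrite (_ : p - _ = (p - l%:Z) + - (s j)%:Z); last by lia.
  exact: homogM.
rewrite exprS {1}/geoq mulNr mulrN fcoefN mulr_suml mulr_sumr fcoef_sum big1 ?oppr0 // => j _.
have -> : c * (Phi^-1 ^+ l * rkG) * (Y j * Phi^-1 ^+ s j * geoq ^+ i.+1) =
    c * Y j * (Phi^-1 ^+ (l + s j) * rkG) * geoq ^+ i.+1 by rewrite exprD; ring.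
apply: (IHi p) => //.
rewrite (_ : p - _ = (p - l%:Z) + - (s j)%:Z); last by lia.
exact: homogM.
Qed.

End UnitSeries.

End ResidueSum.

Section LambdaDegree.
Variables (K : fieldType) (m : nat).

Definition lw (i : 'I_m.+1) := if unlift ord0 i is Some _ then 1%N else 0%N.

Lemma wt_lw i b : wt lw (mcons i b) = mdeg b.
Proof.
rewrite wt_mcons /lw unlift_none mul0n add0n mdegE.
by apply: eq_bigr => j _; rewrite liftK mul1n.
Qed.

End LambdaDegree.

Lemma cancel_unit_powers (R : comUnitRingType) k (A P x e M G q : R) :
  A \is a GRing.unit -> P \is a GRing.unit ->
  P ^+ k.+1 * (1 - q) = A * (P * G) * (e + M * (x * P) ^+ k) ->
  A^-1 * (1 - q) = G * (e * P^-1 ^+ k + M * x ^+ k).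
Proof.
move=> uA uP h; have PV : P^-1 ^+ k * P ^+ k = 1 by rewrite -exprMn mulVr // expr1n.
have uPk : P ^+ k.+1 \is a GRing.unit by rewrite unitrX.
apply: (mulIr uPk); rewrite -mulrA [_ * P ^+ _]mulrC h -!mulrA mulKr //.
have -> : e * P^-1 ^+ k + M * x ^+ k = (e + M * (x * P) ^+ k) * P^-1 ^+ k.
  by rewrite exprMn mulrDl -!mulrA [P ^+ k * _]mulrC PV mulr1.
by rewrite exprS -[LHS]mulr1 -PV; ring.
Qed.

Section ResidueCoefficient.
Variables (K : numFieldType) (m k : nat) (e : K) (mu : fps K m).
Variables (Ai Phi M : fps K m.+1) (Y : 'I_k -> fps K m.+1).
Local Notation x := (xvar K m).
Local Notation W := (k.+1).
Local Notation G := (rkG k Phi).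
Local Notation q := (geoq Phi Y (fun j : 'I_k => (W - j)%N)).
Hypotheses (k0 : (0 < k)%N) (Phi0 : Phi mnm0 != 0)
  (homog_Y : forall j : 'I_k, homog k (- (W - j)%N%:Z) (Y j))
  (wge_Y : forall j : 'I_k, wge (@lw m) 1 (Y j)) (homog_M : homog k 0 M)
  (eqA : Ai * (1 - q) = G * (fpsC m.+1 e * Phi^-1 ^+ k + M * x ^+ k)).

(** [Ai = G H / (1 - q)] is expanded as a geometric series, finite at each degree in lambda.
    Positive powers of [q] leave no residue, nor does [e Phi^-k G], which comes from an exact form
    as [k > 0]. Of [M x^k G] there remains [M x^k], because [G - 1] vanishes where [rk] does. *)
Lemma residue_coef b : Ai (mcons (k + W * mdeg b) b) = M (mcons (W * mdeg b) b).
Proof.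
set d := mcons _ b; pose n := (mdeg b).+1; pose H := fpsC m.+1 e * Phi^-1 ^+ k + M * x ^+ k.
have eqH : Ai * (1 - q) = G * H by [].
have rkd : rk k d = k%:Z by rewrite /rk mcons0 mconsK; lia.
have -> : Ai = (\sum_(i < n) q ^+ i) * (G * H) + q ^+ n * Ai.
  rewrite -eqH; have := subrXX 1 q n; rewrite expr1n => e1.
  have -> : (\sum_(i < n) q ^+ i) = \sum_(i < n) 1 ^+ (n.-1 - i) * q ^+ i.
    by apply: eq_bigr => i _; rewrite expr1n mul1r.
  have e2 : Ai = Ai * (1 - q ^+ n) + q ^+ n * Ai by ring.
  by rewrite {1}e2 e1; ring.
have hq : wge (@lw m) 1 q.
  by apply: wgeN; apply: wge_sum => j _; rewrite -[1%N]addn0; apply: wgeM;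
       [exact: wge_Y|exact: wge_0].
rewrite fcoefD [X in _ + X](_ : _ = 0) ?addr0; last first.
  have := wgeM (wgeX (i := n) hq) (wge_0 Ai); rewrite muln1 addn0; apply.
  by rewrite wt_lw.
have s0 (j : 'I_k) : (0 < W - j)%N by have := ltn_ord j; lia.
have hC : homog k 0 (fpsC m.+1 e).
  move=> d' nd; rewrite fcoefC; case: eqP => [ed|_]; last by rewrite mulr0n.
  by move: nd; rewrite ed /rk mnm0E mtail0 mdeg0 muln0 subrr eqxx.
have hX : homog k k%:Z (x ^+ k).
  move=> d' nd; rewrite xvarXE mnm_muln_e0 FpsE; case: eqP => // ed.
  by move: nd; rewrite ed /rk mcons0 mconsK mdeg0 muln0 subr0 eqxx.
have hMX : homog k (k%:Z - 0%:Z) (M * x ^+ k).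
  by rewrite subr0 -[k%:Z]add0r; apply: homogM homog_M hX.
have hCk : homog k (k%:Z - k%:Z) (fpsC m.+1 e) by rewrite subrr.
have Z f : res0 k Phi f -> (f * (G * H)) d = 0.
  move=> zf; have -> : f * (G * H) = fpsC m.+1 e * (Phi^-1 ^+ k * G) * f
      + M * x ^+ k * (Phi^-1 ^+ 0 * G) * f by rewrite /H; ring.
  by rewrite fcoefD (zf _ _ _ hCk _ rkd) (zf _ _ _ hMX _ rkd) addr0.
rewrite mulr_suml big_ord_recl fcoefD fcoef_sum big1 ?addr0 => [|i _]; last first.
  by apply: Z; apply: res0_geoq; [exact: Phi0|exact: s0|exact: homog_Y].
rewrite expr0 mul1r.
have -> : G * H = fpsC m.+1 e * (Phi^-1 ^+ k * G) + M * x ^+ k + M * x ^+ k * (G - 1).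
  by rewrite /H; ring.
rewrite !fcoefD (res0_pos Phi0 k0 hCk rkd) add0r.
rewrite [X in _ + X](_ : _ = 0) ?addr0; last first.
  apply: fcoefM_eq0 => b1 b2 ed.
  case: (eqVneq (rk k b1) (k%:Z - 0%:Z)) => [e1|n1]; last by left; apply: hMX.
  right; rewrite fcoefD fcoefN fcoef1 rkG_zero ?Phi0 ?subrr //.
  by move: rkd; rewrite ed rkD e1; lia.
by rewrite mulrC fcoef_xvarM mcons0 mconsK leq_addr addKn.
Qed.

End ResidueCoefficient.

Section ResidueTheorem.
Variables (K : numFieldType) (m k : nat) (e ea : K) (y : 'I_k -> fps K m)
  (mu : fps K m) (a phi : fps K m.+1).
Local Notation x := (xvar K m).
Local Notation W := (k.+1).
Local Notation T := (@rsc K m k).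
Hypotheses (k0 : (0 < k)%N) (e0 : e != 0) (y0 : forall j, y j mnm0 = 0)
  (ea0 : ea != 0) (la : @lead K m k k.+1 ea a) (cphi : conjugacy a (nfB e y mu) phi).

Let A := shop (fun=> 1) W (T a).
Let Phi := shop (fun=> 1) 1 (T phi).
Let Y (j : 'I_k) := shop (fun=> 1) (W - j) (T (of_lam (y j))).
Let M := T (of_lam mu).

Lemma rsc_of_lam (c : fps K m) i b :
  T (of_lam c) (mcons i b) = if i == (W * mdeg b)%N then c b else 0.
Proof.
rewrite rscE of_lamE mcons0 mconsK; case: (ltngtP i) => [lt|gt|->].
- by [].
- by rewrite subn_eq0 leqNgt gt.
by rewrite subnn eqxx.
Qed.

Lemma TaE : T a = x ^+ W * A.
Proof.
apply: xdivE => j ltj; apply: fpsP => b; rewrite xcoefE rscE.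
case: ifP => // le; have b0 : mdeg b = 0%N by case: (mdeg b) le => // d; rewrite mulnS; lia.
rewrite b0 muln0 subn0 (lead_wge la) // wt_xw b0 muln0 addn0.
exact: ltj.
Qed.

Lemma A0 : A mnm0 = ea.
Proof.
rewrite -mcons00 shopE' mul1r add0n rscE mdeg0 muln0 subn0.
have := @la (mcons k.+1 mnm0); rewrite wt_xw mdeg0 muln0 addn0 => /(_ (ltnSn _)).
rewrite fcoefD fcoefN fcoefCM xvarXE mnm_muln_e0 FpsE eqxx mulr1.
exact: subr0_eq.
Qed.

Lemma TphiE : T phi = x * Phi.
Proof.
rewrite -[x]expr1; apply: xdivE => -[|//] _; apply: fpsP => b; rewrite xcoefE rscE.
case: ifP => // le; have b0 : mdeg b = 0%N by case: (mdeg b) le => // d; rewrite mulnS; lia.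
have -> : b = mnm0 by apply/eqP; rewrite -mdeg_eq0 b0.
by rewrite sub0n mcons00; case: cphi => [[-> _] _].
Qed.

Lemma Phi0 : Phi mnm0 != 0.
Proof.
rewrite -mcons00 shopE' mul1r add0n rscE mdeg0 muln0 subn0.
by case: cphi => [[_]]; rewrite dxE mnm0E mulr1n add0m mnm1_e0.
Qed.

Lemma TyE j : T (of_lam (y j)) = x ^+ (W - j) * Y j.
Proof.
apply: xdivE => i lti; apply: fpsP => b; rewrite xcoefE rsc_of_lam.
case: eqP => // ei; have b0 : mdeg b = 0%N.
  by case: (mdeg b) ei => // d; rewrite mulnS => ei; move: lti; rewrite ei; lia.
have -> : b = mnm0 by apply/eqP; rewrite -mdeg_eq0 b0.
exact: y0.
Qed.

Lemma YE j i b : Y j (mcons i b) =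
  if (i + (W - j) == W * mdeg b)%N then y j b else 0.
Proof. by rewrite shopE' mul1r rsc_of_lam. Qed.

Lemma homog_Y (j : 'I_k) : homog k (- (W - j)%N%:Z) (Y j).
Proof.
move=> d; rewrite -(mcons_eta d) YE /rk mcons0 mconsK => /eqP nd.
by case: eqP => // e1; case: nd; rewrite -e1; lia.
Qed.

Lemma wge_Y (j : 'I_k) : wge (@lw m) 1 (Y j).
Proof.
move=> d; rewrite -(mcons_eta d) wt_lw YE => lt; case: eqP => // e1.
by have lj := ltn_ord j; move: lt e1; case: (mdeg _) => // _; rewrite muln0; lia.
Qed.

Lemma homog_M : homog k 0 M.
Proof.
move=> d; rewrite -(mcons_eta d) rsc_of_lam /rk mcons0 mconsK => /eqP nd.
by case: eqP => // e1; case: nd; rewrite e1 subrr.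
Qed.

Let G := rkG k Phi.
Let q := geoq Phi Y (fun j : 'I_k => (W - j)%N).
Let uPhi : Phi \is a GRing.unit. Proof. by rewrite fps_unitE Phi0. Qed.
Let uA : A \is a GRing.unit. Proof. by rewrite fps_unitE A0. Qed.

Lemma residue_eq : A^-1 * (1 - q) = G * (fpsC m.+1 e * Phi^-1 ^+ k + M * x ^+ k).
Proof.
have nk : k = 0%N -> mu mnm0 = 0 by move=> ek; move: k0; rewrite ek.
have [_ eqn] := (conj_nfBP y a phi (den_ok_mu e0 nk)).1 cphi.
(* The factor [x] turns [dx phi] into [x dx phi], whose rescaling is known. *)
have := congr1 (fun f => T (x * f)) eqn; rewrite /= !rscM rsc_x.
have -> : x * (T a * T (dx phi) * T (nf_den k e mu phi)) =
    T a * (T (x * dx phi)) * T (nf_den k e mu phi) by rewrite rscM rsc_x; ring.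
rewrite -rkop_rsc TaE TphiE rkopM rkop_x.
have -> : T (nf_den k e mu phi) = fpsC m.+1 e + M * (x * Phi) ^+ k.
  by rewrite /nf_den rscD rscC rscM rscX TphiE.
have -> : T (nf_num y phi) = x ^+ W * (Phi ^+ W * (1 - q)).
  rewrite /nf_num rscD rscX rsc_sum TphiE /q /geoq opprK mulrDr mulr1 mulrDr.
  rewrite -exprMn; congr (_ + _); rewrite !mulr_sumr; apply: eq_bigr => j _.
  rewrite rscM rscX TphiE TyE exprMn.
  have ej : (W = (W - j) + j)%N by have := ltn_ord j; lia.
  have -> : x ^+ W = x ^+ (W - j) * x ^+ j by rewrite -exprD -ej.
  have -> : Phi ^+ W = Phi ^+ (W - j) * Phi ^+ j by rewrite -exprD -ej.
  have PV : Phi ^+ (W - j) * Phi^-1 ^+ (W - j) = 1 by rewrite -exprMn divrr // expr1n.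
  rewrite -[LHS]mulr1 -PV.
  by move: (Phi ^+ _) (Phi^-1 ^+ _) (Phi ^+ j) (x ^+ (W - j)) (x ^+ j) => P1 P2 P3 X1 X2; ring.
have -> : x * Phi + x * rkop k Phi = x * (Phi * G).
  by rewrite /G /rkG mulrDr mulr1 mulVKr // mulrDr.
have -> : x ^+ W * A * (x * (Phi * G)) * (fpsC m.+1 e + M * (x * Phi) ^+ k) =
    x * (x ^+ W * (A * (Phi * G) * (fpsC m.+1 e + M * (x * Phi) ^+ k))) by ring.
move=> /xvarI /xvarXI; exact: cancel_unit_powers.
Qed.

Lemma residue_sum_conj : residue_sum a mu.
Proof.
(* The rescaled [1/a] is [x^-W A^-1], and undoing the rescaling shifts the exponent of [x] at
   [lambda^b] by [W |b|]. *)
pose u (b : multinom m) (n : int) : K :=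
  if n + (W + W * mdeg b)%N%:Z is Posz N then A^-1 (mcons N b) else 0.
have uE b n N : n + (W + W * mdeg b)%N%:Z = N%:Z -> u b n = A^-1 (mcons N b).
  by rewrite /u => ->.
have u0 b n : n + (W + W * mdeg b)%N%:Z < 0 -> u b n = 0.
  by rewrite /u; case: (_ + _).
exists u; split.
- by move=> b; exists (W + W * mdeg b)%N => i lti; apply: u0; lia.
- move=> b n; rewrite /laurent_mul.
  pose N := n + (W + W * mdeg b)%N%:Z.
  have inner (p1 p2 : multinom m) : b = p1 +m p2 ->
      \sum_(i \in [set: nat]) a (mcons i p1) * u p2 (n - i%:Z) =
      if N is Posz N' then
        \sum_(j < N'.+1) xcoef j (T a) p1 * xcoef (N' - j) A^-1 p2 else 0.
    move=> eb; have db : mdeg b = (mdeg p1 + mdeg p2)%N by rewrite eb mdegD.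
    case EN : N => [N'|N']; last first.
      rewrite fsbig1 // => i _; rewrite u0 ?mulr0 //.
      by move: EN; rewrite /N db mulnDr; lia.
    pose S := W * mdeg p1; pose F j := xcoef j (T a) p1 * xcoef (N' - j) A^-1 p2.
    have aE i : (i + S <= N')%N -> a (mcons i p1) * u p2 (n - i%:Z) = F (i + S)%N.
      move=> le; rewrite /F !xcoefE rscE leq_addl addnK; congr (_ * _).
      by apply: uE; move: EN le; rewrite /N /S db mulnDr; lia.
    have out i : (N' < i + S)%N -> a (mcons i p1) * u p2 (n - i%:Z) = 0.
      by move=> lt; rewrite u0 ?mulr0 //; move: EN lt; rewrite /N /S db mulnDr; lia.
    have Fsmall j : (j < S)%N -> F j = 0.
      by move=> lt; rewrite /F !xcoefE rscE leqNgt lt mul0r.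
    rewrite -(@fsbig_widen _ _ _ _ `I_N'.+1) //; last first.
      by move=> i /= [_ /negP]; rewrite -leqNgt => le; apply: out; lia.
    rewrite -fsbig_ord -/(F _).
    have [leS|ltS] := leqP S N'; last first.
      rewrite !big1 // => i _; first by apply: Fsmall; have := leq_ord i; lia.
      by apply: out; lia.
    rewrite -(big_mkord xpredT F) (big_cat_nat (n := S)) //=; last by lia.
    rewrite [X in _ = X + _]big_nat_cond [X in _ = X + _]big1 ?add0r; last first.
      by move=> j /andP[/andP[_ lt] _]; exact: Fsmall.
    rewrite -{1}[S]add0n big_addn -(big_mkord xpredT (fun i => a (mcons i p1) * u p2 (n - i%:Z))).
    rewrite (big_cat_nat (n := N'.+1 - S)) ?leq_subr //= [X in _ + X]big_nat_cond.
    rewrite [X in _ + X]big1 ?addr0; last first.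
      by move=> i /andP[/andP[le _] _]; apply: out; lia.
    by apply: eq_big_nat => i /andP[_ lt]; apply: aE; lia.
  under eq_bigr => p /eqP ep do rewrite (inner _ _ ep).
  case EN : N => [N'|N'].
    rewrite exchange_big /= -(fcoef_sum (index_enum _) xpredT
      (fun j : 'I_N'.+1 => xcoef j (T a) * xcoef (N' - j) A^-1)).
    rewrite -xcoefM TaE -mulrA divrr // mulr1 xcoefE xvarXE mnm_muln_e0 FpsE.
    congr ((nat_of_bool _)%:R); apply/eqP/andP => [/mcons_inj[e1 eb]|[/eqP eb /eqP en]].
      by move: EN; rewrite /N e1 eb mdeg0 eqxx => EN; split=> //; apply/eqP; move: EN; lia.
    by rewrite eb; congr mcons; move: EN; rewrite /N eb en mdeg0; lia.
  rewrite big1 //; case: eqP => // eb; case: eqP => // en.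
  by move: EN; rewrite /N eb en mdeg0; lia.
move=> b; rewrite (uE _ _ (k + W * mdeg b)%N); last by lia.
by rewrite (residue_coef k0 Phi0 homog_Y wge_Y homog_M residue_eq) rsc_of_lam eqxx.
Qed.

End ResidueTheorem.

(** * Majorant norms and convergence *)

Section Majorants.
Variable R : realType.
Local Notation C := R[i]%C.
Local Notation Nm := (@ComplexField.Normc.normc R).

Lemma Nm0 : Nm 0 = 0. Proof. exact: ComplexField.Normc.normc0. Qed.
Lemma Nm1 : Nm 1 = 1. Proof. exact: ComplexField.Normc.normc1. Qed.
Lemma NmM (u v : C) : Nm (u * v) = Nm u * Nm v.
Proof. exact: ComplexField.Normc.normcM. Qed.
Lemma NmV (u : C) : Nm u^-1 = (Nm u)^-1.
Proof. exact: ComplexField.Normc.normcV. Qed.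
Lemma NmN (u : C) : Nm (- u) = Nm u.
Proof. exact: normcN. Qed.
Lemma Nm_ge0 (u : C) : 0 <= Nm u.
Proof. by case: u => a b; apply: sqrtr_ge0. Qed.
Lemma NmD (u v : C) : Nm (u + v) <= Nm u + Nm v.
Proof. exact: le_normcD. Qed.
Lemma Nm_nat i : Nm i%:R = i%:R.
Proof. by rewrite normcMn Nm1. Qed.
Lemma Nm_sum I (r : seq I) (P : pred I) (F : I -> C) :
  Nm (\sum_(i <- r | P i) F i) <= \sum_(i <- r | P i) Nm (F i).
Proof.
elim/big_ind2: _ => // [|u s v t hu hv]; first by rewrite Nm0.
exact: le_trans (NmD _ _) (lerD hu hv).
Qed.

Section Generic.
Variable n : nat.
Implicit Types (rho : 'I_n -> R) (f g : fps C n) (a b : multinom n) (c d : R).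

Definition wn rho a : R := \prod_i rho i ^+ a i.

Lemma wnD rho a b : wn rho (a +m b) = wn rho a * wn rho b.
Proof. by rewrite /wn -big_split; apply: eq_bigr => i _; rewrite mnmDE exprD. Qed.

Lemma wn0 rho : wn rho mnm0 = 1.
Proof. by rewrite /wn big1 // => i _; rewrite mnm0E. Qed.

Lemma wn1 rho i : wn rho (mnm1 i) = rho i.
Proof.
rewrite /wn (bigD1 i) //= mnm1E eqxx expr1 big1 ?mulr1 // => j nj.
by rewrite mnm1E eq_sym (negbTE nj).
Qed.

Lemma wn_ge0 rho a : (forall i, 0 <= rho i) -> 0 <= wn rho a.
Proof. by move=> h; apply: prodr_ge0 => i _; apply: exprn_ge0. Qed.

Lemma ler_wn rho rho' a : (forall i, 0 <= rho i <= rho' i) -> wn rho a <= wn rho' a.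
Proof.
move=> h; apply: ler_prod => i _; have /andP[h0 h1] := h i.
by rewrite exprn_ge0 // lerXn2r // nnegrE // (le_trans h0).
Qed.

Lemma wn_const r a : wn (fun=> r) a = r ^+ mdeg a.
Proof. by rewrite /wn mdegE -prodrXr. Qed.

(** [c] bounds the weighted l1-norm of [f] with radii [rho]. Bounding all finite partial sums avoids
    speaking of the value of the norm. *)
Definition nb rho f (c : R) :=
  forall N, \sum_(a : bmultinom n N) Nm (f a) * wn rho a <= c.

Variable rho : 'I_n -> R.
Hypothesis rho0 : forall i, 0 <= rho i.

Let w0 a : 0 <= wn rho a. Proof. exact: wn_ge0. Qed.
Let t0 f a : 0 <= Nm (f a) * wn rho a.
Proof. by rewrite mulr_ge0 ?Nm_ge0. Qed.

Lemma nb_ge0 f c : nb rho f c -> 0 <= c.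
Proof. by move=> h; apply: le_trans (h 0%N); apply: sumr_ge0. Qed.

Lemma nbW f c d : c <= d -> nb rho f c -> nb rho f d.
Proof. by move=> le h N; apply: le_trans (h N) le. Qed.

Lemma nbD f g c d : nb rho f c -> nb rho g d -> nb rho (f + g) (c + d).
Proof.
move=> hf hg N; apply: le_trans (lerD (hf N) (hg N)).
rewrite -big_split; apply: ler_sum => a _ /=.
by rewrite -mulrDl ler_wpM2r // fcoefD NmD.
Qed.

Lemma nbN f c : nb rho f c -> nb rho (- f) c.
Proof.
move=> hf N; apply: le_trans (hf N); apply: ler_sum => a _.
by rewrite fcoefN NmN.
Qed.

Lemma nbB f g c d : nb rho f c -> nb rho g d -> nb rho (f - g) (c + d).
Proof. by move=> hf /nbN; apply: nbD. Qed.

Lemma nb0 : nb rho 0 0.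
Proof. by move=> N; rewrite big1 // => a _; rewrite fcoef0 Nm0 mul0r. Qed.

Lemma nb_sum I (r : seq I) (P : pred I) (F : I -> fps C n) (c : I -> R) :
  (forall i, P i -> nb rho (F i) (c i)) ->
  nb rho (\sum_(i <- r | P i) F i) (\sum_(i <- r | P i) c i).
Proof.
move=> h; elim/big_ind2: _ => //; first exact: nb0.
by move=> *; apply: nbD.
Qed.

Lemma nbM f g c d : nb rho f c -> nb rho g d -> nb rho (f * g) (c * d).
Proof.
move=> hf hg N; apply: (le_trans _ (ler_pM _ _ (hf N) (hg N))); try exact: sumr_ge0.
pose X b (c : multinom n) := Nm (f b) * wn rho b * (Nm (g c) * wn rho c).
have X0 b (c' : multinom n) : 0 <= X b c' by apply: mulr_ge0.
rewrite big_distrlr /=; have -> : \sum_(i : bmultinom n N) \sum_(j : bmultinom n N)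
    Nm (f i) * wn rho i * (Nm (g j) * wn rho j) =
    \sum_(i : bmultinom n N) \sum_(j : bmultinom n N) X i j by [].
apply: (@le_trans _ _ (\sum_(a : bmultinom n N) \sum_(b : bmultinom n N)
    \sum_(c : bmultinom n N) if (a : multinom n) == b +m c then X b c else 0)).
  apply: ler_sum => a _; rewrite (fcoefM_wide _ _ (bmdeg a)).
  apply: le_trans (ler_wpM2r (w0 a) (Nm_sum _ _ _)) _.
  rewrite mulr_suml; apply: ler_sum => b _.
  apply: le_trans (ler_wpM2r (w0 a) (Nm_sum _ _ _)) _.
  rewrite mulr_suml big_mkcond; apply: ler_sum => c' _.
  case: eqP => // ->; rewrite NmM wnD /X.
  by rewrite mulrACA.
rewrite exchange_big; apply: ler_sum => b _; rewrite exchange_big; apply: ler_sum => c' _ /=.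
rewrite -big_mkcond /=; have [lt|le] := ltnP (mdeg (b +m c')) N; last first.
  rewrite big1 // => a /eqP ea; move: (bmdeg a); rewrite ea ltnNge le //.
by rewrite (big_pred1 (BMultinom lt)).
Qed.

Lemma nb_const (u : C) : nb rho (fpsC n u) (Nm u).
Proof.
move=> [|N]; first by rewrite big1 ?Nm_ge0 // => -[].
rewrite (bigD1 (@bm0 n N)) //= fcoefC eqxx mulr1n wn0 mulr1 big1 ?addr0 // => a na.
rewrite fcoefC; case: eqP => [ea|_]; last by rewrite mulr0n Nm0 mul0r.
by case/eqP: na; apply/val_inj.
Qed.

Lemma nb1 : nb rho 1 1.
Proof. by have := nb_const 1; rewrite Nm1. Qed.

Lemma nbX f c i : nb rho f c -> nb rho (f ^+ i) (c ^+ i).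
Proof.
move=> h; elim: i => [|i IHi]; first by rewrite !expr0; exact: nb1.
by rewrite !exprS; apply: nbM.
Qed.

Lemma nb_fpsX i : nb rho (fpsX C i) (rho i).
Proof.
move=> N; have [lt|le] := ltnP 1 N; last first.
  rewrite big1 // => a _; rewrite FpsE; case: eqP => [ea|_]; last by rewrite Nm0 mul0r.
  by move: (bmdeg a); rewrite ea mdeg1 ltnNge le.
have lt1 : (mdeg (mnm1 i) < N)%N by rewrite mdeg1.
rewrite (bigD1 (BMultinom lt1)) //= FpsE eqxx Nm1 mul1r wn1 big1 ?addr0 // => a na.
rewrite FpsE; case: eqP => [ea|_]; last by rewrite Nm0 mul0r.
by case/eqP: na; apply/val_inj.
Qed.

Lemma nb_prod I (r : seq I) (P : pred I) (F : I -> fps C n) (c : I -> R) :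
  (forall i, P i -> nb rho (F i) (c i)) ->
  nb rho (\prod_(i <- r | P i) F i) (\prod_(i <- r | P i) c i).
Proof.
move=> h; elim/big_ind2: _ => //; first exact: nb1.
by move=> *; apply: nbM.
Qed.

Lemma nb_mono rho' f c : (forall i, 0 <= rho' i <= rho i) -> nb rho f c -> nb rho' f c.
Proof.
move=> h hf N; apply: le_trans (hf N); apply: ler_sum => a _.
by rewrite ler_wpM2l ?Nm_ge0 // ler_wn.
Qed.

(** A partial sum involves finitely many coefficients, and these are already final in some [u i]. *)
Lemma nb_lim (w : 'I_n -> nat) (u : nat -> fps C n) f c :
  (forall a i, (wt w a < i)%N -> f a = u i a) -> (forall i, nb rho (u i) c) ->
  nb rho f c.
Proof.
move=> fu uc N; pose M := (\max_(a : bmultinom n N) wt w a).+1.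
apply: le_trans (uc M N); apply: ler_sum => a _.
by rewrite (fu _ M) // ltnS (leq_bigmax_cond (F := fun a : bmultinom n N => wt w a)).
Qed.

Lemma nb_finite f N : (forall a, (N <= mdeg a)%N -> f a = 0) ->
  nb rho f (\sum_(a : bmultinom n N) Nm (f a) * wn rho a).
Proof.
move=> hf M; pose F a := Nm (f a) * wn rho a.
have F0 a : (N <= mdeg a)%N -> F a = 0 by move=> /hf fa; rewrite /F fa Nm0 mul0r.
rewrite -(big_bmnm_widen (leq_maxl N M) (F := F)) //.
rewrite (@big_sub_widen _ _ _ _ _ _ (bmultinom n M) (bmultinom n (maxn N M)) xpredT F) /=;
  last by move=> a lt; rewrite (leq_trans lt) ?leq_maxr.
rewrite [X in _ <= X](bigID (fun a : bmultinom n (maxn N M) => (mdeg a < M)%N)) /=.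
by rewrite lerDl; apply: sumr_ge0 => a _; apply: t0.
Qed.

End Generic.

Lemma nb_fcomp n p (rho : 'I_n -> R) (sig : 'I_p -> R) (h : 'I_n -> fps C p) f c :
  (forall i, 0 <= rho i) -> (forall i, 0 <= sig i) -> (forall i, h i mnm0 = 0) ->
  (forall i, nb sig (h i) (rho i)) -> nb rho f c -> nb sig (fps_comp f h) c.
Proof.
move=> rho0 sig0 h0 hh hf N; apply: le_trans (hf N).
apply: (@le_trans _ _ (\sum_(a : bmultinom p N) \sum_(b : bmultinom n N)
    Nm (f b) * (Nm (mmap1 h b a) * wn sig a))).
  apply: ler_sum => a _; rewrite (@fcompE _ _ _ _ h0 N) ?bmdeg //.
  apply: le_trans (ler_wpM2r (wn_ge0 a sig0) (Nm_sum _ _ _)) _.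
  by rewrite mulr_suml; apply: ler_sum => b _; rewrite NmM mulrA.
rewrite exchange_big; apply: ler_sum => b _; rewrite -mulr_sumr.
rewrite ler_wpM2l ?Nm_ge0 //.
suff : nb sig (mmap1 h b) (wn rho b) by apply.
by apply: nb_prod => // i _; apply: nbX.
Qed.

Definition anal n (f : fps C n) := exists2 r, 0 < r & exists c, nb (fun=> r) f c.

Lemma analyticP n (f : fps C n) : analytic f <-> anal f.
Proof.
pose s N := [seq val b | b <- enum {: bmultinom n N}].
have us N : uniq (s N) by rewrite map_inj_uniq ?enum_uniq //; exact: val_inj.
have ms N a : (a \in s N) = (mdeg a < N)%N.
  apply/mapP/idP => [[b _ ->]|lt]; first exact: bmdeg.
  by exists (BMultinom lt); rewrite ?mem_enum.
have ss N (F : multinom n -> R) : (\sum_(a \in [set` s N]%classic) (F a)%:E)%E =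
    (\sum_(a : bmultinom n N) F a)%:E.
  by rewrite -fsbig_seq // sumEFin /s big_map big_enum.
split=> -[r r0]; pose F (a : multinom n) := Nm (f a) * r ^+ mdeg a;
  have F0 a : 0 <= F a by rewrite mulr_ge0 ?Nm_ge0 // exprn_ge0 // ltW.
  rewrite /summable; have -> : (\esum_(a in [set: multinom n]%classic) `|(F a)%:E|)%E =
      (\esum_(a in [set: multinom n]%classic) (F a)%:E)%E.
    by apply: eq_esum => a _; rewrite gee0_abs // lee_fin.
  move=> sF; exists r => //; exists (fine (\esum_(a in [set: multinom n]%classic) (F a)%:E)%E) => N.
  have fin : (\esum_(a in [set: multinom n]%classic) (F a)%:E)%E \is a fin_num.
    by rewrite ge0_fin_numE // esum_ge0 // => a _; rewrite lee_fin.
  under eq_bigr => a _ do rewrite wn_const -/(F a).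
  rewrite -lee_fin fineK // -ss; apply: esum_ge; exists [set` s N]%classic => //.
  by split=> //; exact: finite_seq.
move=> [c hc]; exists r => //; rewrite /summable.
have -> : (\esum_(a in [set: multinom n]%classic) `|(F a)%:E|)%E =
    (\esum_(a in [set: multinom n]%classic) (F a)%:E)%E.
  by apply: eq_esum => a _; rewrite gee0_abs // lee_fin.
apply: (@le_lt_trans _ _ c%:E); last exact: ltry.
apply: ge_ereal_sup => _ [X [/finite_seqP[t ->] _] <-].
pose N := (\max_(a <- t) mdeg a).+1.
apply: (@le_trans _ _ (\sum_(a \in [set` s N]%classic) (F a)%:E)%E).
  apply: lee_fsum_nneg_subset; [exact: finite_seq|exact: finite_seq| |].
    move=> a; rewrite !inE /= ms ltnS => ta; exact: leq_bigmax_seq.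
  by move=> a _; rewrite lee_fin.
rewrite ss lee_fin; apply: le_trans (hc N); apply: ler_sum => a _.
by rewrite wn_const.
Qed.

End Majorants.

Section TwoRadii.
Variables (R : realType) (m : nat).
Local Notation C := R[i]%C.
Local Notation Nm := (@ComplexField.Normc.normc R).
Local Notation x := (xvar C m).
Implicit Types (f g : fps C m.+1) (r s c d : R).

Definition rad r s (i : 'I_m.+1) : R := if unlift ord0 i is Some _ then s else r.

Lemma rad_x r s : rad r s ord0 = r. Proof. by rewrite /rad unlift_none. Qed.
Lemma rad_lam r s j : rad r s (lift ord0 j) = s. Proof. by rewrite /rad liftK. Qed.

Lemma rad_ge0 r s i : 0 <= r -> 0 <= s -> 0 <= rad r s i.
Proof. by rewrite /rad; case: unliftP. Qed.

Lemma wn_rad r s i (b : multinom m) : wn (rad r s) (mcons i b) = r ^+ i * s ^+ mdeg b.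
Proof.
rewrite /wn big_ord_recl rad_x mcons0 mdegE -prodrXr; congr (_ * _).
by apply: eq_bigr => j _; rewrite rad_lam mconsS.
Qed.

Definition nb2 r s f c := nb (rad r s) f c.

Section Fixed.
Variables r s : R.
Hypotheses (r0 : 0 < r) (s0 : 0 < s).
Local Notation rs0 := (fun i => rad_ge0 i (ltW r0) (ltW s0)).

Lemma nb2_xX i : nb2 r s (x ^+ i) (r ^+ i).
Proof.
by apply: nbX => [j|]; [exact: rs0|move: (nb_fpsX rs0 ord0); rewrite rad_x].
Qed.

Lemma nb2_shop (u : nat -> C) B j f c : (forall i, Nm (u i) <= B) ->
  nb2 r s f c -> nb2 r s (shop u j f) (B * c / r ^+ j).
Proof.
move=> uB hf N; have B0 : 0 <= B by apply: le_trans (uB 0%N); exact: Nm_ge0.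
pose F (a : multinom m.+1) := Nm (f a) * wn (rad r s) a.
have F0 a : 0 <= F a by rewrite mulr_ge0 ?Nm_ge0 // (wn_ge0 _ rs0).
have lt (a : bmultinom m.+1 N) : (mdeg (a +m mcons j mnm0) < N + j)%N.
  by rewrite mdegD mdeg_mcons mdeg0 addn0 ltn_add2r bmdeg.
pose h (a : bmultinom m.+1 N) : bmultinom m.+1 (N + j) := BMultinom (lt a).
have hinj : injective h.
  by move=> a b /(congr1 (@bmnm _ _)) /= e; apply/val_inj; exact: addIm e.
(* The shift embeds the exponents injectively among those of degree below [N + j], changing each
   weight by the factor [r^j]. *)
apply: (@le_trans _ _ (B / r ^+ j * \sum_(a : bmultinom m.+1 N) F (h a))).
  rewrite mulr_sumr; apply: ler_sum => a _; rewrite shopE NmM /F /= wnD wn_rad.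
  rewrite mdeg0 expr0 mulr1.
  have -> : B / r ^+ j * (Nm (f (a +m mcons j mnm0)) * (wn (rad r s) a * r ^+ j)) =
      B * (Nm (f (a +m mcons j mnm0)) * wn (rad r s) a).
    by field; rewrite expf_neq0 // gt_eqF.
  by rewrite -mulrA ler_wpM2r // mulr_ge0 ?Nm_ge0 // (wn_ge0 _ rs0).
rewrite mulrAC; apply: ler_wpM2r; first by rewrite invr_ge0 exprn_ge0 // ltW.
rewrite ler_wpM2l //; apply: le_trans (hf (N + j)%N).
have -> : \sum_a F (h a) = \sum_(b in [set h a | a in [set: bmultinom m.+1 N]]) F b.
  by rewrite big_imset /=; [apply: eq_bigl => a; rewrite inE|move=> ? ? _ _ /hinj].
rewrite [X in _ <= X](bigID (mem [set h a | a in [set: bmultinom m.+1 N]])) /=.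
by rewrite lerDl; apply: sumr_ge0 => a _; exact: F0.
Qed.

Lemma nb2_xcoef j f c : nb2 r s f c -> nb2 r s (of_lam (xcoef j f)) (c / r ^+ j).
Proof.
rewrite of_lam_xcoef -{2}[c]mul1r; apply: nb2_shop => i.
by case: eqP => _; rewrite ?Nm1 ?Nm0 ?ler01.
Qed.

End Fixed.

(* The terms free of lambda gain a factor (r/r0)^(p+1), the others a factor s/r0. *)
Lemma nb2_small W p f d : analytic f -> wge (xw W) p.+1 f -> 0 < d ->
  exists2 r1, 0 < r1 & forall r, 0 < r -> r <= r1 ->
  exists2 s1, 0 < s1 & forall s, 0 < s -> s <= s1 -> nb2 r s f (d * r ^+ p).
Proof.
move=> /analyticP[r0 r00 [c hc]] wf d0; have c0 := nb_ge0 (fun=> ltW r00) hc.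
(* Each of the two gains has to contribute at most [d r^p / 2]; [c + 1] in place of [c] keeps the
   quotient positive for [c = 0]. *)
pose r1 := Num.min r0 (d * r0 ^+ p.+1 / (2 * (c + 1))).
have c1 : 0 < 2 * (c + 1) by lra.
exists r1; first by rewrite lt_min r00 divr_gt0 // mulr_gt0 ?exprn_gt0.
move=> r rp; rewrite le_min => /andP[rr0 rd].
have drp : 0 < d * r ^+ p by rewrite mulr_gt0 ?exprn_gt0.
exists (Num.min r0 (d * r ^+ p * r0 / (2 * (c + 1)))).
  by rewrite lt_min r00 divr_gt0 // mulr_gt0.
move=> s sp; rewrite le_min => /andP[sr0 sd].
pose th := (r / r0) ^+ p.+1 + s / r0.
have q0 : 0 <= r / r0 by rewrite divr_ge0 // ltW.
have q1 : r / r0 <= 1 by rewrite ler_pdivrMr // mul1r.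
have t1 : 0 <= (r / r0) ^+ p.+1 by rewrite exprn_ge0.
have t2 : 0 <= s / r0 by rewrite divr_ge0 // ltW.
have term a : Nm (f a) * wn (rad r s) a <= th * (Nm (f a) * wn (fun=> r0) a).
  rewrite mulrCA; have [->|fa] := eqVneq (f a) 0; first by rewrite Nm0 !mul0r.
  rewrite ler_wpM2l ?Nm_ge0 // wn_const -(mcons_eta a) wn_rad mdeg_mcons exprD.
  set i := a ord0; set b := mtail a.
  have -> : r ^+ i * s ^+ mdeg b = (r / r0) ^+ i * (s / r0) ^+ mdeg b * (r0 ^+ i * r0 ^+ mdeg b).
    by rewrite mulrACA -!exprMn !divfK ?gt_eqF.
  apply: ler_wpM2r; first by apply: mulr_ge0; apply: exprn_ge0; exact: ltW.
  have s1 : s / r0 <= 1 by rewrite ler_pdivrMr // mul1r.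
  have [b0|bp] := posnP (mdeg b).
    rewrite b0 expr0 mulr1; have pi : (p.+1 <= i)%N.
      rewrite leqNgt; apply: contraNN fa => lt; apply/eqP/wf.
      by rewrite -(mcons_eta a) wt_xw b0 muln0 addn0.
    by apply: (@le_trans _ _ ((r / r0) ^+ p.+1)); [exact: ler_wiXn2l|rewrite lerDl].
  apply: (@le_trans _ _ (s / r0)); last by rewrite lerDr.
  rewrite -[X in _ <= X]mul1r; apply: ler_pM; rewrite ?exprn_ge0 //.
    by rewrite exprn_ile1.
  by rewrite -[X in _ <= X]expr1; apply: ler_wiXn2l.
have : nb2 r s f (th * c).
  move=> N; apply: (@le_trans _ _ (\sum_(a : bmultinom m.+1 N) th * (Nm (f a) * wn (fun=> r0) a))).
    by apply: ler_sum => a _; exact: term.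
  by rewrite -mulr_sumr ler_wpM2l // addr_ge0.
apply: nbW; rewrite /th.
have h1 : (r / r0) ^+ p.+1 * (c + 1) <= d * r ^+ p / 2.
  rewrite expr_div_n exprS mulrAC ler_pdivrMr ?exprn_gt0 //.
  move: rd; rewrite ler_pdivlMr // => rd.
  have := ler_wpM2r (exprn_ge0 p (ltW rp)) rd.
  by lra.
have h2 : s / r0 * (c + 1) <= d * r ^+ p / 2.
  rewrite mulrAC ler_pdivrMr //; move: sd; rewrite ler_pdivlMr // => sd.
  by lra.
have : ((r / r0) ^+ p.+1 + s / r0) * c <= ((r / r0) ^+ p.+1 + s / r0) * (c + 1).
  by rewrite ler_wpM2l ?addr_ge0 //; lra.
by lra.
Qed.

End TwoRadii.

Section AnalyticFixedPoint.
Variables (R : realType) (m k : nat).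
Local Notation C := R[i]%C.
Local Notation Nm := (@ComplexField.Normc.normc R).
Local Notation x := (xvar C m).
Implicit Types (f g al T xi : fps C m.+1) (r s c d : R).

(** There are no small divisors, as the eigenvalues are integers. *)
Lemma Nm_hom_inv i :
  Nm (if i == k.+1 then 0 else (k.+1%:R - i%:R)^-1) <= 1.
Proof.
case: eqP => [_|/eqP ni]; first by rewrite Nm0 ler01.
rewrite NmV; have h : 1 <= Nm (k.+1%:R - i%:R).
  have [le|lt] := leqP i k.+1.
    by rewrite -natrB // Nm_nat ler1n subn_gt0 ltn_neqAle ni.
  have -> : k.+1%:R - i%:R = - (i - k.+1)%:R :> C.
    by rewrite natrB 1?ltnW // opprB.
  by rewrite NmN Nm_nat ler1n subn_gt0.
by rewrite invf_le1 // (lt_le_trans ltr01).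
Qed.

(** The factor [i+1] from differentiation is compensated by the divisor [k-i], so the composite is a
    bounded diagonal operator and the iteration loses no radius of convergence. *)
Lemma dx_hom_inv g : dx (hom_inv k g) =
  shop (fun i => i.+1%:R * (if i.+1 == k.+1 then 0 else (k.+1%:R - i.+1%:R)^-1)) k.+1 g.
Proof.
apply: fpsP => a; rewrite -(mcons_eta a) dx_shop !shopE' -mulrA addn1.
by rewrite addSnnS.
Qed.

Lemma Nm_dx_hom_inv i :
  Nm (i.+1%:R * (if i.+1 == k.+1 then 0 else (k.+1%:R - i.+1%:R)^-1)) <= k.+2%:R.
Proof.
rewrite NmM Nm_nat eqSS; case: eqP => [_|/eqP ni]; first by rewrite Nm0 mulr0 ler0n.
rewrite NmV; have [le|lt] := leqP i k.
  have lt : (i < k)%N by rewrite ltn_neqAle ni.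
  rewrite -natrB ?ltnS // Nm_nat subSS.
  have h : (1 : R) <= (k - i)%:R by rewrite ler1n subn_gt0.
  rewrite ler_pdivrMr ?(lt_le_trans ltr01) // -natrM ler_nat.
  by have : (0 < k - i)%N; [rewrite subn_gt0|case: (k - i)%N => // n _; nia].
have -> : k.+1%:R - i.+1%:R = - (i - k)%:R :> C.
  by rewrite natrB 1?ltnW // -!natr1; ring.
rewrite NmN Nm_nat.
have h : (1 : R) <= (i - k)%:R by rewrite ler1n subn_gt0.
rewrite ler_pdivrMr ?(lt_le_trans ltr01) // -natrM ler_nat.
by have := subnKC (ltnW lt); case: (i - k)%N h => [|n] _; [lia|nia].
Qed.

Section Fixed.
Variables r s : R.
Hypotheses (r0 : 0 < r) (s0 : 0 < s).
Local Notation nb2 := (@nb2 R m r s).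
Let rs0 (i : 'I_m.+1) : 0 <= rad r s i. Proof. exact: rad_ge0 (ltW r0) (ltW s0). Qed.

Let nX i : nb2 (x ^+ i) (r ^+ i). Proof. exact: nb2_xX. Qed.

Lemma nb2_dpow xi d j : 0 <= d -> 2 * d <= 1 -> nb2 xi (2 * d * r) ->
  nb2 (dpow xi j) (d * (j%:R * 2 ^+ j) * r ^+ j).
Proof.
move=> d0 d1 hxi; rewrite dpowE.
have hx1 : nb2 (x + xi) (2 * r).
  apply: (@nbW _ _ _ _ (r + 2 * d * r)).
    by have := ler_wpM2r (ltW r0) d1; lra.
  by apply: nbD => //; have := nX 1; rewrite !expr1.
case: j => [|j]; first by rewrite big_ord0 mulr0 !mul0r mulr0 mul0r; exact: nb0.
have h : nb2 (\sum_(i < j.+1) (x + xi) ^+ (j - i) * x ^+ i) (\sum_(i < j.+1) (2 * r) ^+ j).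
  apply: (nb_sum rs0) => i _.
  have -> : (2 * r) ^+ j = (2 * r) ^+ (j - i) * (2 * r) ^+ i.
    by rewrite -exprD subnK ?leq_ord.
  apply: (nbM rs0); first exact: (nbX rs0).
  apply: nbW (nX i); rewrite exprMn; apply: ler_peMl.
    exact: exprn_ge0 (ltW r0).
  by rewrite exprn_ege1 // ler1n.
apply: nbW (nbM rs0 hxi h); rewrite sumr_const card_ord -mulr_natl exprMn !exprS.
by rewrite le_eqVlt; apply/orP; left; apply/eqP; ring.
Qed.

End Fixed.

(** All estimates are homogeneous in [r]: a factor [x] costs [r], extracting the coefficient of
    [x^j] costs [r^-j]. The powers of [r] combine to [r^(k+1)], and [d] does not depend on the
    radii. *)
Lemma nb2_fix_rhs : exists2 d : R, 0 < d & forall r s al T g, 0 < r -> 0 < s ->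
  nb2 r s al (d / 4 * r ^+ k.+1) -> nb2 r s T (d * r) -> nb2 r s (dx T) d ->
  nb2 r s g (d * r ^+ k.+1) -> nb2 r s (fix_rhs k al T g) (d * r ^+ k.+1).
Proof.
pose D j : R := j%:R * 2 ^+ j.
pose c1 : R := 2 * \sum_(i < k.+1) D (k - i)%N.
pose c2 : R := \sum_(j < k) D j.
pose c3 : R := D k + (k.+3%:R + 1) * 2 ^+ k.
have D0 j : 0 <= D j by rewrite mulr_ge0 // exprn_ge0.
have c10 : 0 <= c1 by rewrite mulr_ge0 // sumr_ge0.
have c20 : 0 <= c2 by rewrite sumr_ge0.
have k3 : 0 <= k.+3%:R :> R by [].
have t2k : 0 <= (2 : R) ^+ k by rewrite exprn_ge0.
have c30 : 0 <= c3 by rewrite addr_ge0 // mulr_ge0 // addr_ge0.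
(* The part [2 (c1 + c2 + c3)] keeps the quadratic terms below half of [d r^(k+1)], the other half
   being left to [al (1 + xi')]. The parts [k+3] and 2 ensure that [xi'] has norm at most 1 and that
   [2 d <= 1]. *)
pose B := 2 * (c1 + c2 + c3) + k.+3%:R + 2.
have B0 : 0 < B by rewrite /B; lra.
pose d := B^-1; have d0 : 0 < d by rewrite invr_gt0.
have dB : d * B = 1 by rewrite mulVf // gt_eqF.
have d2 : 2 * d <= 1.
  by have := mulr_ge0 (ltW d0) c10; have := mulr_ge0 (ltW d0) c20;
     have := mulr_ge0 (ltW d0) c30; have := mulr_ge0 (ltW d0) k3; move: dB; rewrite /B; lra.
have dk : d * k.+3%:R <= 1.
  by have := mulr_ge0 (ltW d0) c10; have := mulr_ge0 (ltW d0) c20;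
     have := mulr_ge0 (ltW d0) c30; move: dB; rewrite /B; lra.
have dc : d * (c1 + c2 + c3) <= 1 / 2.
  by have := mulr_ge0 (ltW d0) k3; move: dB; rewrite /B; lra.
exists d => // r s al T g r0 s0 hal hT hdT hg.
have rs0 (i : 'I_m.+1) : 0 <= rad r s i by exact: rad_ge0 (ltW r0) (ltW s0).
have rX i : 0 < r ^+ i by rewrite exprn_gt0.
have rXn i : r ^+ i != 0 by rewrite gt_eqF.
set xi := hom_inv k g + T.
have hxi : nb2 r s xi (2 * d * r).
  have h : nb2 r s (hom_inv k g) (d * r).
    apply: nbW (nb2_shop r0 s0 k Nm_hom_inv hg).
    by rewrite mul1r exprS mulrA mulfK.
  by apply: nbW (nbD rs0 h hT); lra.
have hdx : nb2 r s (dx xi) (k.+3%:R * d).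
  rewrite dxD; have h : nb2 r s (dx (hom_inv k g)) (k.+2%:R * d).
    rewrite dx_hom_inv; apply: nbW (nb2_shop r0 s0 k.+1 Nm_dx_hom_inv hg).
    by rewrite mulrA mulfK.
  apply: nbW (nbD rs0 h hdT); rewrite -[k.+3]addn1 natrD; lra.
have hD j : nb2 r s (dpow xi j) (d * D j * r ^+ j).
  by apply: nb2_dpow => //; exact: ltW.
have hone : nb2 r s (1 + dx xi) 2.
  have h1 : nb2 r s (1 : fps C m.+1) 1 by exact: nb1.
  by apply: (nbW _ (nbD rs0 h1 hdx)); lra.
have hx i : nb2 r s (x ^+ i) (r ^+ i) by exact: nb2_xX.
have hx1 : nb2 r s (x + xi) (2 * r).
  have h := hx 1%N; rewrite !expr1 in h.
  by apply: nbW (nbD rs0 h hxi); have := ler_wpM2r (ltW r0) d2; lra.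
have hA : nb2 r s (al * (1 + dx xi)) (d / 2 * r ^+ k.+1).
  by apply: nbW (nbM rs0 hal hone); lra.
have hfac : nb2 r s (conj_fac k al xi) (d * c3 * r ^+ (k + k.+1)).
  have h1 := nbM rs0 (hx k.+1) (hD k).
  have h2 := nbM rs0 (nbD rs0 (nbM rs0 (hx k.+1) hdx) hA) (nbX rs0 k hx1).
  apply: nbW (nbD rs0 h1 h2); rewrite exprMn exprD /c3.
  set u := r ^+ k.+1; set v := r ^+ k; set w := 2 ^+ k.
  have : 0 <= d * (w * (v * u)).
    by rewrite (mulr_ge0 (ltW d0)) ?(mulr_ge0 t2k) ?(mulr_ge0 (ltW (rX k))) ?(ltW (rX _)).
  by lra.
rewrite /fix_rhs -/xi /conj_rhs.
have hS1 : nb2 r s (xi * (\sum_(i < k.+1) dpow xi (k - i) * x ^+ i)) (d * (d * c1) * r ^+ k.+1).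
  have h : nb2 r s (\sum_(i < k.+1) dpow xi (k - i) * x ^+ i)
      (\sum_(i < k.+1) d * D (k - i)%N * r ^+ (k - i) * r ^+ i).
    by apply: (nb_sum rs0) => i _; exact: (nbM rs0 (hD (k - i)%N) (hx i)).
  apply: (nbW _ (nbM rs0 hxi h)).
  rewrite (eq_bigr (fun i : 'I_k.+1 => d * r ^+ k * D (k - i)%N)) => [|i _]; last first.
    have -> : r ^+ k = r ^+ (k - i) * r ^+ i by rewrite -exprD subnK ?leq_ord.
    by ring.
  by rewrite -mulr_sumr /c1 exprS le_eqVlt; apply/orP; left; apply/eqP; ring.
have hS2 : nb2 r s (\sum_(j < k) of_lam (xcoef j g) * dpow xi j) (d * (d * c2) * r ^+ k.+1).
  have h : nb2 r s (\sum_(j < k) of_lam (xcoef j g) * dpow xi j)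
      (\sum_(j < k) d * r ^+ k.+1 / r ^+ j * (d * D j * r ^+ j)).
    by apply: (nb_sum rs0) => j _; exact: (nbM rs0 (nb2_xcoef r0 s0 j hg) (hD j)).
  apply: (nbW _ h).
  rewrite (eq_bigr (fun j : 'I_k => d * d * r ^+ k.+1 * D j)) => [|j _]; last first.
    by field; rewrite rXn.
  by rewrite -mulr_sumr /c2 le_eqVlt; apply/orP; left; apply/eqP; ring.
have hS3 : nb2 r s (- of_lam (xcoef (k + k.+1) g) * conj_fac k al xi) (d * (d * c3) * r ^+ k.+1).
  apply: nbW (nbM rs0 (nbN (nb2_xcoef r0 s0 (k + k.+1) hg)) hfac).
  by rewrite le_eqVlt; apply/orP; left; apply/eqP; field; rewrite rXn.
apply: nbW (nbD rs0 (nbB rs0 (nbB rs0 hA hS1) hS2) hS3).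
set u := r ^+ k.+1; have u0 : 0 <= d * u := mulr_ge0 (ltW d0) (ltW (rX _)).
have : d * u * (d * (c1 + c2 + c3)) <= d * u * (1 / 2) by rewrite ler_wpM2l.
by lra.
Qed.

End AnalyticFixedPoint.

Section AnalyticSeries.
Variables (R : realType) (n : nat).
Local Notation C := R[i]%C.
Implicit Types f g : fps C n.

Lemma nb_analytic (rho : 'I_n -> R) r f c : 0 < r -> (forall i, r <= rho i) ->
  nb rho f c -> analytic f.
Proof.
move=> r0 rrho hf; apply/analyticP; exists r => //; exists c.
apply: nb_mono hf => i; by rewrite ltW ?rrho.
Qed.

Lemma analytic_finite f N : (forall a, (N <= mdeg a)%N -> f a = 0) -> analytic f.
Proof.
move=> fN; apply: (@nb_analytic (fun=> 1) 1) => //.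
exact: (nb_finite (fun=> ler01) fN).
Qed.

Lemma analyticD f g : analytic f -> analytic g -> analytic (f + g).
Proof.
move=> /analyticP[r r0 [c hf]] /analyticP[s s0 [d hg]].
have m0 : 0 < Num.min r s by rewrite lt_min r0.
have hf' : nb (fun=> Num.min r s) f c.
  by apply: nb_mono hf => i; rewrite ge_min lexx (ltW m0).
have hg' : nb (fun=> Num.min r s) g d.
  by apply: nb_mono hg => i; rewrite ge_min lexx orbT (ltW m0).
exact: (nb_analytic m0 _ (nbD (fun=> ltW m0) hf' hg')).
Qed.

Lemma analyticCM (u : C) f : analytic f -> analytic (fpsC n u * f).
Proof.
move=> /analyticP[r r0 [c hf]].
exact: (nb_analytic r0 _ (nbM (fun=> ltW r0) (nb_const _ u) hf)).
Qed.

End AnalyticSeries.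

Section AnalyticFamilies.
Variables (R : realType) (m : nat).
Local Notation C := R[i]%C.
Local Notation Nm := (@ComplexField.Normc.normc R).
Local Notation x := (xvar C m).
Local Notation lam := (@lamvar C m).
Implicit Types (f g a phi : fps C m.+1) (r s c d : R).

Lemma nb2_analytic r s f c : 0 < r -> 0 < s -> nb2 r s f c -> analytic f.
Proof.
move=> r0 s0; apply: (@nb_analytic _ _ _ (Num.min r s)); first by rewrite lt_min r0.
by move=> i; rewrite /rad ge_min; case: unliftP => *; rewrite lexx ?orbT.
Qed.

Lemma nb2_lamvar r s j : 0 < r -> 0 < s -> nb2 r s (lam j) s.
Proof.
move=> r0 s0; have := nb_fpsX (fun i => rad_ge0 i (ltW r0) (ltW s0)) (lift ord0 j).
by rewrite rad_lam.
Qed.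

Lemma analytic_subst f phi : analytic f -> analytic phi -> phi mnm0 = 0 ->
  analytic (subst f phi lam).
Proof.
move=> /analyticP[r0 r00 [c hf]] aphi phi0.
have wphi : wge (xw 1) 1 phi.
  by move=> a; rewrite -(mcons_eta a) wt_xw ltnS leqn0 addn_eq0 mul1n mdeg_eq0;
     case/andP => /eqP-> /eqP->; rewrite mcons00.
(* With [p = 0] and constant [r0], the norm of [phi] becomes at most the radius on which [f] is
   bounded. *)
have [r1 r10 /(_ r1 r10 (lexx _))[s1 s10 hs]] := @nb2_small R m 1 0 phi r0 aphi wphi r00.
pose s := Num.min s1 r0; have s0 : 0 < s by rewrite lt_min s10.
have rs0 (i : 'I_m.+1) : 0 <= rad r1 s i by exact: rad_ge0 (ltW r10) (ltW s0).
apply: (@nb2_analytic r1 s _ c) => //; apply: nb_fcomp hf => // [_|i|i].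
- exact: ltW.
- by case: unliftP => [j|] _ //; exact: lamvar0.
case: unliftP => [j|] _.
  by apply: (nbW _ (nb2_lamvar j r10 s0)); rewrite ge_min lexx orbT.
by have := hs s s0; rewrite ge_min lexx expr0 mulr1; exact.
Qed.

Lemma analytic_inverse phi : analytic phi -> coord_change phi ->
  exists sig, [/\ analytic sig, coord_change sig & subst phi sig lam = x].
Proof.
move=> aphi cphi; have [phi0 e0] := cphi.
have [sig [csig _ inv itsig]] := inv_exists cphi.
exists sig; split=> //; set e := dx phi mnm0 in e0 itsig *.
set xi := phi - fpsC m.+1 e * x in itsig.
have wxi : wge (xw 2) 2 xi by apply/wge_linear.
have xi0 : xi mnm0 = 0 by apply: wxi; rewrite wt0.
have axi : analytic xi.
  apply: analyticD => //; rewrite -mulNr -rmorphN; apply: analyticCM.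
  apply: (@analytic_finite _ _ _ 2) => a; rewrite FpsE.
  by case: eqP => // ->; rewrite mdeg1.
have n0 : 0 < Nm e.
  rewrite lt_neqAle Nm_ge0 andbT eq_sym; apply: contraNN e0 => /eqP h.
  by apply/eqP; exact: ComplexField.Normc.eq0_normc.
have [r r0 /(_ r r0 (lexx _))[s s0 /(_ s s0 (lexx _))]] :=
  @nb2_small R m 2 1 xi (Nm e / 2) axi wxi (divr_gt0 n0 (ltr0Sn R 1)).
(* [q] bounds [xi] at radius [r]. At radius [q] in [x], an iterate of norm at most [r] is sent to
   one of norm at most [(q + q) / |e| = r]. *)
rewrite expr1; set q := Nm e / 2 * r => hxi.
have q0 : 0 < q by rewrite mulr_gt0 // divr_gt0.
have qs0 (i : 'I_m.+1) : 0 <= rad q s i by exact: rad_ge0 (ltW q0) (ltW s0).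
have rs0 (i : 'I_m.+1) : 0 <= rad r s i by exact: rad_ge0 (ltW r0) (ltW s0).
suff h i : iter i (inv_rhs e xi) 0 mnm0 = 0 /\ nb2 q s (iter i (inv_rhs e xi) 0) r.
  apply: (@nb2_analytic q s sig r q0 s0); apply: (nb_lim itsig) => i.
  by case: (h i).
elim: i => [|i]; first by split; [exact: fcoef0|exact: nbW (ltW r0) (nb0 _)].
rewrite iterS; move: (iter i _ 0) => g [g0 hg]; split.
  rewrite /inv_rhs fcoefCM fcoefD fcoefN xvar0 subst0 // ?xi0 ?subr0 ?mulr0 //.
  exact: lamvar0.
have hs : nb2 q s (subst xi g lam) q.
  apply: nb_fcomp hxi => // i0.
    by case: unliftP => [j|] _ //; exact: lamvar0.
  rewrite /rad; case: unliftP => [j|] _; last exact: hg.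
  exact: nb2_lamvar.
have hx : nb2 q s x q by have := nb2_xX m q0 s0 1; rewrite !expr1.
have hc : nb2 q s (fpsC m.+1 e^-1) (Nm e^-1) by exact: nb_const.
apply: (nbW _ (nbM qs0 hc (nbB qs0 hx hs))).
rewrite NmV /q le_eqVlt; apply/orP; left; apply/eqP; field.
by rewrite gt_eqF.
Qed.

Lemma dx_of_lamX (tau : fps C m) k :
  dx (of_lam tau * x ^+ k.+1) = shop (fun=> k.+1%:R) 1 (of_lam tau * x ^+ k.+1).
Proof.
apply: fpsP => a; rewrite dxE shopE -mnm1_e0 fcoef_of_lamX mnmDE mnm1E eqxx addn1 eqSS.
by case: eqP => [->|_]; [rewrite mulr_natl|rewrite mul0rn mulr0].
Qed.

Lemma analytic_tangent_nf k (e : C) a (tau : fps C m) N : analytic a -> e != 0 -> leading k e a ->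
  (k = 0%N -> tau mnm0 = 0) -> (forall b, (N <= mdeg b)%N -> tau b = 0) ->
  exists phi (y : 'I_k -> fps C m) mu,
    [/\ analytic phi, tangent_nf e a phi y mu & xcoef k.+1 (phi - x) = tau].
Proof.
move=> aa e0 la tau0 tauN; have [g [y [mu [itg tg etau]]]] := tangent_nf_iter e0 la tau0.
exists (x + (hom_inv k g + of_lam tau * x ^+ k.+1)), y, mu.
split; [|exact: tg|by rewrite addrC addKr].
set T := of_lam tau * x ^+ k.+1 in itg tg etau *.
set al := fpsC m.+1 e * a - x ^+ k.+1 in itg.
have aT : analytic T.
  apply: (@analytic_finite _ _ _ (k.+1 + N)) => b; rewrite fcoef_of_lamX.
  case: eqP => // bk; rewrite -{1}(mcons_eta b) mdeg_mcons bk leq_add2l; exact: tauN.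
have axk : analytic (- x ^+ k.+1).
  apply: (@analytic_finite _ _ _ k.+2) => b; rewrite fcoefN xvarXE FpsE.
  by case: eqP => [->|_ _]; rewrite ?oppr0 // mnm_muln_e0 mdeg_mcons mdeg0; lia.
have aal : analytic al by apply: analyticD axk; exact: analyticCM.
have wT : wge (@xw m k.+2) 2 T.
  have [wphi _ _ _] := tg; move=> b ltb; rewrite fcoef_of_lamX; case: eqP => // bk.
  rewrite -etau xcoefE -bk mcons_eta; have := wphi b ltb.
  by rewrite addrC addKr.
have minl (u v : R) : Num.min u v <= u by rewrite ge_min lexx.
have minr (u v : R) : Num.min u v <= v by rewrite ge_min lexx orbT.
have [d d0 stable] := nb2_fix_rhs R m k.
have d4 : 0 < d / 4 by rewrite divr_gt0.
(* Differentiating [T = tau x^(k+1)] multiplies its norm by [(k+1)/r], so this constant yields the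
   bound [d] for [dx T]. *)
have dk : 0 < d / k.+1%:R by rewrite divr_gt0.
have [r1 r10 h1] := @nb2_small R m k.+2 k.+1 al (d / 4) aal la d4.
have [r2 r20 h2] := @nb2_small R m k.+2 1 T (d / k.+1%:R) aT wT dk.
pose r := Num.min r1 r2; have r0 : 0 < r by rewrite lt_min r10.
have [s1 s10 h1'] := h1 r r0 (minl _ _).
have [s2 s20 h2'] := h2 r r0 (minr _ _).
pose s := Num.min s1 s2; have s0 : 0 < s by rewrite lt_min s10.
have {h1 h1'} hal := h1' s s0 (minl _ _).
have {h2 h2'} hT := h2' s s0 (minr _ _).
rewrite expr1 in hT.
have rs0 (i : 'I_m.+1) : 0 <= rad r s i by exact: rad_ge0 (ltW r0) (ltW s0).
have hdT : nb2 r s (dx T) d.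
  rewrite dx_of_lamX; have Nk (i : nat) : Nm (k.+1%:R : C) <= k.+1%:R by rewrite Nm_nat.
  apply: (nbW _ (nb2_shop r0 s0 1 Nk hT)); rewrite expr1 le_eqVlt; apply/orP; left.
  have kn0 : (k.+1%:R : R) != 0 by rewrite pnatr_eq0.
  by apply/eqP; rewrite mulrA mulfK ?gt_eqF // mulrCA divff ?mulr1.
have hT' : nb2 r s T (d * r).
  apply: (nbW _ hT); rewrite ler_wpM2r ?(ltW r0) // ler_pdivrMr //.
  by rewrite ler_peMr ?(ltW d0) // ler1n.
have c0 : 0 <= d * r ^+ k.+1 by exact: mulr_ge0 (ltW d0) (exprn_ge0 _ (ltW r0)).
have hg : nb2 r s g (d * r ^+ k.+1).
  apply: (nb_lim itg) => i; elim: i => [|i IHi]; first exact: nbW c0 (nb0 _).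
  by rewrite iterS; exact: (stable r s al T).
have hx := nb2_xX m r0 s0 1; rewrite !expr1 in hx.
exact: nb2_analytic r0 s0 (nbD rs0 hx (nbD rs0 (nb2_shop r0 s0 k (@Nm_hom_inv R k) hg) hT)).
Qed.

End AnalyticFamilies.

(** * Powers of the ideal generated by lambda *)

Section IdealPowers.
Variables (K : numFieldType) (m : nat).
Local Notation I := (@vanish_at_lam0 K m).
Implicit Types f g : fps K m.+1.

Lemma ideal_powD N f g : ideal_pow I N f -> ideal_pow I N g -> ideal_pow I N (f + g).
Proof.
move=> [r [h [u [Iu ->]]]] [r' [h' [u' [Iu' ->]]]].
exists (r + r')%N, (fun i => match split i with inl j => h j | inr j => h' j end),
  (fun i => match split i with inl j => u j | inr j => u' j end); split.
  by move=> i j; case: split.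
rewrite big_split_ord; congr (_ + _); apply: eq_bigr => i _.
  by rewrite (unsplitK (inl i)).
by rewrite (unsplitK (inr i)).
Qed.

Lemma ideal_powMS N f g : I g -> ideal_pow I N f -> ideal_pow I N.+1 (g * f).
Proof.
move=> Ig [r [h [u [Iu ->]]]].
exists r, h, (fun i j => if unlift ord0 j is Some l then u i l else g); split.
  by move=> i j; case: unliftP.
rewrite mulr_sumr; apply: eq_bigr => i _; rewrite big_ord_recl unlift_none mulrCA.
by congr (_ * (_ * _)); apply: eq_bigr => j _; rewrite liftK.
Qed.

Lemma fcoef_lamvarM j f a : (lamvar K j * f) a =
  if a (lift ord0 j) is 0 then 0 else f (mnm_sub a (mnm1 (lift ord0 j))).
Proof.
have -> : lamvar K j = fmon K (mnm1 (lift ord0 j)) by apply: fpsP => b; rewrite !FpsE.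
by rewrite fcoef_fmonM lep1mP; case: (a _).
Qed.

(* Euler's identity [sum_j l_j df/dl_j = (deg_l f) f] writes f as a combination
   of the l_j. *)
Lemma ideal_pow_lam N f : wge (@lw m) N f -> ideal_pow I N f.
Proof.
elim: N f => [|N IHN] f wf.
  by exists 1%N, (fun=> f), (fun _ _ => 0); split=> [i []//|]; rewrite big_ord1 big_ord0 mulr1.
pose F j : fps K m.+1 := Fps (fun a => f (a +m mnm1 (lift ord0 j)) *
  (a (lift ord0 j)).+1%:R / (mdeg (mtail a)).+1%:R).
have -> : f = \sum_j lamvar K j * F j.
  apply: fpsP => a; rewrite fcoef_sum.
  rewrite (eq_bigr (fun j => f a / (mdeg (mtail a))%:R * (a (lift ord0 j))%:R)) => [|j _].
    have ea : (\sum_j (a (lift ord0 j))%:R : K) = (mdeg (mtail a))%:R.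
      by rewrite -natr_sum mdegE; congr _%:R; apply: eq_bigr => j _; rewrite mnmE.
    rewrite -mulr_sumr ea; have [t0|nt] := eqVneq (mdeg (mtail a)) 0%N.
      by rewrite t0 mulr0 wf // -(mcons_eta a) wt_lw t0.
    by rewrite divfK // pnatr_eq0.
  rewrite fcoef_lamvarM; case ea : (a (lift ord0 j)) => [|i]; first by rewrite mulr0.
  have lej : lem (mnm1 (lift ord0 j)) a by rewrite lep1mP ea.
  rewrite FpsE submK // mnmBE mnm1E eqxx ea subn1 /=.
  have -> : (mdeg (mtail (mnm_sub a (mnm1 (lift ord0 j))))).+1 = mdeg (mtail a).
    rewrite -{2}(submK lej) mtailD mdegD.
    have -> : mtail (mnm1 (lift ord0 j)) = mnm1 j.
      by apply/mnmP => l; rewrite mnmE !mnm1E (inj_eq lift_inj).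
    by rewrite mdeg1 addn1.
  by rewrite mulrAC.
elim/big_ind: _ => [| |j _]; last 1 first.
- apply: ideal_powMS.
    rewrite /vanish_at_lam0; apply: fpsP => a; rewrite FpsE fcoef0 FpsE.
    case: eqP => // /(congr1 (fun b : multinom m.+1 => b (lift ord0 j))).
    by rewrite mconsS mnm0E mnm1E eqxx.
  apply: IHN => a lta; rewrite FpsE wf ?mul0r //.
  by rewrite wtD wt1 /lw liftK addn1 ltnS.
- by exists 0%N, (fun=> 0), (fun _ _ => 0); split=> [[]|] //; rewrite big_ord0.
- exact: ideal_powD.
Qed.

End IdealPowers.

(** * Exponentials, rotations and the main theorem *)

Section LinearNormalForm.
Variables (K : numFieldType) (m : nat).
Local Notation x := (xvar K m).
Local Notation lam := (@lamvar K m).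

Lemma xcoef_xdx n f : xcoef n (x * dx f) = xcoef n f *+ n.
Proof.
by apply: fpsP => b; rewrite xcoefE xdxE ddiagE mcons0 fcoefMn mulr_natl.
Qed.

(** The coefficient [phi_n] of [x^n] satisfies [c' phi_n = n c phi_n]. The case [n = 1] gives
    [c' = c], and then [(n-1) phi_n = 0]. *)
Lemma nfA_conj (c c' : fps K m) phi : c mnm0 != 0 -> conjugacy (nfA c) (nfA c') phi ->
  c' = c /\ exists2 v : fps K m, v mnm0 != 0 & phi = of_lam v * x.
Proof.
move=> c0 [[phi0 dphi] eqn]; have l0 := @lamvar0 K m.
have {}eqn : of_lam c' * phi = of_lam c * (x * dx phi).
  by rewrite mulrA -eqn /nfA substM // subst_xvar // subst_lam_of_lam.
have eqx n : c' * xcoef n phi = c * xcoef n phi *+ n.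
  by rewrite -xcoef_of_lamM eqn xcoef_of_lamM xcoef_xdx mulrnAr.
have uc : c \is a GRing.unit by rewrite fps_unitE.
have v0 : xcoef 1 phi mnm0 != 0.
  by move: dphi; rewrite dxE mnm0E add0m mulr1n xcoefE mnm1_e0.
have uv : xcoef 1 phi \is a GRing.unit by rewrite fps_unitE.
have ec : c' = c by have /(mulIr uv) := eqx 1%N.
split=> //; exists (xcoef 1 phi) => //; apply: fpsP => a.
rewrite -[x]expr1 fcoef_of_lamX; case: eqP => [a1|/eqP na].
  by rewrite xcoefE -a1 mcons_eta.
have := eqx (a ord0); rewrite ec -mulrnAr => /(mulrI uc) /(congr1 (fun f : fps K m => f (mtail a))).
rewrite fcoefMn xcoefE mcons_eta; case: (a ord0) na => [|[|i]] // _.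
by rewrite mulrS -{1}[phi a]addr0 => /addrI /esym /eqP; rewrite mulrn_eq0 => /eqP.
Qed.

Lemma nfB_nfA (e : K) (y : 'I_0 -> fps K m) (mu : fps K m) : e + mu mnm0 != 0 ->
  nfB e y mu = nfA (fpsC m e + mu)^-1.
Proof.
move=> u; rewrite nfBE /nf_num /nf_den big_ord0 addr0 expr1 expr0 mulr1 /nfA mulrC -of_lamC.
rewrite -(rmorphD (@of_lam K m)) rmorphV // fps_unitE fcoefD fcoefC eqxx mulr1n.
exact: u.
Qed.

End LinearNormalForm.

Section AnalyticConjugacy.
Variables (K : numFieldType) (m k : nat).
Implicit Types (a b phi : fps K m.+1) (y : 'I_k -> fps K m) (mu : fps K m).
Local Notation x := (xvar K m).
Local Notation lam := (@lamvar K m).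

Lemma nf_conj_eq (e : K) y y' mu mu' phi : e != 0 ->
  (forall j, y j mnm0 = 0) -> (forall j, y' j mnm0 = 0) ->
  (k = 0%N -> mu mnm0 = 0) -> (k = 0%N -> mu' mnm0 = 0) ->
  conjugacy (nfB e y mu) (nfB e y' mu') phi -> dx phi mnm0 = 1 ->
  y' = y /\ mu' = mu.
Proof.
move=> e0 y0 y'0 mu0 mu'0 cphi d1; have [k0|k0] := posnP k; last first.
  by have [-> -> _] := nf_conj_tangent k0 e0 y0 y'0 cphi d1.
move: y y' y0 y'0 cphi mu0 mu'0; rewrite k0 => y y' _ _ cphi /(_ erefl) mu0 /(_ erefl) mu'0.
split; first by apply/funext => -[].
have h (nu : fps K m) : nu mnm0 = 0 -> e + nu mnm0 != 0 by move=> ->; rewrite addr0.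
have u (nu : fps K m) : nu mnm0 = 0 -> fpsC m e + nu \is a GRing.unit.
  by move=> nu0; rewrite fps_unitE fcoefD fcoefC eqxx mulr1n h.
move: cphi; rewrite !nfB_nfA ?h // => /nfA_conj[|ec _]; last first.
  by apply: (addrI (fpsC m e)); apply: invr_inj.
by rewrite -fps_unitE unitrV u.
Qed.

(** Since [eb = ea c^k], dividing [psi] by its linear coefficient leads to a normal form with
    constant [ea]; multiplication by [c] brings any conjugacy to that form back to the original
    target. *)
Lemma conj_tangent_factor (ea eb : K) a y' mu' psi (c := dx psi mnm0) :
  ea != 0 -> eb != 0 -> leading k ea a -> (forall j, y' j mnm0 = 0) ->
  (k = 0%N -> mu' mnm0 = 0) -> conjugacy a (nfB eb y' mu') psi ->
  exists y chi, [/\ psi = fpsC m.+1 c * chi, tangent_nf ea a chi y mu' &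
    forall phi, conjugacy a (nfB ea y mu') phi ->
      conjugacy a (nfB eb y' mu') (fpsC m.+1 c * phi)].
Proof.
move=> ea0 eb0 la y'0 mu'0 cpsi; have c0 : c != 0 by case: cpsi => [[]].
have ee := conj_leading ea0 eb0 la (leading_nfB eb0 y'0 mu'0) cpsi.
pose y (j : 'I_k) := fpsC m (c ^- (k.+1 - j)) * y' j.
have y'E : y' = (fun j : 'I_k => fpsC m (c ^+ (k.+1 - j)) * y j).
  apply/funext => j; rewrite /y mulrA -(rmorphM (fpsC m)) divff ?expf_neq0 //.
  by rewrite rmorph1 mul1r.
have y0 j : y j mnm0 = 0 by rewrite fcoefCM y'0 mulr0.
have sc phi := @conj_scale K m k ea c y mu' a phi c0 (den_ok_mu ea0 mu'0).
have psiE : psi = fpsC m.+1 c * (fpsC m.+1 c^-1 * psi).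
  by rewrite mulrA -(rmorphM (fpsC m.+1)) divff // rmorph1 mul1r.
exists y, (fpsC m.+1 c^-1 * psi); split; first exact: psiE.
  split; [|exact: y0|exact: mu'0|].
    apply/(wge_tangent _ (isT : 1 < k.+2)%N); case: cpsi => [[psi0 _] _].
    split; first by rewrite fcoefCM psi0 mulr0.
    by rewrite dxM dxC mul0r add0r fcoefCM mulVf.
  by have [h _] := sc (fpsC m.+1 c^-1 * psi); apply: h; rewrite -psiE -ee -y'E.
by move=> phi cphi; have [_ h] := sc phi; rewrite y'E ee; apply: h.
Qed.

End AnalyticConjugacy.

Section FormalAnalytic.
Variables (R : realType) (m k : nat).
Local Notation C := R[i]%C.
Local Notation x := (xvar C m).
Local Notation lam := (@lamvar C m).

(* Bring b to its normal form analytically. The tangent transformations of a to its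
   normal form are parametrised by their coefficient of x^(k+1), and truncating
   that coefficient gives an analytic one. *)
Lemma analytic_conj_approx (ea eb : C) (a b phi : fps C m.+1) n :
  analytic a -> analytic b -> ea != 0 -> eb != 0 ->
  leading k ea a -> leading k eb b -> conjugacy a b phi ->
  exists phin, [/\ analytic phin, conjugacy a b phin & wge (@lw m) n (phin - phi)].
Proof.
move=> aa ab ea0 eb0 la lb cphi; have l0 := @lamvar0 C m.
have [phi2 [y' [mu' [aphi2 tphi2 _]]]] :=
  @analytic_tangent_nf R m k eb b 0 0 ab eb0 lb (fun=> fcoef0 _ _) (fun _ _ => fcoef0 _ _).
have [wphi2 y'0 mu'0 cphi2] := tphi2.
have [_ d2] := (wge_tangent phi2 (isT : 1 < k.+2)%N).1 wphi2.
have [ccphi2 _] := cphi2.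
have [sig [asig csig inv]] := analytic_inverse aphi2 ccphi2.
have cbsig := conj_inv csig inv cphi2.
have cpsi := conj_trans cphi cphi2.
have [psi epsi] : exists psi, psi = subst phi2 phi lam by exists (subst phi2 phi lam).
rewrite -epsi in cpsi.
have [y [chi [psiE tchi scal]]] := conj_tangent_factor ea0 eb0 la y'0 mu'0 cpsi.
move: psiE scal; set c := dx psi mnm0 => psiE scal.
have [wchi y0 _ cchi] := tchi.
pose P (d : multinom m) := (wt (fun=> 1%N) d < n)%N.
pose tau : fps C m := Fps (fun d => if P d then xcoef k.+1 (chi - x) d else 0).
have tau0 : k = 0%N -> tau mnm0 = 0.
  move=> k0; rewrite FpsE; case: ifP => // _; rewrite xcoefE k0 wchi //.
  by rewrite wt_xw mdeg0 muln0.
have tauN d : (n <= mdeg d)%N -> tau d = 0 by rewrite FpsE /P wt_mdeg ltnNge => ->.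
have [chin [y3 [mu3 [achin tchin etau]]]] := analytic_tangent_nf aa ea0 la tau0 tauN.
have [wchin y30 mu30 cchin] := tchin.
(* Truncating the free coefficient does not move the normal form: [chi] and [chin] differ by a
   conjugacy between normal forms tangent to the identity. *)
have [ey emu] : y = y3 /\ mu' = mu3.
  have [th [cth _ dth]] := formally_conjugate_cancel cchin cchi.
  have [_ d1] := (wge_tangent chi (isT : 1 < k.+2)%N).1 wchi.
  have [_ d1n] := (wge_tangent chin (isT : 1 < k.+2)%N).1 wchin.
  have {}dth : dx th mnm0 = 1 by rewrite dth d1 d1n divr1.
  exact: nf_conj_eq ea0 y30 y0 mu30 mu'0 cth dth.
have [hag _ _] : [/\ agree P chin chi, forall j d, P d -> y3 j d = y j d
                   & forall d, P d -> mu3 d = mu' d].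
  apply: (@tangent_nf_unique _ _ _ P ea a a chin chi) => //; first exact: dclosed_wt.
  move=> d Pd; have : xcoef k.+1 (chin - x) d = xcoef k.+1 (chi - x) d.
    by rewrite etau FpsE Pd.
  by rewrite !xcoefD !fcoefD => /addIr.
have cpsin : conjugacy a (nfB eb y' mu') (fpsC m.+1 c * chin).
  by apply: scal; rewrite ey emu; exact: cchin.
have [[psin0 _] _] := cpsin; have [[psi0 _] _] := cpsi.
have phiE : phi = subst sig psi lam.
  have [[phi0 _] _] := cphi; have [phi20 _] := ccphi2.
  by rewrite epsi -subst_subst // (inv_left ccphi2 csig inv) subst_xvar.
exists (subst sig (fpsC m.+1 c * chin) lam); split.
- by apply: analytic_subst => //; exact: analyticCM.
- exact: conj_trans cpsin cbsig.
(* With weight 0 on [x] and 1 on lambda, precision [n] is congruence modulo the [n]-th power of the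
   ideal, which composition with the fixed series [sig] preserves. *)
rewrite phiE; suff [_ _ h] : near predT (@lw m) 0 n
    (subst sig (fpsC m.+1 c * chin) lam) (subst sig psi lam) by move=> d; exact: h.
apply: (near_fcomp (w := @lw m)) => // i; rewrite /lw; case: (unliftP ord0 i) => [j|] ei.
  apply: near_refl => d; rewrite -(mcons_eta d) wt_lw ltnS leqn0 mdeg_eq0 => /eqP ->.
  rewrite FpsE; case: eqP => // /(congr1 (fun b : multinom m.+1 => b (lift ord0 j))).
  by rewrite mconsS mnm0E mnm1E eqxx.
split=> // d _; rewrite add0n -{1}(mcons_eta d) wt_lw -wt_mdeg => lt.
by rewrite psiE fcoefD fcoefN !fcoefCM hag // subrr.
Qed.

End FormalAnalytic.

(** * Exponentials of power series and roots of unity *)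

Section Logarithm.
Variables (K : fieldType) (m : nat).
Implicit Types h u v : fps K m.

Let tail h N := \sum_(i < N) fpsC m (i.+2`!%:R^-1) * h ^+ i.+2.

(** [z] is a logarithm of the constant term. For the remaining factor [1 + u], the equation
    [exp h = 1 + u] reads [h = u - tail h], a contraction because [tail] begins with the square of
    [h]. *)
Lemma fps_exp_surj (E : K -> K) v z : E z = v mnm0 -> v mnm0 != 0 ->
  exists t, fps_exp E t = v.
Proof.
move=> Ez v0; pose u := fpsC m (v mnm0)^-1 * v - 1.
have u0 : u mnm0 = 0 by rewrite fcoefD fcoefN fcoefCM mulVf // fcoef1 eqxx subrr.
pose F h := u - Fps (fun a => tail h (mdeg a).+1 a).
have [h [wh Fh _]] : exists h, [/\ wge deg1 1 h, F h = h
    & forall a i, (wt deg1 a < i)%N -> h a = iter i F 0 a].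
  apply: fps_fix => s f g hfg.
  have ht N : near predT deg1 2 s (tail f N) (tail g N).
    apply: near_sum => i _.
    have hc (c : K) : near predT deg1 0 s (fpsC m c) (fpsC m c).
      exact: near_refl (wge_0 _).
    have hX := nearX (@dclosed_predT _) i.+2 hfg.
    apply: (nearW _ _ (nearM (@dclosed_predT _) (hc _) hX)); lia.
  have hT : near predT deg1 2 s (Fps (fun a => tail f (mdeg a).+1 a))
      (Fps (fun a => tail g (mdeg a).+1 a)).
    split=> [a lta|a lta|a Pa lta].
    - by have [w1 _ _] := ht (mdeg a).+1; exact: w1.
    - by have [_ w2 _] := ht (mdeg a).+1; exact: w2.
    by have [_ _ w3] := ht (mdeg a).+1; exact: (w3 a Pa lta).
  apply: nearB; last by apply: nearW hT; lia.
  by apply: near_refl; apply/ord1_mdeg.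
have h0 : h mnm0 = 0 by apply/ord1_mdeg.
have eu a : u a = h a + tail h (mdeg a).+1 a.
  by rewrite -[in h a]Fh fcoefD fcoefN subrK.
have cK : (fpsC m z + h) mnm0 = z by rewrite fcoefD fcoefC eqxx h0 addr0.
exists (fpsC m z + h); rewrite /fps_exp cK Ez addrAC subrr add0r.
have -> : v = fpsC m (v mnm0) * (1 + u).
  by rewrite /u addrC subrK mulrA -rmorphM mulfV // rmorph1 mul1r.
congr (_ * _); last apply: fpsP => a.
  by rewrite fcoefCM fcoefD u0 fcoef1 eqxx addr0 mulr1.
have small i : (mdeg a < i)%N -> (fpsC m (i`!%:R^-1) * h ^+ i) a = 0.
  by move=> lt; rewrite fcoefCM fcoefX_small ?mulr0.
rewrite FpsE fcoefD eu.
(* [tail h (mdeg a).+1] reaches the power [deg a + 2], two more than the truncated exponential; both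
   extra terms vanish at [a]. *)
have -> : \sum_(i < (mdeg a).+1) fpsC m (i`!%:R^-1) * h ^+ i =
    \sum_(i < (mdeg a).+3) fpsC m (i`!%:R^-1) * h ^+ i -
    fpsC m ((mdeg a).+1`!%:R^-1) * h ^+ (mdeg a).+1 -
    fpsC m ((mdeg a).+2`!%:R^-1) * h ^+ (mdeg a).+2.
  by rewrite [in RHS]big_ord_recr [in RHS]big_ord_recr /=; ring.
rewrite !fcoefD !fcoefN !small ?subr0 // 2!big_ord_recl /= 2!fcoefD.
by rewrite fact0 factS fact0 muln1 !invr1 !rmorph1 !mul1r expr0 expr1.
Qed.

End Logarithm.

Section ComplexExponential.
Variable R : realType.
Implicit Types (p q : R) (z w : R[i]%C).

Lemma cexp_surj w : w != 0 -> exists z, cexp z = w.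
Proof.
case: w => a b; set n := a ^+ 2 + b ^+ 2 => w0.
have n0 : 0 < n.
  rewrite lt_neqAle addr_ge0 ?sqr_ge0 // andbT eq_sym; apply: contraNneq w0 => h.
  move: h => /eqP; rewrite paddr_eq0 ?sqr_ge0 // !sqrf_eq0 => /andP[/eqP-> /eqP->].
  by rewrite eq_complex /= !eqxx.
pose r := Num.sqrt n; have r0 : 0 < r by rewrite sqrtr_gt0.
have r2 : r ^+ 2 = n by rewrite sqr_sqrtr // ltW.
pose u := a / r; pose v := b / r.
have uv : u ^+ 2 + v ^+ 2 = 1.
  by rewrite !expr_div_n -mulrDl -/n -r2 divff // expf_neq0 // gt_eqF.
have u1 : -1 <= u <= 1.
  by rewrite -ler_norml -(@ler_pXn2r _ 2) ?nnegrE // expr1n real_normK ?num_real // -uv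
    lerDl sqr_ge0.
have [t [ct st]] : exists t, cos t = u /\ sin t = v.
  have cu : cos (acos u) = u by rewrite acosK // in_itv.
  have su : sin (acos u) = `|v| by rewrite sin_acos // -uv addrC addKr sqrtr_sqr.
  have [v0|v0] := lerP 0 v; first by exists (acos u); rewrite cu su ger0_norm.
  by exists (- acos u); rewrite cosN sinN cu su ltr0_norm // opprK.
exists (ln r +i* t)%C; rewrite /cexp /= lnK ?posrE // ct st.
have h t1 : r * (t1 / r) = t1 by rewrite mulrC divfK // gt_eqF.
by apply/eqP; rewrite eq_complex /= !mul0r subr0 addr0 !h !eqxx.
Qed.

Lemma cexp2piD p q : cexp2pi (p + q) = cexp2pi p * cexp2pi q.
Proof.
rewrite /cexp2pi /cexp /= expR0 mulrDr cosD sinD; apply/eqP; rewrite eq_complex /=.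
by apply/andP; split; apply/eqP; ring.
Qed.

Lemma cexp2pi0 : cexp2pi (0 : R) = 1.
Proof. by rewrite /cexp2pi /cexp /= mulr0 expR0 cos0 sin0 mul1r. Qed.

Lemma cexp2pi1 : cexp2pi (1 : R) = 1.
Proof. by rewrite /cexp2pi /cexp /= mulr1 mulr_natl cos2pi sin2pi expR0 mul1r. Qed.

Lemma cexp2piM q n : cexp2pi (q * n%:R) = cexp2pi q ^+ n.
Proof.
elim: n => [|n IHn]; first by rewrite mulr0 cexp2pi0.
by rewrite mulrSr mulrDr mulr1 cexp2piD IHn exprSr.
Qed.

Lemma cexp2pi_neq0 q : cexp2pi q != 0.
Proof.
apply/eqP => h; have := cexp2piD q (- q); rewrite subrr cexp2pi0 h mul0r.
by apply/eqP/oner_neq0.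
Qed.

(** The double-angle formula turns [cos (2 pi q) = 1] into [sin (pi q) = 0], impossible for [pi q]
    strictly between 0 and [pi]. *)
Lemma cexp2pi_neq1 q : 0 < q < 1 -> cexp2pi q != 1.
Proof.
move=> /andP[q0 q1]; apply/eqP; rewrite /cexp2pi /cexp /= expR0 mul1r.
have -> : 2 * pi * q = (pi * q) *+ 2 by rewrite mulr2n; ring.
move=> /(congr1 (@complex.Re R)) /=; rewrite cos_mulr2n => h.
have := sin2cos2 (pi * q); have : 0 < sin (pi * q).
  by apply: sin_gt0_pi; rewrite mulr_gt0 ?pi_gt0 //= -[X in _ < X]mulr1 ltr_pM2l ?pi_gt0.
move=> /(exprn_gt0 2) s0 e; move: s0; rewrite e.
by lra.
Qed.

Lemma cexp2pi_root k l : (0 < k)%N -> cexp2pi (l%:R / k%:R : R) ^+ k = 1.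
Proof.
move=> k0; rewrite -cexp2piM divfK ?pnatr_eq0 ?gtn_eqF //.
by rewrite -[l%:R]mul1r cexp2piM cexp2pi1 expr1n.
Qed.

Lemma root_cexp2pi k c : (0 < k)%N -> c ^+ k = 1 ->
  exists l : 'I_k, c = cexp2pi (l%:R / k%:R : R).
Proof.
move=> k0 ck; have kn0 : (k%:R : R) != 0 by rewrite pnatr_eq0 gtn_eqF.
have prim : k.-primitive_root (cexp2pi (1%:R / k%:R : R)).
  have [j pj jk] := prim_order_exists k0 (cexp2pi_root 1 k0).
  have [ej|ne] := eqVneq j k; first by rewrite -{1}ej.
  have ltj : (j < k)%N by rewrite ltn_neqAle ne dvdn_leq.
  have j0 := prim_order_gt0 pj; have /eqP[] : cexp2pi (j%:R / k%:R : R) != 1.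
    apply: cexp2pi_neq1; rewrite divr_gt0 ?ltr0n //.
    by rewrite ltr_pdivrMr ?ltr0n // mul1r ltr_nat.
  by rewrite -[RHS](prim_expr_order pj) -cexp2piM mul1r mulrC.
have [l ->] := prim_rootP prim ck; exists l.
by rewrite -cexp2piM mul1r mulrC.
Qed.

End ComplexExponential.

Section NormalFormTheorems.
Variables (K : numFieldType) (m : nat).
Implicit Types (a phi : fps K m.+1) (mu : fps K m) (omega : fps K 1) (c e : K).

Lemma nfA_exists a omega : unfolds 0 a omega ->
  exists c : fps K m, c mnm0 != 0 /\ formally_conjugate a (nfA c).
Proof.
move=> ua; have e0 : omega mnm0 != 0 by case: ua.
have [phi [y [mu [[_ _ mu0 cphi] _]]]] :=
  tangent_nf_exists (tau := 0) e0 (unfolds_leading ua) (fun=> fcoef0 _ _).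
have ne : omega mnm0 + mu mnm0 != 0 by rewrite mu0 // addr0.
exists (fpsC m (omega mnm0) + mu)^-1; split; last by exists phi; rewrite -(nfB_nfA y).
by rewrite -fps_unitE unitrV fps_unitE fcoefD fcoefC eqxx mulr1n.
Qed.

(** The dilation [c] is a parameter, to be chosen according to which roots the field contains. *)
Lemma nfB_exists k a omega c : (0 < k)%N -> unfolds k a omega -> c != 0 ->
  exists (y : 'I_k -> fps K m) mu,
    [/\ forall j, y j mnm0 = 0,
        formally_conjugate a (nfB (omega mnm0 * c ^+ k) y mu),
        residue_infty (nfB_den k (omega mnm0 * c ^+ k) mu) (nfB_num y) (- mu)
      & residue_sum a mu].
Proof.
move=> k0 ua c0; have e0 : omega mnm0 != 0 by case: ua.
have la := unfolds_leading ua.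
have [phi [y [mu [[_ y0 mu0 cphi] _]]]] :=
  tangent_nf_exists (tau := 0) e0 la (fun=> fcoef0 _ _).
exists (fun j : 'I_k => fpsC m (c ^+ (k.+1 - j)) * y j), mu; split.
- by move=> j; rewrite fcoefCM y0 mulr0.
- by exists (fpsC m.+1 c * phi); apply/conj_scale => //; exact: den_ok_mu.
- exact: residue_infty_nfB.
have i0 : (omega mnm0)^-1 != 0 by rewrite invr_eq0.
by apply: (residue_sum_conj k0 e0 y0 i0 _ cphi); apply/leadingP.
Qed.

Lemma nfB_conjP k e e' (y y' : 'I_k -> fps K m) mu mu' a : (0 < k)%N ->
  e != 0 -> e' != 0 -> (forall j, y j mnm0 = 0) -> (forall j, y' j mnm0 = 0) ->
  formally_conjugate a (nfB e y mu) ->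
  formally_conjugate a (nfB e' y' mu') <->
  mu' = mu /\ exists c, [/\ c != 0, e' = e * c ^+ k &
    forall j : 'I_k, y' j = fpsC m (c ^+ (k.+1 - j)) * y j].
Proof.
move=> k0 e0 e'0 y0 y'0 [phi cphi]; split=> [[phi' cphi']|[-> [c [c0 -> y'E]]]].
  have [chi [cchi _ _]] := formally_conjugate_cancel cphi cphi'.
  have [ee emu ey _] := nf_conj k0 e0 e'0 y0 y'0 cchi.
  by split=> //; exists (dx chi mnm0); split=> //; case: cchi => [[]].
exists (fpsC m.+1 c * phi).
have -> : y' = (fun j : 'I_k => fpsC m (c ^+ (k.+1 - j)) * y j) by apply/funext.
apply/conj_scale => //; apply: den_ok_mu => // ek; by rewrite ek in k0.
Qed.

Lemma nfA_unique (c c' : fps K m) a : c mnm0 != 0 ->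
  formally_conjugate a (nfA c) -> formally_conjugate a (nfA c') -> c = c'.
Proof.
move=> c0 [phi cphi] [phi' cphi'].
by have [chi [/(nfA_conj c0)[-> _] _ _]] := formally_conjugate_cancel cphi cphi'.
Qed.

End NormalFormTheorems.

Section Rotations.
Variable R : realType.

(* c^(k+1-j) = c^(1-j) for a k-th root of unity c. *)
Lemma cexp2pi_weight k (l j : 'I_k) : (0 < k)%N ->
  cexp2pi (- ((j%:R - 1) * l%:R / k%:R) : R) = cexp2pi (l%:R / k%:R : R) ^+ (k.+1 - j).
Proof.
move=> k0; apply: (mulIf (expf_neq0 j (cexp2pi_neq0 (l%:R / k%:R : R)))).
rewrite -exprD subnK 1?ltnW ?ltnS //; last exact: leq_trans (ltn_ord j) (leqnSn k).
rewrite exprS cexp2pi_root // mulr1 -cexp2piM -cexp2piD; congr cexp2pi.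
by ring.
Qed.

Lemma sign_root_cexp2pi k (r : R) : (0 < k)%N -> r ^+ k = 1 ->
  exists l : 'I_k, (r%:C)%C = cexp2pi (l%:R / k%:R : R).
Proof. by move=> k0 rk; apply: root_cexp2pi => //; rewrite -rmorphXn /= rk. Qed.

Lemma cexp2pi_sign_root k (l : nat) (r : R) : (0 < k)%N ->
  (r%:C)%C = cexp2pi (l%:R / k%:R : R) -> r ^+ k = 1.
Proof.
move=> k0 e; apply: (@complexI R); rewrite rmorphXn /= e cexp2pi_root //.
Qed.

Lemma sign_weight k (r : R) (j : 'I_k) : r != 0 -> r ^+ k = 1 ->
  r ^ (- (j%:Z - 1)) = r ^+ (k.+1 - j).
Proof.
move=> r0 rk; apply: (mulIf (expf_neq0 j r0)).
rewrite -exprD subnK; last exact: leq_trans (ltnW (ltn_ord j)) (leqnSn k).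
rewrite exprS rk mulr1 exprnP -expfzDr //.
by have -> : - (j%:Z - 1) + j = 1 by ring.
Qed.

(* For odd k both constant terms of the denominators are 1, for even k c^k = 1. *)
Lemma sign_scale k (s s' c : R) : (0 < k)%N -> s = 1 \/ s = -1 -> s' = 1 \/ s' = -1 ->
  s' ^+ k.+1 = s ^+ k.+1 * c ^+ k ->
  [/\ s' ^+ k.+1 = s ^+ k.+1, c ^+ k = 1 & c = 1 \/ c = -1].
Proof.
move=> k0 hs hs' e.
have n1 (t : R) i : t = 1 \/ t = -1 -> `|t ^+ i| = 1.
  by case=> ->; rewrite ?expr1n ?normr1 // normrX normrN1 expr1n.
have nc : `|c| = 1.
  apply/eqP; rewrite -(@pexpr_eq1 _ _ k) // -normrX.
  by have := congr1 Num.norm e; rewrite normrM (n1 s') // (n1 s) // mul1r => <-.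
have hc : c = 1 \/ c = -1.
  have [c0|c0] := lerP 0 c; [left|right]; first by rewrite -nc ger0_norm.
  by rewrite -nc ltr0_norm // opprK.
have ev (t : R) i : ~~ odd i -> t = 1 \/ t = -1 -> t ^+ i = 1.
  by move=> /negbTE o [] ->; rewrite ?expr1n // -signr_odd o.
have [ok|nk] := boolP (odd k).
  have h t : t = 1 \/ t = -1 -> t ^+ k.+1 = 1 :> R by apply: ev; rewrite /= ok.
  by move: e; rewrite !h // mul1r => <-.
by move: e; rewrite (ev c k) // mulr1 => ->.
Qed.

(** [d] is the positive [k]-th root of [1/|w|]. The sign of [w] is absorbed by [c^k] for odd [k],
    and remains as [s^(k+1) = s] for even [k]. *)
Lemma sign_normalisation k (w : R) : (0 < k)%N -> w != 0 ->
  exists s c, [/\ s = 1 \/ s = -1, c != 0 & w * c ^+ k = s ^+ k.+1].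
Proof.
move=> k0 w0; pose d := expR (- ln `|w| / k%:R).
have dk : d ^+ k = `|w|^-1.
  by rewrite -expRM_natr divfK ?pnatr_eq0 ?gtn_eqF // expRN lnK // posrE normr_gt0.
have nw : `|w| != 0 by rewrite normr_eq0.
have sw : w = Num.sg w * `|w| by rewrite -numEsg.
have d0 : d != 0 by rewrite gt_eqF // expR_gt0.
have hs : Num.sg w = 1 \/ Num.sg w = -1.
  by case: sgrP w0 => // _ _; [left|right].
have [ok|nk] := boolP (odd k).
  exists 1, (Num.sg w * d); split; [by left|by rewrite mulf_neq0 // sgr_eq0|].
  rewrite expr1n exprMn dk; case: hs => hs; rewrite hs; rewrite hs in sw; rewrite {1}sw.
    by rewrite expr1n !mul1r divff.
  by rewrite -signr_odd ok expr1 mulN1r mulN1r mulrNN divff.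
exists (Num.sg w), d; split => //; rewrite dk {1}sw mulfK // exprS.
by case: hs => ->; rewrite ?expr1n ?mulr1 // -signr_odd (negbTE nk) mulr1.
Qed.

End Rotations.

Local Open Scope complex_scope.

Theorem theorem3p3 (R : realType) (k : nat) :
  (* (1a) *)
  (forall (m : nat) (a : fps R[i] m.+1) (omega : fps R[i] 1),
     unfolds k a omega ->
     (k = 0%N ->
        exists c : fps R[i] m,
          c mnm0 != 0 /\ formally_conjugate a (nfA c)) /\
     ((0 < k)%N ->
        exists (y : 'I_k -> fps R[i] m) (mu : fps R[i] m),
          [/\ forall j, y j mnm0 = 0,
              formally_conjugate a (nfB 1 y mu),
              residue_infty (nfB_den k 1 mu) (nfB_num y) (- mu)
            & residue_sum a mu])) /\
  (* (1b) *)
  (k = 0%N ->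
     forall (m : nat) (c c' : fps R[i] m),
       c mnm0 != 0 -> c' mnm0 != 0 ->
       (forall a : fps R[i] m.+1,
          formally_conjugate a (nfA c) -> formally_conjugate a (nfA c') ->
          c = c') /\
       (forall phi : fps R[i] m.+1, conjugacy (nfA c) (nfA c') phi ->
          exists t : fps R[i] m,
            phi = of_lam (fps_exp (@cexp R) t) * xvar _ m)) /\
  ((0 < k)%N ->
     forall (m : nat) (y y' : 'I_k -> fps R[i] m) (mu mu' : fps R[i] m),
       (forall j, y j mnm0 = 0) -> (forall j, y' j mnm0 = 0) ->
       (forall a : fps R[i] m.+1,
          formally_conjugate a (nfB 1 y mu) ->
          (k = 1%N -> formally_conjugate a (nfB 1 y' mu') ->
             y = y' /\ mu = mu') /\
          (formally_conjugate a (nfB 1 y' mu') <->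
             mu' = mu /\
             exists l : 'I_k, forall j : 'I_k,
               y' j = fpsC m (cexp2pi (- ((j%:R - 1) * l%:R / k%:R))) * y j)) /\
       (forall phi : fps R[i] m.+1, conjugacy (nfB 1 y mu) (nfB 1 y' mu') phi ->
          exists (l : 'I_k) (t : fps R[i] m) (psi : fps R[i] m.+1),
            is_flow (nfB 1 y mu) t psi /\
            phi = fpsC m.+1 (cexp2pi (l%:R / k%:R)) * psi)) /\
  (* (1c) *)
  ((0 < k)%N ->
     forall mu : R[i],
       at_lam0 (X3 k 1 mu) =
         xvar _ 0 ^+ k.+1 / (1 + fpsC 1 mu * xvar _ 0 ^+ k) /\
       universal (X3 k 1 mu)) /\
  (* (1d), real version of (1a) *)
  (forall (m : nat) (a : fps R m.+1) (omega : fps R 1),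
     unfolds k a omega ->
     (k = 0%N ->
        exists c : fps R m,
          c mnm0 != 0 /\ formally_conjugate a (nfA c)) /\
     ((0 < k)%N ->
        exists (s : R) (y : 'I_k -> fps R m) (mu : fps R m),
          [/\ s = 1 \/ s = -1,
              forall j, y j mnm0 = 0,
              formally_conjugate a (nfB (s ^+ k.+1) y mu),
              residue_infty (nfB_den k (s ^+ k.+1) mu) (nfB_num y) (- mu)
            & residue_sum a mu])) /\
  (* (1d), real version of (1b) *)
  (k = 0%N ->
     forall (m : nat) (c c' : fps R m),
       c mnm0 != 0 -> c' mnm0 != 0 ->
       (forall a : fps R m.+1,
          formally_conjugate a (nfA c) -> formally_conjugate a (nfA c') ->
          c = c') /\
       (forall phi : fps R m.+1, conjugacy (nfA c) (nfA c') phi ->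
          exists (s : R) (t : fps R m),
            (s = 1 \/ s = -1) /\
            phi = fpsC m.+1 s * of_lam (fps_exp (@expR R) t) * xvar _ m)) /\
  ((0 < k)%N ->
     forall (m : nat) (s s' : R) (y y' : 'I_k -> fps R m) (mu mu' : fps R m),
       s = 1 \/ s = -1 -> s' = 1 \/ s' = -1 ->
       (forall j, y j mnm0 = 0) -> (forall j, y' j mnm0 = 0) ->
       (forall a : fps R m.+1,
          formally_conjugate a (nfB (s ^+ k.+1) y mu) ->
          (k = 1%N -> formally_conjugate a (nfB (s' ^+ k.+1) y' mu') ->
             y = y' /\ mu = mu') /\
          (formally_conjugate a (nfB (s' ^+ k.+1) y' mu') <->
             [/\ s' ^+ k.+1 = s ^+ k.+1, mu' = mu
               & exists (l : 'I_k) (r : R),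
                   [/\ r = 1 \/ r = -1,
                       r%:C = cexp2pi (l%:R / k%:R)
                     & forall j : 'I_k,
                         y' j = fpsC m (r ^ (- (j%:Z - 1))) * y j]])) /\
       (forall phi : fps R m.+1,
          conjugacy (nfB (s ^+ k.+1) y mu) (nfB (s' ^+ k.+1) y' mu') phi ->
          exists (l : 'I_k) (r : R) (t : fps R m) (psi : fps R m.+1),
            [/\ r = 1 \/ r = -1,
                r%:C = cexp2pi (l%:R / k%:R),
                is_flow (nfB (s ^+ k.+1) y mu) t psi
              & phi = fpsC m.+1 r * psi])) /\
  (* (1d), real version of (1c) *)
  ((0 < k)%N ->
     forall s mu : R, s = 1 \/ s = -1 ->
       at_lam0 (X3 k (s ^+ k.+1) mu) =
         xvar _ 0 ^+ k.+1 / (fpsC 1 (s ^+ k.+1) + fpsC 1 mu * xvar _ 0 ^+ k) /\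
       universal (X3 k (s ^+ k.+1) mu)) /\
  (* (2) *)
  (forall (m : nat) (a b : fps R[i] m.+1) (omega omega' : fps R[i] 1),
     analytic a -> analytic b -> analytic omega -> analytic omega' ->
     unfolds k a omega -> unfolds k b omega' ->
     (formally_conjugate a b <-> analytically_conjugate a b) /\
     (forall phi : fps R[i] m.+1, conjugacy a b phi ->
        forall n : nat, (0 < n)%N ->
          exists phin : fps R[i] m.+1,
            [/\ analytic phin, conjugacy a b phin
              & ideal_pow (@vanish_at_lam0 _ m) n (phin - phi)])).
Proof.
have n1 (r : R) : r = 1 \/ r = -1 -> r != 0.
  by case=> ->; rewrite ?oppr_eq0 oner_eq0.
have C1 : (1 : R[i]) != 0 by exact: oner_neq0.
split=> [m a omega ua|].
  have w0 : omega mnm0 != 0 by case: ua.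
  split=> [k0|k0]; first by apply: (@nfA_exists _ m a omega); rewrite -k0.
  (* The dilation that turns the constant [omega(0)] of the denominator into 1. *)
  pose c : R[i] := k.-root (omega mnm0)^-1.
  have ck : omega mnm0 * c ^+ k = 1 by rewrite rootCK // divff.
  have c0 : c != 0.
    by apply: contraNneq C1 => c0; rewrite -ck c0 expr0n gtn_eqF // mulr0.
  by have := nfB_exists k0 ua c0; rewrite ck.
split=> [k0 m c c' c0 c'0|].
  split=> [a|phi /(nfA_conj c0)[_ [v v0 ->]]]; first exact: nfA_unique.
  have [z ez] := cexp_surj v0; have [t <-] := fps_exp_surj ez v0.
  by exists t.
split=> [k0 m y y' mu mu' y0 y'0|].
  split=> [a ca|phi cphi].
    have iffP : formally_conjugate a (nfB 1 y' mu') <->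
        mu' = mu /\ exists l : 'I_k, forall j : 'I_k,
          y' j = fpsC m (cexp2pi (- ((j%:R - 1) * l%:R / k%:R))) * y j.
      split=> [/(nfB_conjP mu' k0 C1 C1 y0 y'0 ca)[-> [c [c0 ck y'E]]]|[-> [l y'E]]].
        split=> //; move: ck; rewrite mul1r => /esym /(root_cexp2pi k0)[l ec].
        by exists l => j; rewrite cexp2pi_weight // -ec.
      apply/(nfB_conjP _ k0 C1 C1 y0 y'0 ca); split=> //.
      exists (cexp2pi (l%:R / k%:R)); split=> [||j]; first exact: cexp2pi_neq0.
        by rewrite cexp2pi_root // mulr1.
      by rewrite -cexp2pi_weight.
    split=> // k1 /iffP[-> [l y'E]]; split=> //; apply/funext => j.
    have l0 : l = 0%N :> nat by have := ltn_ord l; move: (l : nat) => i; rewrite k1; case: i.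
    by rewrite y'E l0 mulr0 mul0r oppr0 cexp2pi0 rmorph1 mul1r.
  have [ee _ _ [t [psi [ft ->]]]] := nf_conj k0 C1 C1 y0 y'0 cphi.
  move: ee; rewrite mul1r => /esym /(root_cexp2pi k0)[l ->].
  by exists l, t, psi.
split=> [k0 mu|].
  split; last exact: universal_X3.
  by rewrite at_lam0_X3 // rmorph1.
split=> [m a omega ua|].
  have w0 : omega mnm0 != 0 by case: ua.
  split=> [k0|k0]; first by apply: (@nfA_exists _ m a omega); rewrite -k0.
  have [s [c [hs c0 es]]] := sign_normalisation k0 w0.
  have := nfB_exists k0 ua c0; rewrite es => -[y [mu [h1 h2 h3 h4]]].
  by exists s, y, mu.
split=> [k0 m c c' c0 c'0|].
  split=> [a|phi /(nfA_conj c0)[_ [v v0 ->]]]; first exact: nfA_unique.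
  (* The real exponential reaches only series with positive constant term, so the sign of [v(0)] is
     split off. *)
  pose s := Num.sg (v mnm0).
  have ss : s * s = 1 by rewrite /s -expr2 sqr_sg v0.
  have nv : 0 < `|v mnm0| by rewrite normr_gt0.
  have ev : (fpsC m s * v) mnm0 = `|v mnm0| by rewrite fcoefCM normrEsg.
  have ez : expR (ln `|v mnm0|) = (fpsC m s * v) mnm0 by rewrite ev lnK.
  have [|t et] := fps_exp_surj ez; first by rewrite ev gt_eqF.
  exists s, t; split.
    by rewrite /s; case: sgrP v0 => // _ _; [left|right].
  by rewrite et of_lamCM !mulrA -(rmorphM (fpsC m.+1)) ss rmorph1 mul1r.
split=> [k0 m s s' y y' mu mu' hs hs' y0 y'0|].
  have e0 : s ^+ k.+1 != 0 by rewrite expf_neq0 // n1.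
  have e'0 : s' ^+ k.+1 != 0 by rewrite expf_neq0 // n1.
  split=> [a ca|phi cphi].
    have iffP : formally_conjugate a (nfB (s' ^+ k.+1) y' mu') <->
        [/\ s' ^+ k.+1 = s ^+ k.+1, mu' = mu
          & exists (l : 'I_k) (r : R), [/\ r = 1 \/ r = -1,
              r%:C = cexp2pi (l%:R / k%:R)
            & forall j : 'I_k, y' j = fpsC m (r ^ (- (j%:Z - 1))) * y j]].
      split=> [/(nfB_conjP mu' k0 e0 e'0 y0 y'0 ca)[-> [c [c0 ee y'E]]]
              |[ee -> [l [r [hr er y'E]]]]].
        have [ess ck hc] := sign_scale k0 hs hs' ee; split=> //.
        have [l el] := sign_root_cexp2pi k0 ck; exists l, c; split=> // j.
        by rewrite sign_weight.
      have rk := cexp2pi_sign_root k0 er.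
      apply/(nfB_conjP _ k0 e0 e'0 y0 y'0 ca); split=> //.
      exists r; split=> [||j]; [exact: n1|by rewrite rk mulr1|].
      by rewrite -sign_weight // n1.
    split=> // k1 /iffP[_ -> [l [r [hr er y'E]]]]; split=> //; apply/funext => j.
    have r1 : r = 1.
      by have := cexp2pi_sign_root k0 er; rewrite k1 expr1.
    by rewrite y'E r1 exp1rz rmorph1 mul1r.
  have [ee _ _ [t [psi [ft ephi]]]] := nf_conj k0 e0 e'0 y0 y'0 cphi.
  have [_ ck hc] := sign_scale k0 hs hs' ee.
  have [l el] := sign_root_cexp2pi k0 ck.
  by exists l, (dx phi mnm0), t, psi.
split=> [k0 s mu hs|].
  have e0 : s ^+ k.+1 != 0 by rewrite expf_neq0 // n1.
  by split; [exact: at_lam0_X3|exact: universal_X3].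
move=> m a b omega omega' aa ab _ _ ua ub.
have approx phi n : conjugacy a b phi -> exists phin,
    [/\ analytic phin, conjugacy a b phin & wge (@lw m) n (phin - phi)].
  by apply: analytic_conj_approx aa ab _ _ (unfolds_leading ua) (unfolds_leading ub);
    [case: ua|case: ub].
split=> [|phi cphi n _].
  split=> [[phi /(approx _ 1%N)[phin [h1 h2 _]]]|[phi [_ cphi]]]; last by exists phi.
  by exists phin.
have [phin [h1 h2 h3]] := approx phi n cphi.
by exists phin; split=> //; exact: ideal_pow_lam.
Qed.
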